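(* Fix $n\in\mathbb{Z}_{>0}$. Let $\alpha$ be a weak composition with $n$ parts. Let $P_1$ be an increasing tableau with $\mathrm{wt}(K_-(P_1))=\alpha$. Let $N$ be an integer with $N>n$ and $N>\max(P_1)$. Suppose $w\in S_+$ fixes $1,2,\dots,N$. Then $$\mathfrak{L}_\alpha^{(\beta)}\times G_w^{(\beta)}(x_1,\dots,x_n)=\sum_P \beta^{|P|-\ell(w)-|\alpha|}\,\mathfrak{L}^{(\beta)}_{\mathrm{wt}(\mathrm{cap}_n(K_-(P)))},$$ where the sum is over all increasing tableaux $P$ with at most $n$ rows such that (i) the cells of $P$ whose entries are smaller than $N$ form exactly the tableau $P_1$ (i.e. ignoring entries of $P$ larger than $N$ gives $P_1$), and (ii) the subword of $\mathrm{word}(P)$ consisting of the letters larger than $N$ is a Hecke word of $w$.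
   Context: Tableaux are drawn in English convention on Young diagrams of partitions (row 1 on top, column 1 leftmost); $T(r,c)$ is the entry in row $r$, column $c$; $|P|$ is the number of cells. An increasing tableau is a filling with positive integers, strictly increasing along rows (left to right) and columns (top to bottom). For a tableau $T$, $T_j$ denotes the set of entries in column $j$. A key is a tableau whose columns are strictly increasing and satisfy $T_1\supseteq T_2\supseteq\cdots$. For finite $S,T\subseteq\mathbb{Z}_{>0}$, $T\triangleleft S$ is computed as follows: go through the elements of $S$ from largest to smallest; each $s$ picks the largest element of $T$ that is less than $s$ and not yet picked (if one exists); $T\triangleleft S$ is the set of picked elements. Iterated expressions are evaluated right to left. The left key $K_-(P)$ of an increasing tableau $P$ is the key of the same shape whose column $j$ consists (in increasing order) of $P_1\triangleleft(P_2\triangleleft(\cdots\triangleleft P_j))$. For a key $T$ with at most $n$ rows, $\mathrm{cap}_n(T)$ is obtained by replacing, in each column, the entries larger than $n$ by the largest integers in $[n]$ missing from that column, and then sorting each column increasingly. For a tableau $T$ with entries in $[n]$, $\mathrm{wt}(T)$ is the weak composition whose $i$th entry is the number of entries equal to $i$. For a weak composition $\alpha=(\alpha_1,\dots,\alpha_n)$ (sequence of $n$ nonnegative integers), $|\alpha|=\sum\alpha_i$ and $x^\alpha=\prod x_i^{\alpha_i}$. The reading word $\mathrm{word}(P)$ reads columns left to right, each column bottom to top. $S_+$ is the group of permutations of $\mathbb{Z}_{>0}$ moving finitely many elements; $s_i$ swaps $i,i+1$; a reduced word of $w$ is a word $a_1\cdots a_l$ of minimal length with $w=s_{a_1}\cdots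 s_{a_l}$, and $\ell(w)=l$. The 0-Hecke equivalence $\equiv_H$ on words in positive integers is generated by $ii\equiv_H i$, $i(i+1)i\equiv_H(i+1)i(i+1)$, $ij\equiv_H ji$ for $|i-j|\ge2$; a word $a$ is a Hecke word of $w$ (written $[a]_H=w$) if $a\equiv_H b$ for a reduced word $b$ of $w$. A compatible pair is a pair of words $(a,i)=(a_1\cdots a_m,i_1\cdots i_m)$ of equal length with $i$ weakly increasing and $i_j=i_{j+1}\Rightarrow a_j>a_{j+1}$. The stable Grothendieck function is $G_w^{(\beta)}=\sum \beta^{\ell(a)-\ell(w)}x^{\mathrm{wt}(i)}$ over compatible pairs $(a,i)$ with $[a]_H=w^{-1}$, where $\mathrm{wt}(i)_j$ is the number of $j$'s in $i$; $G_w^{(\beta)}(x_1,\dots,x_n)$ is obtained by setting $x_{n+1}=x_{n+2}=\cdots=0$. Lascoux polynomials: a reverse set-valued tableau (RSVT) is a filling of a Young diagram with nonempty subsets of $[n]$ such that $\min T(r,c)\ge\max T(r,c+1)$ and $\min T(r,c)>\max T(r+1,c)$; $L(T)$ keeps the largest element of each cell; $\mathrm{wt}(T)_i$ is the number of cells containing $i$. For an RSSYT $T$ (row weakly decreasing, column strictly decreasing), $K_-(T)$ is the key whose column $i$ is $T_1\trianglerighteq(T_2\trianglerighteq(\cdots(T_{i-1}\trianglerighteq T_i)))$, where $T\trianglerighteq S$ is computed by going through $S$ from smallest to largest, each $s$ picking the smallest not-yet-picked $t\in T$ with $t\ge s$, and taking the picked set. $\mathrm{key}(\alpha)$ is the key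 whose column $c$ is $\{i:\alpha_i\ge c\}$. Then $\mathfrak{L}_\alpha^{(\beta)}=\sum_T \beta^{|\mathrm{wt}(T)|-|\alpha|}x^{\mathrm{wt}(T)}$ over RSVTs $T$ of the same shape as $\mathrm{key}(\alpha)$ with $K_-(L(T))\le\mathrm{key}(\alpha)$ entrywise. *)

(* Defs.v *)
From Stdlib Require Import ClassicalEpsilon.
From mathcomp Require Import all_boot all_algebra.
From mathcomp Require Import mpoly.
Set Implicit Arguments. Unset Strict Implicit. Unset Printing Implicit Defensive.
Import GRing.Theory.

(* Finite sums over the (finite) set of objects satisfying a predicate.
   If the set {x | A x} is finite, [fsum A F] is the sum of F over it
   (independent of the enumeration chosen); otherwise it is 0.          *)
Definition fsum (T : eqType) (V : nmodType) (A : T -> Prop) (F : T -> V) : V :=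
  match excluded_middle_informative
          (exists s : seq T, uniq s /\ forall x, x \in s <-> A x) with
  | left H => \sum_(x <- proj1_sig (constructive_indefinite_description _ H)) F x
  | right _ => 0%R
  end.

(* Tableaux: list of rows (row 1 first), each row listed left to right. *)

Definition ncols (A : Type) (T : seq (seq A)) : nat := size (head [::] T).

Definition col (A : Type) (x0 : A) (T : seq (seq A)) (j : nat) : seq A :=
  [seq nth x0 r j | r <- T & j < size r].

Definition columns (A : Type) (x0 : A) (T : seq (seq A)) : seq (seq A) :=
  [seq col x0 T j | j <- iota 0 (ncols T)].

Definition of_cols (A : Type) (x0 : A) (cs : seq (seq A)) : seq (seq A) :=
  [seq [seq nth x0 c r | c <- cs & r < size c] | r <- iota 0 (size (head [::] cs))].

Definition is_shape (A : Type) (T : seq (seq A)) : bool :=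
  sorted geq (map size T) && all (fun r => 0 < size r) T.

Definition increasing_tableau (P : seq (seq nat)) : bool :=
  [&& is_shape P, all (all (fun x => 0 < x)) P, all (sorted ltn) P
    & all (sorted ltn) (columns 0 P)].

Fixpoint iter_op (op : seq nat -> seq nat -> seq nat) (cs : seq (seq nat)) : seq nat :=
  match cs with
  | [::] => [::]
  | [:: c] => c
  | c :: cs' => op c (iter_op op cs')
  end.

Definition pick_lt (avail : seq nat) (s : nat) : option nat :=
  let c := [seq t <- avail | t < s] in
  if c is [::] then None else Some (\max_(t <- c) t).

Fixpoint tri_rec (avail Sdesc : seq nat) : seq nat :=
  match Sdesc with
  | [::] => [::]
  | s :: S' => match pick_lt avail s with
               | Some t => t :: tri_rec (rem t avail) S'
               | None => tri_rec avail S'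
               end
  end.

Definition tri (T S : seq nat) : seq nat :=
  sort leq (tri_rec (undup T) (sort geq (undup S))).

Definition left_key (P : seq (seq nat)) : seq (seq nat) :=
  of_cols 0 [seq iter_op tri (take j.+1 (columns 0 P)) | j <- iota 0 (ncols P)].

Definition cap_col (n : nat) (c : seq nat) : seq nat :=
  sort leq ([seq x <- c | x <= n] ++
            take (count (fun x => n < x) c) (sort geq [seq i <- iota 1 n | i \notin c])).

Definition cap (n : nat) (T : seq (seq nat)) : seq (seq nat) :=
  of_cols 0 (map (cap_col n) (columns 0 T)).

Definition wt_seq (n : nat) (s : seq nat) : seq nat := [seq count_mem i s | i <- iota 1 n].
Definition wt (n : nat) (T : seq (seq nat)) : seq nat := wt_seq n (flatten T).

Definition word (P : seq (seq nat)) : seq nat := flatten (map (@rev nat) (columns 0 P)).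

Definition restrict (N : nat) (P : seq (seq nat)) : seq (seq nat) :=
  [seq r <- map (filter (fun x => x <= N)) P | r != [::]].

(* S_+ : permutations of Z_{>0} (as functions on nat fixing 0) moving
   finitely many elements. *)
Definition s_ (i : nat) (x : nat) : nat :=
  if x == i then i.+1 else if x == i.+1 then i else x.

Definition perm_of_word (a : seq nat) : nat -> nat :=
  foldr (fun i f x => s_ i (f x)) id a.

Definition in_Splus (w : nat -> nat) : Prop :=
  bijective w /\ w 0 = 0 /\ exists M, forall x, M < x -> w x = x.

Definition reduced_word (w : nat -> nat) (b : seq nat) : Prop :=
  all (fun i => 0 < i) b /\ perm_of_word b =1 w /\
  forall c, all (fun i => 0 < i) c -> perm_of_word c =1 w -> size b <= size c.

Definition ell (w : nat -> nat) : nat :=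
  match excluded_middle_informative (exists b, reduced_word w b) with
  | left H => size (proj1_sig (constructive_indefinite_description _ H))
  | right _ => 0
  end.

Inductive hecke_step : seq nat -> seq nat -> Prop :=
  | hs_idem u v i : hecke_step (u ++ [:: i; i] ++ v) (u ++ [:: i] ++ v)
  | hs_braid u v i : hecke_step (u ++ [:: i; i.+1; i] ++ v) (u ++ [:: i.+1; i; i.+1] ++ v)
  | hs_comm u v i j : (i + 2 <= j) || (j + 2 <= i) ->
                      hecke_step (u ++ [:: i; j] ++ v) (u ++ [:: j; i] ++ v).

Inductive hecke_equiv : seq nat -> seq nat -> Prop :=
  | he_refl a : hecke_equiv a a
  | he_step a b : hecke_step a b -> hecke_equiv a b
  | he_sym a b : hecke_equiv a b -> hecke_equiv b a
  | he_trans a b c : hecke_equiv a b -> hecke_equiv b c -> hecke_equiv a c.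

Definition hecke_word (w : nat -> nat) (a : seq nat) : Prop :=
  exists b, reduced_word w b /\ hecke_equiv a b.

Definition monomial (R : comNzRingType) (n : nat) (al : seq nat) : {mpoly R[n]} :=
  (\prod_(i < n) 'X_i ^+ nth 0 al i)%R.

Definition compatible (p : seq nat * seq nat) : bool :=
  let: (a, i) := p in
  [&& size a == size i, sorted leq i &
      all (fun j => (nth 0 i j == nth 0 i j.+1) ==> (nth 0 a j.+1 < nth 0 a j))
          (iota 0 (size i).-1)].

(* G_w^{(beta)}(x_1..x_n): compatible pairs (a,i), [a]_H = w^{-1},
   letters of i in [n] (the others vanish when x_{n+1} = ... = 0). *)
Definition groth (R : comNzRingType) (n : nat) (beta : R) (w : nat -> nat) : {mpoly R[n]} :=
  fsum (fun p : seq nat * seq nat =>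
          compatible p /\ all (fun k => (0 < k) && (k <= n)) p.2 /\
          exists v : nat -> nat, (forall x, v (w x) = x /\ w (v x) = x) /\ hecke_word v p.1)
       (fun p => beta ^+ (size p.1 - ell w) *: monomial R n (wt_seq n p.2))%R.

Definition key_rev (n : nat) (al : seq nat) : seq (seq nat) :=
  of_cols 0 [seq rev [seq i <- iota 1 n | c <= nth 0 al i.-1] | c <- iota 1 (\max_(a <- al) a)].

Definition pick_ge (avail : seq nat) (s : nat) : option nat :=
  let c := [seq t <- avail | s <= t] in
  if c is [::] then None else Some (head 0 (sort leq c)).

Fixpoint trie_rec (avail Sinc : seq nat) : seq nat :=
  match Sinc with
  | [::] => [::]
  | s :: S' => match pick_ge avail s with
               | Some t => t :: trie_rec (rem t avail) S'
               | None => trie_rec avail S'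
               end
  end.

Definition trie (T S : seq nat) : seq nat :=
  sort leq (trie_rec (undup T) (sort leq (undup S))).

Definition left_key_rev (T : seq (seq nat)) : seq (seq nat) :=
  of_cols 0 [seq sort geq (iter_op trie (take j.+1 (columns 0 T))) | j <- iota 0 (ncols T)].

(* reverse set-valued tableau with entries in [n]; each cell a nonempty set,
   represented as a strictly increasing list *)
Definition rsvt (n : nat) (T : seq (seq (seq nat))) : Prop :=
  is_shape T /\
  all (all (fun c => [&& 0 < size c, sorted ltn c & all (fun x => (0 < x) && (x <= n)) c])) T /\
  (forall r c, c.+1 < size (nth [::] T r) ->
     last 0 (nth [::] (nth [::] T r) c.+1) <= head 0 (nth [::] (nth [::] T r) c)) /\
  (forall r c, c < size (nth [::] T r.+1) ->
     last 0 (nth [::] (nth [::] T r.+1) c) < head 0 (nth [::] (nth [::] T r) c)).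

Definition Lmax (T : seq (seq (seq nat))) : seq (seq nat) := map (map (last 0)) T.

Definition wt_sv (n : nat) (T : seq (seq (seq nat))) : seq nat :=
  [seq count (fun c => i \in c) (flatten T) | i <- iota 1 n].

Definition tab_le (A B : seq (seq nat)) : Prop :=
  forall r c, c < size (nth [::] A r) -> nth 0 (nth [::] A r) c <= nth 0 (nth [::] B r) c.

Definition lascoux (R : comNzRingType) (n : nat) (beta : R) (al : seq nat) : {mpoly R[n]} :=
  fsum (fun T : seq (seq (seq nat)) =>
          rsvt n T /\ map size T = map size (key_rev n al) /\
          tab_le (left_key_rev (Lmax T)) (key_rev n al))
       (fun T => beta ^+ (sumn (wt_sv n T) - sumn al) *: monomial R n (wt_sv n T))%R.

(* Main.v *)
(* Encode an increasing tableau by the rows in which each letter occurs, and insert a letter by Hecke row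
   insertion.  Three facts about the insertion [x -> P] are used: the row word of the result is 0-Hecke
   equivalent to [word(P) x]; the inverse insertions from the corners of a tableau (keeping the corner cell
   or not) enumerate all pairs (tableau, letter), weakly increasing insertions corresponding to corners that
   move weakly to the left; and the weight [al] of the left key is unchanged if the corner is kept, and is
   changed to [phi c al] (the first entry equal to [c] drops by one) if a corner of column [c] is removed.

   The Lascoux polynomial satisfies the same recursion: adding to a reverse set-valued tableau the new
   smallest letter in the bottom cell of column [c], inside an existing cell or in a new cell, is dual for the
   dominance order on left keys to [al |-> al] and [al |-> phi c al].  Summing Lascoux polynomials over
   all [P] with [trunc N P] and the Hecke class of the big letters prescribed, one variable at a time, the
   letters at most [N] rebuild the recursion at [P1] and the bigger ones are removed from the Hecke word,
   which is the recursion of the Grothendieck polynomial.  Insertion words are weakly increasing whereas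
   compatible words are strictly monotone; the substitution of [X + .. + X^D] for [X] passes from one to the other.

   The powers of [beta] are recovered from the case [beta = 1] because the exponent is the degree minus a constant. *)

From Stdlib Require Import ClassicalEpsilon FunctionalExtensionality.
From mathcomp Require Import all_boot all_algebra.
From mathcomp Require Import mpoly.
From mathcomp Require Import zify.
Require Import Defs.
Set Implicit Arguments. Unset Strict Implicit. Unset Printing Implicit Defensive.
Import GRing.Theory.

(** * Hecke row insertion, one letter at a time *)

(** Restricting to the letters at most [a] commutes with insertion, and what remains of an
    unfinished insertion at that level is a row and a bit. Insertion thus becomes a reversible scan
    over the letters, and shapes, left keys and reading words are followed by inductions on [a].
    Capping comes from the dual side: reverse tableaux have letters in [[n]], so their left keys
    live on [[n]], and such a key lies below the key of [P], whose entries may reach [m], exactly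
    when it lies below the capped key. If [P] has more than [n] rows nothing lies below, and the
    term vanishes. Each variable brings the condition that the weight vanishes on an initial segment
    of [[n]]. Since [n < N], that condition sees only letters smaller than [N], so it passes through
    the product formula. With no variables left only the empty tableau counts, which starts the
    induction. A bound [m] on all letters makes the sums finite: [w] moves only points of
    [N+1 .. m], so its Hecke words use no letters outside that interval. *)

(* [p a r] says that the letter [a] occurs in row [r]; rows are numbered from 0. *)
Definition filling := nat -> nat -> bool.

Fixpoint shape (p : filling) (a r : nat) : nat :=
  if a is b.+1 then shape p b r + p a r else 0.

Definition part (l : nat -> nat) := forall r, l r.+1 <= l r.
(** A new cell of row [r+1] must lie under a cell of [l] itself, so the rows of [q] receive a rook
    strip: no letter repeats in a row or in a column. *)
Definition addable (l : nat -> nat) (q : nat -> bool) := forall r, q r.+1 -> l r.+1 < l r.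

Definition tab (m : nat) (p : filling) :=
  (forall a r, p a r -> 0 < a <= m) /\ (forall a, addable (shape p a) (p a.+1)).

Lemma shape_part p : (forall a, addable (shape p a) (p a.+1)) -> forall a, part (shape p a).
Proof.
move=> h; elim=> [|a IH] r //=; have := h a r; have := IH r; case: (p _ r.+1); lia.
Qed.

(* An insertion restricted to the letters at most [a]: [Wait x] while [a < x], then [Act b r] if it ends
   in row [r], in a new cell when [b] and without a new cell otherwise. *)
Inductive status := Wait of nat | Act of bool & nat.

Definition setr (q : nat -> bool) r b := fun i => if i == r then b else q i.

(** [q] holds the original rows of the letter and [q'] its rows after a possible removal one row
    above: a letter already present is absorbed, otherwise it is appended. *)
Definition bump r (q q' : nat -> bool) : status * (nat -> bool) :=
  if q r then (Act false r, q') else (Act true r, setr q' r true).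

(** With [Act true r], row [r] has gained a cell among the smaller letters, so [a] is displaced from
    it. With [Act false r] nothing was gained: [a] keeps its place and a copy of it moves down. In
    the last branch [a] fills the cell below the end of row [r], and the recorded row drops so as to
    remain a corner. *)
Definition fstep a (l : nat -> nat) s (q : nat -> bool) : status * (nat -> bool) :=
  match s with
  | Wait x => if a == x then bump 0 q q else (s, q)
  | Act true r => if q r then bump r.+1 q (setr q r false) else (s, q)
  | Act false r => if q r then bump r.+1 q q
                   else if q r.+1 && ((l r.+1).+1 == l r) then (Act false r.+1, q) else (s, q)
  end.

Definition bstep a (l : nat -> nat) s (q : nat -> bool) : status * (nat -> bool) :=
  match s with
  | Wait x => (s, q)
  | Act b r =>
    if ~~ q r then (s, q) else
    let q' := if b then setr q r false else q in
    if r is r'.+1 then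
      if q r' then (Act false r', q')
      else if ~~ b && ((l r).+1 == l r') then (Act false r', q')
      else (Act true r', setr q' r' true)
    else (Wait a, q')
  end.

(** [l'] is the shape before the insertion and [l] the shape after it. *)
Definition inv s (l' l : nat -> nat) :=
  match s with
  | Wait x => forall i, l i = l' i
  | Act b r => (forall i, l i = l' i + (b && (i == r))) /\ l r.+1 < l r
  end.

Definition early a s := if s is Wait x then a <= x else true.

Lemma addl_part l q : part l -> addable l q -> part (fun i => l i + q i).
Proof. by move=> h1 h2 r; have := h1 r; have := h2 r; case: (q r.+1); lia. Qed.

Lemma eqSn r : (r.+1 == r) = false. Proof. by lia. Qed.
Lemma eqnS r : (r == r.+1) = false. Proof. by lia. Qed.

Ltac dtest := rewrite /setr /= ?eqSS; repeat match goal with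
  | |- context [?x == ?y :> nat] => case: (@eqP _ x y) => ?; subst; try lia end; try lia.
Ltac feq := try done; congr pair; apply: functional_extensionality => i; dtest; try congruence.

(** The forward step reads the shape before the insertion, the backward step the shape after it.
    Reversibility and the invariant are proved together because the invariant converts one shape
    into the other. *)
Lemma fstepP a l' l s q : part l' -> addable l' q -> part l -> inv s l' l -> early a s ->
  let sq := fstep a l' s q in
  [/\ inv sq.1 (fun i => l' i + q i) (fun i => l i + sq.2 i), addable l sq.2,
      bstep a l sq.1 sq.2 = (s, q) & early a.+1 sq.1].
Proof.
move=> pl' al' pl; case: s => [x|b r] /=.
  move=> hi ea; have ? : l = l' by apply: functional_extensionality.
  subst l; move: (al' 0) (pl' 0) => a0 p0.
  case: eqP => [<-|ne]; rewrite /bump /=; last by split=> //; lia.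
  case e: (q 0) => /=; split=> //=; rewrite ?e /= ?addn0.
  all: try done.
  all: try (by split=> [i|]; dtest).
  all: try by feq.
case=> hi hr _.
have E : l = fun i => l' i + (b && (i == r)) by apply: functional_extensionality.
have P0 := pl' r; have P1 := pl' r.+1.
have A0 := al' r; have A1 := al' r.+1.
have Q0 := pl r; have Q1 := pl r.+1.
rewrite {l hi}E /= in hr Q0 Q1 pl *.
rewrite !(eqSn, eqnS, eqxx) /= in hr Q0 Q1.
case: b hr Q0 Q1 pl => /= hr Q0 Q1 pl; case e: (q r) => /=; rewrite /bump;
  (case e1: (q r.+1) => /=; last rewrite /=); rewrite ?e ?e1 /=; try (case e2: (_ == _) => /=);
  rewrite /setr /=; split=> //=; (try rewrite !(e, e1, eqSn, eqnS, eqxx) /=); (try rewrite !(e, e1, e2, eqSn, eqnS, eqxx) /=);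
 try (by split=> [i|]; dtest);
 try (by move=> i; move: (al' i) (pl' i); dtest);
 try (case: ifP => ?);
 try (by feq).
all: try lia.
Qed.

Definition unst s (l : nat -> nat) := fun i => l i - (if s is Act b r then b && (i == r) else false).

Definition corner s (l : nat -> nat) := if s is Act b r then l r.+1 < l r else true.

Lemma bstepP a l s2 q2 : part l -> addable l q2 -> corner s2 (fun i => l i + q2 i) ->
  early a.+1 s2 ->
  let sq := bstep a l s2 q2 in
  [/\ corner sq.1 l, addable (unst sq.1 l) sq.2, fstep a (unst sq.1 l) sq.1 sq.2 = (s2, q2)
    & early a sq.1].
Proof.
move=> pl al; case: s2 => [x|b r] /= hc ea.
  split=> //; last by lia.
    by move=> i /al; rewrite /unst !subn0.
  by case: eqP => // ?; lia.
have ad i (d : nat) : l i - 0 = l i by rewrite subn0.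
case: r hc => [|r] hc.
  have p0 := pl 0; have a0 := al 0.
  case e: (q2 0) => /=; case: b hc => hc; rewrite /unst /= ?e /= in hc *; split=> //=;
  rewrite ?eqxx /bump /setr /= ?e //=;
  try (by move=> i; move: (al i) (pl i) hc; dtest); try (by feq); try lia.
  case: ifP => //; lia.
have P0 := pl r; have A0 := al r; have P1 := pl r.+1; have A1 := al r.+1.
case e: (q2 r.+1) => /=; last first.
  case: b hc => hc; rewrite /unst /= ?e /= in hc *; split=> //=; rewrite ?e //=;
  try (by move=> i; move: (al i) (pl i) hc; dtest); try lia.
  by case: ifP => //; lia.
rewrite e in A0.
case e2: ((l r.+1).+1 == l r) => /=; case e1: (q2 r) => /=; case: b hc => hc /=;
  rewrite /unst /= ?e /= in hc *; split=> //=; rewrite /bump /setr;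
  (try rewrite !(e, e1, eqSn, eqnS, eqxx) /=);
  try (by move=> i; move: (al i) (pl i) hc; dtest); try (by feq); try lia.
all: try (by rewrite !subn0 e2).
Qed.

Fixpoint st (p : filling) x a : status :=
  if a is b.+1 then (fstep b.+1 (shape p b) (st p x b) (p b.+1)).1 else Wait x.

Definition ins (p : filling) x : filling := fun a r =>
  if a is b.+1 then (fstep b.+1 (shape p b) (st p x b) (p b.+1)).2 r else false.

(** Mirror image of [st]: it descends from the status [s] at the letter [m] to the status at level
    [a]. *)
Fixpoint rst (p : filling) m s a : status :=
  if a == m then s else
  if m is k.+1 then rst p k (bstep k.+1 (shape p k) s (p k.+1)).1 a else s.

Definition rins (p : filling) m s : filling := fun a r =>
  if a is b.+1 then (b < m) && (bstep b.+1 (shape p b) (rst p m s b.+1) (p b.+1)).2 r else false.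

Lemma rst_top p m s : rst p m s m = s.
Proof. by case: m s => [|m] s //=; rewrite eqxx. Qed.

Lemma rst_step p m s a : a < m -> rst p m s a = (bstep a.+1 (shape p a) (rst p m s a.+1) (p a.+1)).1.
Proof.
elim: m s => // m IH s lt; rewrite /= eqSS.
case: (a =P m.+1) => [?|_]; first lia.
case: (a =P m) => [->|ne]; first by rewrite rst_top.
by rewrite IH //; lia.
Qed.

Lemma st_inv p x : 0 < x -> (forall a, addable (shape p a) (p a.+1)) -> forall a,
  [/\ inv (st p x a) (shape p a) (shape (ins p x) a), early a.+1 (st p x a),
   forall b, b < a -> addable (shape (ins p x) b) (ins p x b.+1) & part (shape (ins p x) a)].
Proof.
move=> x0 h; elim=> [|a [i1 i2 i3 i4]] //.
have [j1 j2 _ j4] := fstepP (shape_part h a) (h a) i4 i1 i2.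
split=> //.
  move=> b; rewrite ltnS leq_eqVlt => /orP [/eqP ->|/i3] //.
have := addl_part i4 j2; congr part.
Qed.

Lemma ins_st p x m : 0 < x -> (forall a, addable (shape p a) (p a.+1)) -> forall a, a <= m ->
  rst (ins p x) m (st p x m) a = st p x a.
Proof.
move=> x0 h a /subnKC; move: (m - a) => d; elim: d a => [|d IH] a e.
  by rewrite -e addn0 rst_top.
have [i1 i2 i3 i4] := st_inv x0 h a.
have [_ _ j3 _] := fstepP (shape_part h a) (h a) i4 i1 i2.
rewrite rst_step; last lia.
rewrite IH; last lia.
by have := congr1 fst j3.
Qed.

Lemma ins_rins p x m : 0 < x -> tab m p -> rins (ins p x) m (st p x m) = p.
Proof.
move=> x0 [hm h]; apply: functional_extensionality => -[|a]; apply: functional_extensionality => r.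
  by case e: (p 0 r) => //; have := hm _ _ e.
rewrite /rins; case: ltnP => lt; last by case e: (p a.+1 r) => //; have := hm _ _ e; lia.
have [i1 i2 i3 i4] := st_inv x0 h a.
have [_ _ j3 _] := fstepP (shape_part h a) (h a) i4 i1 i2.
rewrite ins_st //.
exact: (congr1 (fun q => q.2 r) j3).
Qed.

Lemma st_wait p x a y : st p x a = Wait y -> y = x.
Proof.
elim: a y => [|a IH] y /=; first by case.
case: (st p x a) IH => [z|[] r] IH /=; rewrite /bump.
- by case: eqP => _; [case: ifP | move=> -[<-]; exact: IH].
- by case: ifP => //; case: ifP.
- by case: ifP => _; [case: ifP | case: ifP].
Qed.

Lemma st_early p x a : a < x -> st p x a = Wait x.
Proof.
elim: a => [|a IH] //= lt; rewrite IH /=; last lia.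
by case: eqP => // ?; lia.
Qed.

Lemma st_act p x m : 0 < x <= m -> (forall a, addable (shape p a) (p a.+1)) ->
  exists b r, st p x m = Act b r.
Proof.
move=> /andP [x0 xm] h; have [_ + _ _] := st_inv x0 h m.
case e: (st p x m) => [y|b r] /=; last by exists b, r.
by rewrite (st_wait e); lia.
Qed.

Lemma inv_corner s l' l : inv s l' l -> corner s l /\ l' = unst s l.
Proof.
case: s => [x|b r] /= => [h|[h hr]]; split=> //; apply: functional_extensionality => i;
  by rewrite /unst h; lia.
Qed.

Lemma corner_inv s l : corner s l -> inv s (unst s l) l.
Proof.
case: s => [x|b r] /= => [_ i|h]; first by rewrite /unst subn0.
by split=> // i; rewrite /unst; case: b; case: eqP => //= [->|]; lia.
Qed.

Lemma unst_part s l : corner s l -> part l -> part (unst s l).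
Proof.
case: s => [x|[] r] /= h p i; have := p i; rewrite /unst /=; try lia.
by case: (i =P r) => [->|]; case: eqP; lia.
Qed.

Lemma rst_corner p m s a : (forall a, addable (shape p a) (p a.+1)) -> corner s (shape p m) ->
  early m.+1 s -> a <= m -> corner (rst p m s a) (shape p a) /\ early a.+1 (rst p m s a).
Proof.
move=> h hc he /subnKC; move: (m - a) => d; elim: d a => [|d IH] a e.
  have -> : a = m by lia.
  by rewrite rst_top.
have [c1 c2] := IH a.+1 ltac:(lia).
have [j1 _ _ j4] := bstepP (shape_part h a) (h a) c1 c2.
rewrite rst_step; last lia.
by split.
Qed.

Lemma rst_wait p m b r : (forall a, addable (shape p a) (p a.+1)) -> shape p m r.+1 < shape p m r ->
  exists2 x, 0 < x & rst p m (Act b r) 0 = Wait x.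
Proof.
move=> h hc; have [] := rst_corner (m := m) (s := Act b r) h hc isT (leq0n m).
by case: (rst _ _ _ _) => [x|? ?] //= _ x0; exists x.
Qed.

Section Rev.
Variables (p : filling) (m : nat) (b : bool) (r x : nat).
Hypotheses (h : forall a, addable (shape p a) (p a.+1))
  (hc : shape p m r.+1 < shape p m r) (hw : rst p m (Act b r) 0 = Wait x).

Let cor a : a <= m -> corner (rst p m (Act b r) a) (shape p a) /\ early a.+1 (rst p m (Act b r) a).
Proof. exact: (rst_corner (@h)). Qed.

Lemma rins_st a : a <= m ->
  [/\ shape (rins p m (Act b r)) a = unst (rst p m (Act b r) a) (shape p a),
      st (rins p m (Act b r)) x a = rst p m (Act b r) a &
      a < m -> addable (shape (rins p m (Act b r)) a) (rins p m (Act b r) a.+1)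
       /\ ins (rins p m (Act b r)) x a.+1 = p a.+1].
Proof.
have aux a' : a' < m -> shape (rins p m (Act b r)) a' = unst (rst p m (Act b r) a') (shape p a') ->
  st (rins p m (Act b r)) x a' = rst p m (Act b r) a' -> 
  addable (shape (rins p m (Act b r)) a') (rins p m (Act b r) a'.+1) /\
  fstep a'.+1 (shape (rins p m (Act b r)) a') (st (rins p m (Act b r)) x a')
         (rins p m (Act b r) a'.+1) = (rst p m (Act b r) a'.+1, p a'.+1).
  move=> lt e1 e2; have [c1 c2] := cor lt.
  have [j1 j2 j3 _] := bstepP (shape_part (@h) a') (@h a') c1 c2.
  have e3 : rins p m (Act b r) a'.+1 = (bstep a'.+1 (shape p a') (rst p m (Act b r) a'.+1) (p a'.+1)).2.
    by apply: functional_extensionality => i; rewrite /rins lt.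
  by rewrite e1 e2 e3 rst_step.
elim: a => [|a IH] lt; last have [i1 i2 i3] := IH (ltnW lt).
  have e0 : shape (rins p m (Act b r)) 0 = unst (rst p m (Act b r) 0) (shape p 0).
    by rewrite hw; apply: functional_extensionality => i; rewrite /unst subn0.
  split=> //.
  move=> m0; have [g1 g2] := aux 0 m0 e0 (esym hw); split=> //.
  by have := congr1 snd g2.
have [c1 c2] := cor (ltnW lt); have [g1 g2] := aux a lt i1 i2.
have pu := unst_part c1 (shape_part (@h) a).
have := fstepP (a := a.+1) (q := rins p m (Act b r) a.+1) pu _ (shape_part (@h) a) (corner_inv c1) c2.
rewrite -i1 -i2 g2 /= => /(_ g1) [/inv_corner [_ v2] _ _ _].
have e1 : shape (rins p m (Act b r)) a.+1 = unst (rst p m (Act b r) a.+1) (shape p a.+1).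
  exact: v2.
have e2 : st (rins p m (Act b r)) x a.+1 = rst p m (Act b r) a.+1 by rewrite /= g2.
split=> // lt'; have [f1 f2] := aux _ lt' e1 e2; split=> //.
by have := congr1 snd f2.
Qed.

End Rev.

Lemma insP p m x : tab m p -> 0 < x <= m ->
  exists b r, [/\ st p x m = Act b r, tab m (ins p x), shape (ins p x) m r.+1 < shape (ins p x) m r
   & forall i, shape (ins p x) m i = shape p m i + (b && (i == r))].
Proof.
move=> [hm h] xm; have [b [r e]] := st_act xm h; exists b, r.
have /andP [x0 _] := xm.
have [i1 i2 i3 i4] := st_inv x0 h m; rewrite e in i1; case: i1 => i1 hc.
split=> //; split=> [a i|a i]; last first.
  by have [_ _ H _] := st_inv x0 h a.+1; apply: H.
case: a => //= a; case: (ltnP a m) => // le.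
have nq j : p a.+1 j = false by apply: contraTF le => /hm; lia.
suff S k : exists b r, st p x (m + k) = Act b r.
  have := S (a - m); rewrite subnKC // => -[b' [r' ->]] /=.
  by case: b'; rewrite !nq /= ?nq.
elim: k => [|k [b' [r' IH]]]; first by rewrite addn0 e; exists b, r.
have nq' j : p (m + k).+1 j = false by apply: contraTF isT => /hm; lia.
by rewrite addnS /= IH /=; exists b', r'; case: b' {IH}; rewrite !nq'.
Qed.

Lemma rinsP p m b r x : tab m p -> shape p m r.+1 < shape p m r -> rst p m (Act b r) 0 = Wait x ->
  [/\ tab m (rins p m (Act b r)), 0 < x <= m, ins (rins p m (Act b r)) x = p
    & st (rins p m (Act b r)) x m = Act b r].
Proof.
move=> [hm h] hc hw; have R := rins_st h hc hw.
have sm : st (rins p m (Act b r)) x m = Act b r.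
  by have [_ -> _] := R m (leqnn m); rewrite rst_top.
have tr : tab m (rins p m (Act b r)).
  split=> [a i|a]; first by case: a => //= a /andP [].
  case: (ltnP a m) => lt; first by have [_ _ /(_ lt) []] := R a (ltnW lt).
  by move=> i; rewrite /rins ltnNge lt.
have xm : 0 < x <= m.
  have [y y0 e] := rst_wait b h hc; move: hw; rewrite e => -[E']; subst y; rewrite y0 /=.
  by case: leqP => // /(@st_early (rins p m (Act b r))); rewrite sm.
split=> //; have [b' [r' [_ [ti _] _ _]]] := insP tr xm.
apply: functional_extensionality => -[|a]; last case: (ltnP a m) => lt.
- by apply: functional_extensionality => i; case e: (p 0 i) => //; have := hm _ _ e.
- by have [_ _ /(_ lt) []] := R a (ltnW lt).
apply: functional_extensionality => i; case e: (p a.+1 i); first by have := hm _ _ e; lia.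
by case e': (ins _ _ _ _) => //; have := ti _ _ e'; lia.
Qed.

(* The row bumping lemma, letter by letter. *)
Lemma order_step p x' x : 0 < x' -> 0 < x -> (forall a, addable (shape p a) (p a.+1)) ->
  forall a, match st p x' a, st (ins p x') x a with
  | Act _ r', Act _ r => (x' <= x) = (r <= r')
  | Act _ _, Wait _ => x' <= a
  | Wait _, Act _ _ => x < x'
  | _, _ => True
  end.
Proof.
(* The states in which one of the two letters still waits belong to the statement because the
   induction on [a] passes through them; each case is then arithmetic on row lengths. *)
move=> x0' x0 h; elim=> [|a IH] //.
have [i1 i2 _ i4] := st_inv x0' h a.
have -> : st (ins p x') x a.+1 = (fstep a.+1 (shape (ins p x') a) (st (ins p x') x a)
   (fstep a.+1 (shape p a) (st p x' a) (p a.+1)).2).1 by [].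
have -> : st p x' a.+1 = (fstep a.+1 (shape p a) (st p x' a) (p a.+1)).1 by [].
have pp := shape_part h a; have hh := h a.
have W := @st_wait (ins p x') x a; have W' := @st_wait p x' a.
move: (st p x' a) (st (ins p x') x a) (p a.+1) (shape p a) (shape (ins p x') a)
  i1 i2 i4 IH hh pp W W' => s' s q l l2.
case: s' => [y'|[] r']; case: s => [y|[] r] //= i1 i2 i4 IH hh pp W W';
  try (have ? := W _ erefl); try (have ? := W' _ erefl); subst.
all: rewrite /bump /setr.
all: try (case: i1 => i1 hc; have I0 := i1 0; have I1 := i1 r'; have I2 := i1 r'.+1;
          have I3 := hh r'; have I4 := pp r'; move: hc I0 I1 I2 I3 I4).
all: try (have J1 := i1 r; have J2 := i1 r.+1; have J3 := hh r; have J4 := pp r; move: J1 J2 J3 J4).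
all: repeat (match goal with |- context [if ?c then _ else _] => 
   lazymatch c with context [if _ then _ else _] => fail | _ => case: (boolP c) => ? end end; rewrite /=;
   try (exfalso; lia)).
all: try lia.
all: try (case: (r =P 0) => ?; subst; lia).
all: try (case: (r =P r') => ?; first by subst; lia).
all: try (case: (r =P r'.+1) => ?; first by subst; lia).
all: try (case: (r' =P r.+1) => ?; first by subst; lia).
all: try lia.
Qed.

(** * The weight of the left key *)

Definition topb (al : nat -> nat) A k v :=
  [&& 0 < v <= A, al v == k & all (fun u => (al u == k) ==> (u <= v)) (iota 1 A)].

(** [l r] is the index of the first free column of row [r], so this says that the letter with rows
    [q] occupies the column of index [k]. *)
Definition extb (l : nat -> nat) (q : nat -> bool) A k := has (fun r => q r && (l r == k)) (iota 0 A).

(** A new largest letter in the column of index [k] raises the last entry equal to [k]. That this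
    computes the greedily defined left key is [key_comp]. *)
Definition grow al l q A v := al v + (extb l q A (al v) && topb al A (al v) v).

(* [comp p a] is the weight of the left key of the subtableau of letters at most [a]. *)
Fixpoint comp (p : filling) a : nat -> nat :=
  if a is b.+1 then grow (comp p b) (shape p b) (p b.+1) b.+1 else fun=> 0.

Definition mult (al : nat -> nat) (s : seq nat) k := count (fun v => al v == k) s.

Lemma topbP (al : nat -> nat) A k v : reflect [/\ 0 < v <= A, al v = k & forall u, 0 < u <= A -> al u = k -> u <= v]
  (topb al A k v).
Proof.
apply: (iffP and3P) => -[h1 h2 h3]; split=> //; try exact/eqP.
  move=> u hu e; move/allP: h3 => /(_ u); rewrite mem_iota; lia.
by apply/allP => u; rewrite mem_iota => hu; apply/implyP => /eqP; apply: h3; lia.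
Qed.

Lemma extbP (l : nat -> nat) (q : nat -> bool) A k : reflect (exists r, [/\ r < A, q r & l r = k]) (extb l q A k).
Proof.
apply: (iffP hasP) => [[r]|[r [h1 h2 h3]]].
  by rewrite mem_iota => h /andP [? /eqP ?]; exists r; split=> //; lia.
by exists r; rewrite ?mem_iota ?h2 ?h3 ?eqxx.
Qed.

Lemma top_exists al A k : 0 < mult al (iota 1 A) k -> exists v, topb al A k v.
Proof.
rewrite /mult -has_count => /hasP [v]; rewrite mem_iota => hv /eqP e.
have ex : exists v, (0 < v <= A) && (al v == k) by exists v; rewrite e eqxx; lia.
have ub i : (0 < i <= A) && (al i == k) -> i <= A by lia.
case: (ex_maxnP ex ub) => i /andP [hi /eqP ei] h; exists i; apply/topbP; split=> // u hu eu.
by apply: h; rewrite hu eu eqxx.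
Qed.

(** The multiplicities after the increments depend only on the old ones and on the set of values
    that lose an entry; weights and row lengths can therefore be compared without matching their
    indices. *)
Lemma count_inc (c : nat -> nat) (inc : nat -> bool) (e : nat -> bool) (s : seq nat) :
  (forall k, count (fun v => (c v == k) && inc v) s = e k) ->
  forall k, mult (fun v => c v + inc v) s k + e k = mult c s k + (if k is j.+1 then nat_of_bool (e j) else 0).
Proof.
move=> h k; rewrite -(h k); have -> : (if k is j.+1 then nat_of_bool (e j) else 0) =
  if k is j.+1 then count (fun v => (c v == j) && inc v) s else 0 by case: k.
rewrite /mult; elim: s {h} => [|v s IH] /=; first by case: k.
by case: k IH => [|k] IH; case: (inc v) => /=; lia.
Qed.

Lemma count1P (P : pred nat) s x : uniq s -> x \in s -> P x -> (forall y, y \in s -> P y -> y = x) ->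
  count P s = 1.
Proof.
move=> us xs px h; rewrite (eq_in_count (a2 := pred1 x)) ?count_uniq_mem ?xs // => y ys /=.
by apply/idP/eqP => [|->] //; exact: h.
Qed.

Lemma count0P (P : pred nat) s : (forall y, y \in s -> ~~ P y) -> count P s = 0.
Proof. by move=> h; apply/eqP; rewrite -leqn0 leqNgt -has_count; apply/hasPn. Qed.

Lemma shape_out p a r : (forall a, addable (shape p a) (p a.+1)) -> a <= r -> shape p a r = 0.
Proof.
move=> h; elim: a r => [|a IH] [|r] //= le; rewrite IH; last lia.
by case e: (p _ _) => //; have := h _ _ e; rewrite !IH; lia.
Qed.

Lemma comp_out p a v : ~~ (0 < v <= a) -> comp p a v = 0.
Proof.
elim: a => [|a IH] //= h; rewrite /grow IH; last lia.
by rewrite /topb (negbTE h) andbF.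
Qed.

(** The weight of a left key is a rearrangement of the row lengths; letters are counted from 1 and
    rows from 0. *)
Definition balanced A (al l : nat -> nat) := 
  forall k, mult al (iota 1 A) k = mult l (iota 0 A) k.

(** If two rows had equal length, the row just above the lower one would have that length too, and
    the lower new cell would have nothing of [l] above it. *)
Lemma add_inj l q r r' : part l -> addable l q -> q r -> q r' -> l r = l r' -> r = r'.
Proof.
move=> pl al; have mono i j : i <= j -> l j <= l i.
  by move=> /subnKC <-; elim: (j - i) => [|d IH]; rewrite ?addn0 // addnS (leq_trans (pl _)).
suff W i j : q j -> i < j -> l i = l j -> False.
  move=> h h' e; case: (ltngtP r r') => // lt; [case: (W r r')|case: (W r' r)] => //.
case: j => // j /al h; rewrite ltnS => /mono; lia.
Qed.

Lemma grow_balanced A al l q : part l -> addable l q -> (forall r, A <= r -> ~~ q r) ->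
  balanced A al l -> balanced A (grow al l q A) (fun i => l i + q i).
Proof.
move=> pl aq ql hb k.
have h1 k' : count (fun v => (al v == k') && (extb l q A (al v) && topb al A (al v) v)) (iota 1 A) = 
   extb l q A k'.
  case: (boolP (extb l q A k')) => [/extbP [r [rA qr lr]]|ne].
    have [v hv] : exists v, topb al A k' v.
      apply: top_exists; rewrite hb /mult -has_count; apply/hasP; exists r; rewrite ?mem_iota ?lr //=.
    have /topbP [v1 v2 v3] := hv.
    apply: (count1P (x := v)); rewrite ?iota_uniq ?mem_iota; [by []|lia| |].
      by rewrite v2 eqxx hv andbT; apply/extbP; exists r.
    move=> y; rewrite mem_iota => y1 /and3P [/eqP y2 _ /topbP [_ _ y3]].
    by have := y3 v v1; have := v3 y; lia.
  by apply: count0P => y _; apply: contra ne => /and3P [/eqP <-].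
have h2 k' : count (fun v => (l v == k') && q v) (iota 0 A) = extb l q A k'.
  case: (boolP (extb l q A k')) => [/extbP [r [rA qr lr]]|ne].
    apply: (count1P (x := r)); rewrite ?iota_uniq ?mem_iota ?lr ?eqxx //.
    by move=> y _ /andP [/eqP e qy]; apply: (add_inj pl aq) => //; rewrite e.
  apply: count0P => y; rewrite mem_iota => hy; apply: contra ne => /andP [/eqP e qy].
  by apply/extbP; exists y; split=> //; lia.
have := count_inc h1 k; have := count_inc h2 k; have := hb k.
rewrite -/(mult _ _ _) /grow; lia.
Qed.

Lemma comp_balanced p a : (forall a, addable (shape p a) (p a.+1)) ->
  balanced a (comp p a) (shape p a) /\ balanced a.+1 (comp p a) (shape p a).
Proof.
move=> h; suff H : balanced a (comp p a) (shape p a).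
  split=> // k; rewrite /mult -[a.+1]addn1 !iotaD !count_cat -/(mult _ _ _) H /= add0n add1n.
  by rewrite comp_out ?shape_out //; lia.
elim: a => [|a IH] //.
have IH' : balanced a.+1 (comp p a) (shape p a).
  move=> k; rewrite /mult -[a.+1]addn1 !iotaD !count_cat -/(mult _ _ _) IH /= add0n add1n.
  by rewrite comp_out ?shape_out //; lia.
apply: grow_balanced => //; first exact: shape_part.
case=> // r hr; apply/negP => /h; rewrite !shape_out //; lia.
Qed.

(** [al'] and [al] are the key weights before and after the insertion. In the case of a new cell,
    the last clause makes [v] the first position of the value [l' r + 1] in [al], that is, [al'] is
    [phi] of [al]. *)
Definition krel A s (al' l' al : nat -> nat) :=
  if s is Act true r then
    exists v, [/\ 0 < v <= A, al' v = l' r, (forall u, al u = al' u + (u == v)) &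
      forall u, 0 < u <= A -> al' u = (l' r).+1 -> v < u]
  else al = al'.

Section Balanced.
Variables (A : nat) (al l : nat -> nat).
Hypotheses (pl : part l) (hb : balanced A al l).

Lemma bal_row v : 0 < v <= A -> exists2 r, r < A & l r = al v.
Proof.
move=> hv; have : 0 < mult l (iota 0 A) (al v).
  by rewrite -hb /mult -has_count; apply/hasP; exists v; rewrite ?mem_iota //=; lia.
by rewrite /mult -has_count => /hasP [r]; rewrite mem_iota => hr /eqP; exists r => //; lia.
Qed.

Lemma bal_top r : r < A -> exists v, topb al A (l r) v.
Proof.
move=> hr; apply: top_exists; rewrite hb /mult -has_count; apply/hasP.
by exists r; rewrite ?mem_iota //=.
Qed.

Lemma bal_uniq k v w : (forall r r', r < A -> r' < A -> l r = k -> l r' = k -> r = r') ->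
  0 < v <= A -> 0 < w <= A -> al v = k -> al w = k -> v = w.
Proof.
move=> hu hv hw ev ew; have [r hr lr] := bal_row hv.
have : mult al (iota 1 A) k = 1.
  rewrite hb; apply: (count1P (x := r)); rewrite ?iota_uniq ?mem_iota ?lr ?ev ?eqxx //.
  by move=> y; rewrite mem_iota => hy /eqP e; apply: hu => //; rewrite ?lr //; lia.
apply: contra_eq => ne; rewrite /mult.
have pe : perm_eq (iota 1 A) (v :: w :: rem w (rem v (iota 1 A))).
  have iv : v \in iota 1 A by rewrite mem_iota; lia.
  apply: (perm_trans (perm_to_rem iv)); rewrite perm_cons; apply: perm_to_rem.
  by rewrite mem_rem_uniq ?iota_uniq // inE eq_sym ne mem_iota; lia.
by rewrite (permP pe) /= ev ew eqxx; lia.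
Qed.

Lemma part_le i j : i <= j -> l j <= l i.
Proof.
by move=> /subnKC <-; elim: (j - i) => [|d IH]; rewrite ?addn0 // addnS (leq_trans (pl _)).
Qed.

Lemma uniq_len r r' : (0 < r -> l r < l r.-1) -> l r.+1 < l r -> l r' = l r -> r' = r.
Proof.
move=> h1 h2 e; case: (ltngtP r' r) => // lt.
  by case: r h1 h2 e lt => // r h1 h2 e; rewrite ltnS => /part_le; have := h1 isT; rewrite /=; lia.
by have := part_le lt; lia.
Qed.

(** [q] with the row [t] added is still addable, so the column of index [l t] was free: exactly one
    further entry rises, the last one of value [l t]. *)
Lemma grow_extra q t : addable l q -> (0 < t -> l t < l t.-1) -> t < A -> ~~ q t ->
  exists v, [/\ topb al A (l t) v, grow al l q A v = l t,
    (forall u, grow al l (setr q t true) A u = grow al l q A u + (u == v)) &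
     forall u, grow al l q A u = (l t).+1 -> al u = (l t).+1].
Proof.
move=> aq ht tA nq; have [v hv] := bal_top tA; exists v.
have /topbP [v1 v2 v3] := hv.
have aq2 : addable l (setr q t true).
  by move=> i; rewrite /setr; case: eqP => [e _|_ /aq //]; by move: ht; rewrite -e; apply.
have ne : extb l q A (l t) = false.
  apply/negbTE/extbP => -[r [rA qr er]]; move: nq; rewrite -(_ : r = t) ?qr //.
  by apply: (add_inj pl aq2); rewrite /setr ?eqxx //; case: eqP.
have ye : extb l (setr q t true) A (l t) by apply/extbP; exists t; rewrite /setr eqxx.
split=> //; first by rewrite /grow v2 ne addn0.
- move=> u; rewrite /grow; case: (al u =P l t) => [e|n].
    rewrite e ne ye /= addn0; congr (_ + nat_of_bool _); apply/idP/eqP => [/topbP [u1 u2 u3]|->] //.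
    by have := u3 _ v1 v2; have := v3 _ u1 u2; lia.
  have -> : (u == v) = false by apply: contra_notF n => /eqP ->.
  rewrite addn0; congr (_ + nat_of_bool (_ && _)); apply/extbP/extbP => -[r [r1 r2 r3]].
    by exists r; split=> //; move: r2; rewrite /setr; case: eqP => // e; case: n; rewrite -r3 e.
  by exists r; split=> //; rewrite /setr; case: eqP.
- move=> u; rewrite /grow; case: (al u =P l t) => [->|n]; first by rewrite ne; lia.
  by case: (_ && _) => /=; lia.
Qed.
End Balanced.

(** Follow [v], the entry raised so far by the insertion. The next letter raises the same entries
    before and after the insertion, except at values close to the lengths of rows [r] and [r+1]; the
    cases check that the weights still differ in at most one entry, the first of its value. *)
Lemma krel_step A s al' l' al l q : part l' -> addable l' q -> inv s l' l -> part l ->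
  balanced A al' l' -> balanced A al l -> (forall r, q r -> r < A) ->
  (forall r, A <= r.+1 -> l r = 0) -> 0 < A -> krel A s al' l' al ->
  krel A (fstep A l' s q).1 (grow al' l' q A) (fun i => l' i + q i)
     (grow al l (fstep A l' s q).2 A).
Proof.
move=> pl' aq hi pl hb' hb qA lA A0; case: s hi => [x|[] r].
- move=> /= hi ->; have E : l = l' by apply: functional_extensionality.
  subst l; case: eqP => [_|_] //; rewrite /bump; case e: (q 0) => //=.
  have [|v [/topbP [v1 v2 _] v3 v4 v5]] := grow_extra pl' hb' aq _ A0 (negbT e); first by [].
  exists v; rewrite e addn0; split=> // u u1 /v5 u2.
  by have [r _ e'] := bal_row hb' u1; have := part_le pl' (leq0n r); rewrite e' u2 ltnn.
- case=> hl hc [v [v1 v2 v3 v4]].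
  have hr : 0 < r -> l' r < l' r.-1.
    by case: r hl {hc v2 v4} => // r hl _; have := pl r; rewrite !hl eqxx eqnS /=; lia.
  have rA : r.+1 < A by case: ltnP => // /lA; rewrite hl eqxx; lia.
  have av : al v = (l' r).+1 by rewrite v3 v2 eqxx addn1.
  (* [v] is not raised again: another row of length [l' r + 1] provides an entry of that value
     beyond [v], so [v] is not the last one. *)
  have nov (q2 : nat -> bool) : (forall i, q2 i -> l i = (l' r).+1 -> i != r /\ q i) -> grow al l q2 A v = (l' r).+1.
    move=> hq; rewrite /grow av; case: (boolP (extb _ _ _ _)) => [|_]; last by rewrite addn0.
    case/extbP => r3 [h1 h2 h3]; have [ne q3] := hq _ h2 h3.
    have [|u0] := bal_top hb' (r := r3); first by lia.
    have -> : l' r3 = (l' r).+1 by rewrite -h3 hl (negbTE ne) addn0.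
    case/topbP => u1 u2 u3; case: topbP => [[_ _ /(_ u0 u1)]|_]; last by rewrite addn0.
    by have := v4 _ u1 u2; rewrite v3 u2; lia.
  have same (q1 q2 : nat -> bool) u : u != v -> al' u != l' r ->
      (forall i, i < A -> (q1 i && (l i == al' u)) = (q2 i && (l' i == al' u))) ->
      grow al l q1 A u = grow al' l' q2 A u.
    move=> uv uk hq; rewrite /grow v3 (negbTE uv) addn0; congr (_ + nat_of_bool _).
    have -> : extb l q1 A (al' u) = extb l' q2 A (al' u).
      by apply: eq_in_has => i; rewrite mem_iota => hi; apply: hq; lia.
    congr (_ && _); apply/topbP/topbP => -[u1 u2 u3]; split=> //.
    + move=> w w1 w2; apply: u3 => //; rewrite v3 w2; case: (w =P v) => [e|]; last by rewrite addn0.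
      by move: uk; rewrite -w2 e v2 eqxx.
    + by rewrite v3 (negbTE uv) addn0.
    + move=> w w1; rewrite v3; case: (w =P v) => [->|_]; last by rewrite addn0; apply: u3.
      by rewrite v2 addn1 => e; have := v4 u u1 (esym e); lia.
  rewrite /=; case qr: (q r); last first.
    have aq2 : addable l' (setr q r true).
      by move=> i; rewrite /setr; case: eqP => [e _|_ /aq //]; by move: hr; rewrite -e; apply.
    have ne : extb l' q A (l' r) = false.
      apply/negbTE/extbP => -[r3 [h1 h2 h3]]; move: qr; rewrite -(_ : r3 = r) ?h2 //.
      by apply: (add_inj pl' aq2); rewrite /setr ?eqxx //; case: eqP.
    rewrite /= qr; exists v; rewrite addn0; split=> //; first by rewrite /grow v2 ne addn0.
      move=> u; case: (u =P v) => [->|/eqP uv].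
        rewrite nov; first by rewrite /grow v2 ne; lia.
        by move=> i qi _; split=> //; apply: contraTneq qi => ->; rewrite qr.
      rewrite addn0; case: (al' u =P l' r) => [e|/eqP n]; last first.
        apply: same => // i _; rewrite hl; case: (i =P r) => [->|_]; rewrite ?qr ?addn0 //.
      rewrite /grow v3 (negbTE uv) addn0 e ne; suff -> : extb l q A (l' r) = false by [].
      apply/negbTE/extbP => -[r3 [h1 h2 h3]]; case/extbP: (negbT ne); exists r3; split=> //.
      by move: h3; rewrite hl; case: (r3 =P r) => [e3|_]; rewrite ?addn0 //; move: h2; rewrite e3 qr.
    move=> u u1; rewrite {1}/grow; case: (al' u =P l' r) => [->|n]; first by rewrite ne; lia.
    by move=> h; apply: v4 => //; move: h; case: (_ && _) => /=; lia.
  have ye : extb l' q A (l' r) by apply/extbP; exists r; split=> //; lia.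
  have lr1 : l r.+1 = l' r.+1 by rewrite hl eqSn addn0.
  have ad1 : addable l (setr q r false).
    move=> i; rewrite /setr; case: eqP => // n /aq; rewrite !hl; case: eqP => //; lia.
  have uk : l' r.+1 < l' r -> forall u, 0 < u <= A -> al' u = l' r -> u = v.
    move=> lt u u1 u2; apply: (bal_uniq hb' (k := l' r)) => // i j _ _ ei ej.
    by rewrite (uniq_len pl' hr lt ei) (uniq_len pl' hr lt ej).
  (* When row [r] is alone with its length, [v] is the only entry of that value. In the source [a]
     raises [v]; in the result [v] was raised earlier and [a] has left row [r], so the weights
     agree. *)
  have B1 : l' r.+1 < l' r -> grow al l (setr q r false) A = grow al' l' q A.
    move=> lt; apply: functional_extensionality => u; case: (u =P v) => [->|/eqP uv].
      rewrite nov; last first.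
        by move=> i; rewrite /setr; case: eqP.
      rewrite /grow v2 ye; case: topbP => [_|]; first by rewrite addn1.
      by case; split=> // w w1 /(uk lt w w1) ->.
    case: (boolP (0 < u <= A)) => [ur|ur]; last first.
      by rewrite /grow /topb (negbTE ur) !andbF !addn0 v3 (negbTE uv) addn0.
    have n : al' u != l' r by apply: contra_neqN uv => /eqP /(uk lt u ur).
    apply: same => // i _; rewrite hl /setr; case: (i =P r) => [->|_]; rewrite ?addn0 //.
    by move: n; rewrite [al' u == _]eq_sym => /negbTE ->; rewrite andbF.
  case q1: (q r.+1) => /=.
    rewrite /bump q1 /=; apply: B1; exact: aq.
  have [||vt [/topbP [x1 x2 x3] x4 x5 x6]] := grow_extra pl hb ad1 (t := r.+1) _ rA.
  - by [].
  - by rewrite /setr eqSn q1.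
  rewrite /bump q1 /=; rewrite !lr1 in x2 x3 x4 x6.
  case lt: (l' r.+1 < l' r).
    exists vt; rewrite q1 addn0 -B1 //; split=> // u u1 /x6; rewrite v3; case: eqP => [->|n]; first lia.
    rewrite addn0 => e; have [r0 r1 r2] := bal_row hb' u1.
    have [e'|ne] : l' r.+1 = (l' r).-1 \/ l' r.+1 < (l' r).-1 by lia.
      by case: n; apply: uk => //; rewrite e e'; lia.
    by case: (leqP r0 r) => /(part_le pl'); lia.
  have {lt} ek : l' r.+1 = l' r by have := pl' r; lia.
  rewrite !ek in x2 x3 x4 x6 *.
  have [u0 /topbP [y1 y2 y3]] := bal_top hb' (r := r) ltac:(lia).
  have v2v : vt != v by apply: contra_eqN x2 => /eqP ->; rewrite av; lia.
  have z2 : al' vt = l' r by move: x2; rewrite v3 (negbTE v2v) addn0.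
  have gk u : al' u = l' r -> u != v -> grow al l (setr q r false) A u = l' r.
    move=> e uv; rewrite /grow v3 (negbTE uv) addn0 e.
    suff -> : extb l (setr q r false) A (l' r) = false by rewrite addn0.
    apply/negbTE/extbP => -[r3 [_ h2 h3]]; move: h2 h3; rewrite /setr hl; case: eqP => // n.
    by rewrite addn0 => q3 /(add_inj pl' aq q3 qr).
  have gs u : al' u <> l' r -> grow al l (setr q r false) A u = grow al' l' q A u.
    move=> n; have uv : u != v by apply: contra_not_neq n => ->.
    apply: same => //; first exact/eqP.
    move=> i _; rewrite hl /setr; case: (i =P r) => [->|_]; rewrite ?addn0 //.
    by case: (l' r =P al' u) n => [->|]; rewrite ?andbF.
  have g' u : al' u = l' r -> grow al' l' q A u = l' r + (u == u0).
    move=> e; rewrite /grow e ye /=; congr (_ + nat_of_bool _); apply/topbP/eqP => [[h1 h2 h3]|->] //.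
    by have := h3 _ y1 y2; have := y3 _ h1 h2; lia.
  rewrite q1 addn0.
  (* Rows [r] and [r+1] have equal length. In the source [a] raises [u0]. If [u0] is [v], the
     difference moves to the entry [vt] raised by the new cell; otherwise [vt] is [u0] and the
     difference remains at [v]. *)
  case: (u0 =P v) => [eu|/eqP nu].
    exists vt; split=> //.
    + by rewrite g' // eu (negbTE v2v) addn0.
    + move=> u; rewrite x5; congr (_ + _).
      case: (u =P v) => [->|/eqP uv]; first by rewrite nov ?g' ?eu ?eqxx ?addn1 // => i; rewrite /setr; case: eqP.
      case: (al' u =P l' r) => [e|n]; last by rewrite gs.
      by rewrite gk // g' // eu (negbTE uv) addn0.
    + move=> u u1; case: (al' u =P l' r) => [e|n].
        rewrite g' //; case: eqP => [->|]; last by lia.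
        by have := y3 _ x1 z2; move/eqP: v2v; lia.
      rewrite {1}/grow => h; have := v4 u u1; have := y3 _ x1 z2; move/eqP: v2v.
      by move: h; case: (_ && _) => /=; lia.
  exists v; split=> //.
  - by rewrite g' // [v == _]eq_sym (negbTE nu) addn0.
  - move=> u; rewrite x5.
    have e2 : vt = u0.
      have h1 := y3 _ x1 z2; apply/eqP; rewrite eqn_leq h1 /=.
      by apply: x3 => //; rewrite v3 y2 (negbTE nu) addn0.
    rewrite e2; case: (u =P v) => [->|/eqP uv].
      rewrite nov; last by move=> i; rewrite /setr; case: eqP.
      by rewrite g' // eq_sym; lia.
    case: (al' u =P l' r) => [e|n]; first by rewrite gk // g' // addn0.
    rewrite gs // addn0; case: eqP => [e|]; last by rewrite addn0.
    by case: n; rewrite e.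
  - move=> u u1; case: (al' u =P l' r) => [e|n].
      by rewrite g' //; case: eqP => [->|]; [have := y3 _ v1 v2; lia | lia].
    rewrite {1}/grow => h; apply: v4 => //.
    by move: h; case: (_ && _) => /=; lia.
- case=> hl hc ->; have E : l = l' by apply: functional_extensionality => i; rewrite hl addn0.
  subst l; rewrite /=; case qr: (q r); last by case: ifP.
  rewrite /bump; case q1: (q r.+1) => //=.
  have rA : r.+1 < A by case: ltnP => // /lA; lia.
  have [|v [/topbP [x1 x2 x3] x4 x5 x6]] := grow_extra pl hb' aq (t := r.+1) _ rA (negbT q1); first by [].
  rewrite q1 addn0; exists v; split=> // u u1 /[dup] gu /x6 e.
  have [r0 r1 r2] := bal_row hb' u1.
  (* No entry may keep the value [l' r.+1 + 1]: either row [r] alone has this length, and [a] in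
     that row raises the corresponding entry, or no row has this length. *)
  have [e'|ne] : l' r.+1 = (l' r).-1 \/ l' r.+1 < (l' r).-1 by lia.
    have hr : 0 < r -> l' r < l' r.-1 by case: (r) qr => // r' /aq.
    have ul := uniq_len pl hr hc.
    have ur : al' u = l' r by rewrite e e'; lia.
    move: gu; rewrite /grow ur; have -> : extb l' q A (l' r) by apply/extbP; exists r; split=> //; lia.
    case: topbP => [_|[]]; first by rewrite /=; lia.
    split=> // w w1 w2; rewrite (bal_uniq hb' (v := w) (w := u) (k := l' r)) //.
    by move=> i j _ _ /ul -> /ul ->.
  by case: (leqP r0 r) => /(part_le pl); lia.
Qed.

Lemma comp_ins p x a : 0 < x -> (forall a, addable (shape p a) (p a.+1)) ->
  krel a (st p x a) (comp p a) (shape p a) (comp (ins p x) a).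
Proof.
move=> x0 h; have hi : forall a, addable (shape (ins p x) a) (ins p x a.+1).
  by move=> b; have [_ _ H _] := st_inv x0 h b.+1; apply: H.
elim: a => [|a IH] //; have [i1 i2 _ i4] := st_inv x0 h a.
have IH' : krel a.+1 (st p x a) (comp p a) (shape p a) (comp (ins p x) a).
  case: (st p x a) IH i1 => [y|[] r] //= [v [v1 v2 v3 v4]] [hl hr]; exists v; split=> //; first lia.
  move=> u u1 e; apply: v4 => //; case: (ltnP a u) => // lt; first by move: e; rewrite comp_out //; lia.
  by lia.
apply: (krel_step (shape_part h a) (h a) i1 i4) IH' => //.
- by have [] := comp_balanced a h.
- by have [] := comp_balanced a hi.
- case=> // r hr; case: ltnP => // le; have := h _ _ hr; rewrite !shape_out //; lia.
- by move=> r; rewrite ltnS => /(shape_out hi).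
Qed.

(** * Finite sums over tableaux, reindexed by reverse insertion *)

Definition dec (P : Prop) : bool := if excluded_middle_informative P then true else false.
Lemma decP P : reflect P (dec P).
Proof. by rewrite /dec; case: excluded_middle_informative => h; constructor. Qed.

Lemma dec_iff (P Q : Prop) : (P <-> Q) -> dec P = dec Q.
Proof. by move=> h; apply/decP/decP; rewrite h. Qed.

Arguments st : simpl never.
Arguments rst : simpl never.
Arguments ins : simpl never.
Arguments shape : simpl never.

(** A letter [a] occurs only in rows of index less than [a], so a finite function records all
    tableaux with letters at most [m], and sums over tableaux become sums over a finite type. *)
Definition ffill m := {ffun 'I_m * 'I_m -> bool}.

Definition toF m (t : ffill m) : filling := fun a r =>
  if a is b.+1 then
    if @insub _ (fun i => i < m) 'I_m b is Some i then
      if @insub _ (fun i => i < m) 'I_m r is Some j then t (i, j) else false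
    else false
  else false.

Definition ofF m (p : filling) : ffill m := [ffun ij => p (val ij.1).+1 (val ij.2)].

Lemma toFK m (t : ffill m) : ofF m (toF t) = t.
Proof. by apply/ffunP => -[i j]; rewrite ffunE /= !valK. Qed.

Lemma tab_row m p a r : tab m p -> p a r -> r < a.
Proof.
move=> [h1 h2] e; have := h1 _ _ e; case: a e => // a e _; case: r e => // r e.
by case: ltnP => // le; have := h2 a r e; rewrite (@shape_out p a r h2) //; lia.
Qed.

Lemma ofFK m p : tab m p -> toF (ofF m p) = p.
Proof.
move=> hp; apply: functional_extensionality => -[|a]; apply: functional_extensionality => r.
  by case e: (p 0 r) => //; have := hp.1 _ _ e.
rewrite /toF; case: insubP => [i _ ei|ni]; last first.
  by case e: (p a.+1 r) => //; have := hp.1 _ _ e; lia.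
case: insubP => [j _ ej|nj]; first by rewrite ffunE /= ei ej.
by case e: (p a.+1 r) => //; have := hp.1 _ _ e; have := tab_row hp e; lia.
Qed.

Local Open Scope ring_scope.

Lemma sum_bij (V : nmodType) (I J : finType) (P : pred I) (Q : pred J) (F : I -> V) (G : J -> V)
    (f : I -> J) (g : J -> I) :
  (forall i, P i -> Q (f i) /\ g (f i) = i) -> (forall j, Q j -> P (g j) /\ f (g j) = j) ->
  (forall i, P i -> F i = G (f i)) -> \sum_(i | P i) F i = \sum_(j | Q j) G j.
Proof.
move=> h1 h2 h3; rewrite (reindex_onto g f) /=; last by move=> i /h1 [].
apply: eq_big => [j|j].
  apply/idP/idP => [/andP [/h1 [+ _] /eqP e]|qj]; first by rewrite e.
  by have [-> ->] := h2 _ qj; rewrite eqxx.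
by case/andP => /h3 -> /eqP ->.
Qed.

Definition TS (V : nmodType) m (C : filling -> Prop) (g : filling -> V) : V :=
  \sum_(t : ffill m | dec (tab m (toF t) /\ C (toF t))) g (toF t).

Definition isc m (p : filling) r := (shape p m r.+1 < shape p m r)%N.

Definition wx (s : status) : nat := if s is Wait x then x else 0%N.
Definition rowof (s : status) : nat := if s is Act _ r then r else 0%N.
Definition newof (s : status) : bool := if s is Act b _ then b else false.

Lemma isc_lt m p r : tab m p -> isc m p r -> (r < m)%N.
Proof. by move=> [_ h]; rewrite /isc; case: (ltnP r m) => // le; rewrite !(shape_out h) //; lia. Qed.

(** Insertion and reverse insertion are inverse bijections between a tableau with a corner, kept or
    removed, and a tableau with a letter to insert. [p] is the result on the left and the source on
    the right. *)
Lemma edge_sum (V : nmodType) m (C : filling -> Prop) (h : filling -> nat -> bool -> nat -> V) :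
  TS m C (fun p => \sum_(b : bool) \sum_(r < m | isc m p r)
      h (rins p m (Act b r)) (wx (rst p m (Act b r) 0)) b r) =
  \sum_(1 <= x < m.+1) TS m (fun p => C (ins p x)) 
      (fun p => h p x (newof (st p x m)) (rowof (st p x m))).
Proof.
rewrite big_add1 /= big_mkord /TS; under eq_bigr => t _ do rewrite pair_big_dep /=.
rewrite !pair_big_dep /=.
case: m C h => [|m] C h.
  by rewrite [LHS]big1 ?[RHS]big1 // => [[[x hx] t] | [t [b [r hr]]]].
pose P0 (i : ffill m.+1 * (bool * 'I_m.+1)) := dec (tab m.+1 (toF i.1) /\ C (toF i.1)) && isc m.+1 (toF i.1) i.2.2.
pose rv (i : ffill m.+1 * (bool * 'I_m.+1)) := rins (toF i.1) m.+1 (Act i.2.1 i.2.2).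
pose xv (i : ffill m.+1 * (bool * 'I_m.+1)) := wx (rst (toF i.1) m.+1 (Act i.2.1 i.2.2) 0).
have K i : P0 i -> [/\ tab m.+1 (rv i), (0 < xv i <= m.+1)%N, ins (rv i) (xv i) = toF i.1 &
     st (rv i) (xv i) m.+1 = Act i.2.1 i.2.2].
  case/andP => /decP [ht _] hc; have [y y0 e] := rst_wait i.2.1 ht.2 hc.
  by have := rinsP ht hc e; rewrite /xv e /rv.
pose Q (j : 'I_m.+1 * ffill m.+1) := dec (tab m.+1 (toF j.2) /\ C (ins (toF j.2) j.1.+1)).
apply: (@sum_bij _ _ _ P0 Q _ _ (fun i => (inord (xv i).-1, ofF m.+1 (rv i)))
  (fun j => let s := st (toF j.2) j.1.+1 m.+1 in 
     (ofF m.+1 (ins (toF j.2) j.1.+1), (newof s, inord (rowof s))))).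
- move=> i Pi; have [k1 k2 k3 k4] := K i Pi.
  have e : (inord (xv i).-1 : 'I_m.+1).+1 = xv i by rewrite inordK; lia.
  split.
    by apply/decP; rewrite /= e ofFK // k3; split=> //; case/andP: Pi => /decP [].
  rewrite /= e ofFK // k4 /= k3 toFK.
  by case: (i) => t [b r] /=; rewrite inord_val.
- move=> [x t] /decP [/= ht hC]; have xm : (0 < x.+1 <= m.+1)%N by have := ltn_ord x; lia.
  have [b [r [k1 k2 k3 k4]]] := insP ht xm.
  have rm : (r < m.+1)%N by apply: (isc_lt k2).
  rewrite k1 /=; have Pi : P0 (ofF m.+1 (ins (toF t) x.+1), (b, inord r)).
    by rewrite /P0 /= ofFK // inordK // /isc k3 andbT; apply/decP.
  split=> //; rewrite /rv /xv /= ofFK // inordK // -k1.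
  by rewrite ins_rins // toFK ins_st //= ?inord_val //; exact: ht.2.
- move=> i Pi; have [k1 k2 k3 k4] := K i Pi.
  have e : (inord (xv i).-1 : 'I_m.+1).+1 = xv i by rewrite inordK; lia.
  by rewrite /= e ofFK // k4.
Qed.

Local Close Scope ring_scope.

Local Open Scope ring_scope.

Definition hasc B (al : nat -> nat) c := has (fun v => al v == c) (iota 1 B).

Definition botb (al : nat -> nat) B k v :=
  [&& 0 < v <= B, al v == k & all (fun u => (al u == k) ==> (v <= u)) (iota 1 B)]%N.

Definition phi B c (al : nat -> nat) v := (al v - botb al B c v)%N.

Lemma botbP (al : nat -> nat) A k v :
  reflect [/\ (0 < v <= A)%N, al v = k & forall u, (0 < u <= A)%N -> al u = k -> (v <= u)%N]
  (botb al A k v).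
Proof.
apply: (iffP and3P) => -[h1 h2 h3]; split=> //; try exact/eqP.
  move=> u hu e; move/allP: h3 => /(_ u); rewrite mem_iota; lia.
by apply/allP => u; rewrite mem_iota => hu; apply/implyP => /eqP; apply: h3; lia.
Qed.

Lemma shape_le p a r : (shape p a r <= a)%N.
Proof. by rewrite /shape; elim: a => // a IH; case: (p _ _); lia. Qed.

Section Sums.
Variables (V : nmodType) (B : nat) (g : (nat -> nat) -> V).

(* Sums over multistrips of size d, the last column being at most b. *)
Fixpoint NN d b al : V :=
  if d is k.+1 then
    \sum_(1 <= c < b.+1 | hasc B al c) (NN k c al + NN k c.-1 (phi B c al))
  else g al.

(* Sums over weakly increasing words of length d, the last letter being at most a. *)
Fixpoint YY m d a (C : filling -> Prop) : V :=
  if d is k.+1 then \sum_(1 <= x < a.+1) YY m k x (fun p => C (ins p x))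
  else TS m C (fun p => g (comp p m)).

(** Entries of the weight are row lengths, and the lowest row of a given positive length is a
    corner. *)
Lemma hasc_row m p c : tab m p -> (m <= B)%N -> (0 < c)%N ->
  hasc B (comp p m) c = has (fun r => isc m p r && (shape p m r == c)) (iota 0 m).
Proof.
move=> tp mB c0; have [bal _] := comp_balanced m tp.2.
apply/hasP/hasP => [[v _ /eqP e]|[r]].
  have hv : (0 < v <= m)%N by case: (boolP (0 < v <= m)%N) => // /comp_out e'; move: c0; rewrite -e e'.
  have [r rm lr] := bal_row bal hv; rewrite e in lr.
  have ex : exists r, shape p m r == c by exists r; rewrite lr.
  have ub i : shape p m i == c -> (i <= m)%N.
    by case: (leqP i m) => // lt /eqP; rewrite (shape_out tp.2) ?(ltnW lt) //; lia.
  case: (ex_maxnP ex ub) => i /eqP hi mx; exists i; last first.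
    rewrite hi eqxx andbT /isc; have := shape_part tp.2 m i; rewrite leq_eqVlt => /orP [/eqP e'|] //.
    by have := mx i.+1; rewrite e' hi eqxx; lia.
  rewrite mem_iota /=; case: (ltnP i m) => // le; move: hi; rewrite (shape_out tp.2) //; lia.
rewrite mem_iota => hr /andP [_ /eqP e].
have : (0 < mult (comp p m) (iota 1 m) c)%N.
  by rewrite bal /mult -has_count; apply/hasP; exists r; rewrite ?e // mem_iota.
rewrite /mult -has_count => /hasP [v]; rewrite mem_iota => hv ev; exists v => //.
by rewrite mem_iota; lia.
Qed.

Lemma NN_corners m p b (f : nat -> V) : tab m p -> (m <= B)%N ->
  \sum_(1 <= c < b.+1 | hasc B (comp p m) c) f c =
  \sum_(r < m | isc m p r && (shape p m r <= b)%N) f (shape p m r).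
Proof.
move=> tp mB; have mono i j : (i <= j)%N -> (shape p m j <= shape p m i)%N.
  exact: (part_le (shape_part tp.2 m)).
transitivity (\sum_(1 <= c < b.+1) \sum_(r < m | isc m p r && (shape p m r == c)) f c).
  rewrite big_mkcond; apply: eq_big_nat => c /andP [c0 _].
  rewrite (hasc_row tp) //; case: hasP => [[r]|n]; last first.
    rewrite big_pred0 // => r; apply/negP => h; case: n; exists (val r) => //.
    by rewrite mem_iota ltn_ord.
  rewrite mem_iota => hr /andP [h1 h2]; rewrite (big_pred1 (Ordinal hr)) // => -[i hi] /=.
  rewrite -val_eqE /=; apply/andP/eqP => [[h3 /eqP h4]|->] //; move/eqP: h2 => h2.
  by case: (ltngtP i r) => // lt; have := mono _ _ lt; move: h1 h3; rewrite /isc; lia.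
rewrite big_add1 /= big_mkord.
rewrite (exchange_big_dep (fun r : 'I_m => isc m p r)) /=; last by move=> i j _ /andP [].
rewrite [RHS]big_mkcondr /=; apply: eq_bigr => r hr.
case: ifP => [le|nle]; last first.
  by rewrite big_pred0 // => c; rewrite hr /=; apply/eqP => e; have := ltn_ord c; lia.
have s0 : (0 < shape p m r)%N by move: hr; rewrite /isc; lia.
have sb : ((shape p m r).-1 < b)%N by lia.
rewrite (big_pred1 (Ordinal sb)) /=; first by rewrite prednK.
case=> c hc; rewrite hr /= -val_eqE /=; apply/eqP/eqP; lia.
Qed.

(** The bound for the next column is the length of the corner's row after the step: [c] if the
    corner is kept and [c-1] if it is removed. The weights come from [comp_ins], read backwards. *)
Lemma NN_step m p d b : tab m p -> (m <= B)%N ->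
  NN d.+1 b (comp p m) = \sum_(c : bool) \sum_(r < m | isc m p r) 
    if (shape p m r <= b)%N then NN d (shape (rins p m (Act c r)) m r) (comp (rins p m (Act c r)) m)
    else 0.
Proof.
move=> tp mB; rewrite /= (NN_corners _ (fun c => NN d c (comp p m) + NN d c.-1 (phi B c (comp p m)))) //.
rewrite big_split /= addrC big_bool /=; congr (_ + _); rewrite [LHS]big_mkcondr /=;
  apply: eq_bigr => r hr; case: ifP => // _.
- have [x x0 hw] := rst_wait true tp.2 hr; have [t1 xm t3 t4] := rinsP tp hr hw.
  have [b' [r' [k1 _ _ k4]]] := insP t1 xm; rewrite t4 in k1; case: k1 => ? ?; subst b' r'.
  have := comp_ins m x0 t1.2; rewrite t4 t3 in k4 *.
  move=> [v [v1 v2 v3 v4]]; have := k4 r; rewrite eqxx /= addn1 => e; rewrite e /=.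
  congr (NN _ _ _); apply: functional_extensionality => u; rewrite /phi v3.
  suff -> : botb (comp p m) B (shape (rins p m (Act true r)) m r).+1 u = (u == v) by lia.
  apply/botbP/eqP => [[h1 h2 h3]|->].
    have := h3 v ltac:(lia); rewrite v3 v2 eqxx addn1 => /(_ erefl) le.
    case: (u =P v) => // ne; move: h2; rewrite v3; case: eqP => // _; rewrite addn0 => h2.
    have := v4 u; case: (leqP u m) => um; first by lia.
    by move: h2; rewrite comp_out //; lia.
  split; [lia|by rewrite v3 v2 eqxx addn1|].
  move=> w w1; rewrite v3; case: eqP => [->|_] //; rewrite addn0 => h.
  have := v4 w; case: (leqP w m) => um; first by lia.
  by move: h; rewrite comp_out //; lia.
- have [x x0 hw] := rst_wait false tp.2 hr; have [t1 xm t3 t4] := rinsP tp hr hw.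
  have [b' [r' [k1 _ _ k4]]] := insP t1 xm; rewrite t4 in k1; case: k1 => ? ?; subst b' r'.
  have := comp_ins m x0 t1.2; rewrite t4 t3 in k4 * => /= ->.
  by have := k4 r; rewrite addn0 => ->.
Qed.

Lemma TS_eq m (C C' : filling -> Prop) (f f' : filling -> V) :
  (forall p, tab m p -> C p <-> C' p) -> (forall p, tab m p -> C p -> f p = f' p) ->
  TS m C f = TS m C' f'.
Proof.
move=> h1 h2; apply: eq_big => [t|t /decP [? ?]]; last exact: h2.
by apply: dec_iff; split=> -[? ?]; split=> //; apply/h1.
Qed.

Lemma YY_eq m d a (C C' : filling -> Prop) : (a <= m)%N ->
  (forall p, tab m p -> C p <-> C' p) -> YY m d a C = YY m d a C'.
Proof.
elim: d a C C' => [|d IH] a C C' am h /=; first exact: TS_eq.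
apply: eq_big_nat => x hx; apply: IH; first by lia.
have xm : (0 < x <= m)%N by lia.
by move=> p tp; apply: h; have [? [? [_ ti _ _]]] := insP tp xm.
Qed.

(** By [order_step] the letters allowed before [x] are those whose corner lies weakly below the row
    where [x] stops; for corners this is a bound on the row length, hence on the column. *)
Lemma YY_NN_ins m d x C : (0 < x <= m)%N -> (m <= B)%N ->
  YY m d x (fun p => C (ins p x)) = 
  TS m (fun p => C (ins p x)) (fun p => NN d (shape p m (rowof (st p x m))) (comp p m)).
Proof.
move=> + mB; elim: d x C => [|d IH] x C xm //.
pose C' p := C (ins p x).
pose h p x' (b : bool) r := if (x' <= x)%N then NN d (shape p m r) (comp p m) else 0.
transitivity (\sum_(1 <= x' < m.+1) TS m (fun p => C' (ins p x')) 
   (fun p => h p x' (newof (st p x' m)) (rowof (st p x' m)))).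
  rewrite /= [RHS](big_cat_nat _ (n := x.+1)) //=; last by lia.
  rewrite [X in _ = _ + X]big_nat_cond [X in _ = _ + X]big1 ?addr0; last first.
    move=> x' hx'; rewrite /TS big1 // => t _; rewrite /h ifF //; lia.
  apply: eq_big_nat => x' hx'; rewrite (IH _ (fun p => C' p)); last by lia.
  by apply: TS_eq => // p _ _; rewrite /h ifT //; lia.
rewrite -edge_sum; apply: TS_eq => // p tp _.
rewrite (NN_step _ _ tp) //; apply: eq_bigr => b _; apply: eq_bigr => r hr; rewrite /h.
have [x' x0 hw] := rst_wait b tp.2 hr; have [t1 xm' t3 t4] := rinsP tp hr hw; rewrite hw /=.
have x0' : (0 < x)%N by lia.
have := order_step x0 x0' t1.2 m; rewrite t3 t4.
have [b0 [r0 [-> _ _ _]]] := insP tp xm => /= ->.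
congr (if _ then _ else _); have mono := part_le (shape_part tp.2 m).
case: (leqP r0 r) => [/mono ->|lt] //; symmetry.
by have := mono _ _ lt; move: hr; rewrite /isc; lia.
Qed.

Lemma YY_NN m d C : (m <= B)%N -> YY m d m C = TS m C (fun p => NN d m (comp p m)).
Proof.
move=> mB; case: d => [|d] //.
transitivity (\sum_(1 <= x < m.+1) TS m (fun p => C (ins p x)) 
   (fun p => NN d (shape p m (rowof (st p x m))) (comp p m))).
  by apply: eq_big_nat => x hx; apply: (@YY_NN_ins m d x C); lia.
rewrite -(@edge_sum _ m C (fun p x b r => NN d (shape p m r) (comp p m))).
apply: TS_eq => // p tp _; rewrite (NN_step _ _ tp) //.
by apply: eq_bigr => b _; apply: eq_bigr => r _; rewrite shape_le.
Qed.

End Sums.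

Local Close Scope ring_scope.

(** * Reading words *)

Lemma he_ctx u v a b : hecke_equiv a b -> hecke_equiv (u ++ a ++ v) (u ++ b ++ v).
Proof.
elim=> {a b} [a|a b h|a b _ /he_sym //|a b c _ h1 _ h2]; first exact: he_refl; last exact: he_trans h2.
apply: he_step; case: h => [u' v' i|u' v' i|u' v' i j h]; rewrite !catA -!(catA (u ++ u')) -!(catA _ v' v).
- exact: hs_idem.
- exact: hs_braid.
- exact: hs_comm.
Qed.

Lemma he_cat a b c d : hecke_equiv a b -> hecke_equiv c d -> hecke_equiv (a ++ c) (b ++ d).
Proof.
move=> h1 h2; apply: (he_trans (b := b ++ c)); first exact: (he_ctx [::] c h1).
by have := he_ctx b [::] h2; rewrite !cats0.
Qed.

Lemma he_catl a c d : hecke_equiv c d -> hecke_equiv (a ++ c) (a ++ d).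
Proof. by apply: he_cat; exact: he_refl. Qed.

Lemma he_catr a c d : hecke_equiv c d -> hecke_equiv (c ++ a) (d ++ a).
Proof. by move=> h; apply: he_cat => //; exact: he_refl. Qed.

Definition far x y := (x + 2 <= y) || (y + 2 <= x).

Lemma he_far x s : all (far x) s -> hecke_equiv (x :: s) (s ++ [:: x]).
Proof.
elim: s => [|y s IH] /=; first by move=> _; exact: he_refl.
case/andP => h1 h2; apply: (he_trans (b := y :: x :: s)).
  exact: he_step (@hs_comm [::] s _ _ h1).
exact: (he_catl [:: y] (IH h2)).
Qed.

Lemma he_idem x : hecke_equiv [:: x; x] [:: x].
Proof. exact: he_step (@hs_idem [::] [::] x). Qed.

Definition rowL (p : filling) a r := [seq b <- iota 1 a | p b r].
Definition tailL (p : filling) m a r := [seq b <- iota a.+1 (m - a) | p b r].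

Fixpoint wd (f : nat -> seq nat) R := if R is k.+1 then f k ++ wd f k else [::].

Definition rword (p : filling) m := wd (rowL p m) m.

Lemma eq_wd f g R : (forall r, r < R -> f r = g r) -> wd f R = wd g R.
Proof. by elim: R => //= R IH h; rewrite h // IH // => r lt; apply: h; lia. Qed.

Lemma wd_one f g R r0 : (forall r, r != r0 -> f r = g r) -> hecke_equiv (f r0) (g r0) ->
  hecke_equiv (wd f R) (wd g R).
Proof.
move=> h1 h2; elim: R => [|R IH] /=; first exact: he_refl.
case: (R =P r0) => [e|/eqP n]; first by apply: he_cat => //; rewrite e.
by rewrite h1 //; exact: he_catl.
Qed.

Lemma wd_pair f g R r0 : (forall r, r != r0 -> r != r0.+1 -> f r = g r) -> r0.+1 < R ->
  hecke_equiv (f r0.+1 ++ f r0) (g r0.+1 ++ g r0) -> hecke_equiv (wd f R) (wd g R).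
Proof.
move=> h1 lt h2; elim: R lt => // R IH; rewrite ltnS leq_eqVlt => /orP [/eqP <-|lt] /=.
  rewrite !catA (@eq_wd f g r0); first exact: he_catr.
  by move=> r lr; apply: h1; lia.
by rewrite h1; [apply: he_catl; exact: IH|lia|lia].
Qed.

Lemma wdS f k : wd f k.+1 = f k ++ wd f k. Proof. by []. Qed.
Arguments wd : simpl never.

Lemma rowLS p a r : rowL p a.+1 r = rowL p a r ++ (if p a.+1 r then [:: a.+1] else [::]).
Proof.
have e : iota 1 a.+1 = iota 1 a ++ [:: a.+1] by rewrite -{1}[a.+1]addn1 iotaD.
by rewrite /rowL e filter_cat.
Qed.

Lemma tailLS p m a r : a < m -> tailL p m a r = (if p a.+1 r then [:: a.+1] else [::]) ++ tailL p m a.+1 r.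
Proof. by rewrite /tailL => /subnSK <- /=; case: ifP. Qed.

Lemma row_tail p m a r : a <= m -> rowL p a r ++ tailL p m a r = rowL p m r.
Proof. by move=> le; rewrite /rowL /tailL -filter_cat -[a.+1]add1n -iotaD subnKC. Qed.

Lemma rowL_eq p p' a r : (forall b, b <= a -> p b r = p' b r) -> rowL p a r = rowL p' a r.
Proof. by move=> h; apply: eq_in_filter => b; rewrite mem_iota => hb; apply: h; lia. Qed.

Lemma rowL_rcons p a r L z : rowL p a r = rcons L z -> z <= a /\ forall y, y \in L -> y < z.
Proof.
move=> e; have : sorted ltn (rcons L z).
  by rewrite -e; apply: (sorted_filter ltn_trans); exact: iota_ltn_sorted.
have : z \in rowL p a r by rewrite e mem_rcons inE eqxx.
rewrite mem_filter mem_iota => /andP [_ hz] srt; split=> [|y yL]; first by lia.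
move: srt; rewrite (sorted_pairwise ltn_trans) pairwise_rcons => /andP [/allP h _]; exact: h.
Qed.

Lemma tailL_gt p m a r y : y \in tailL p m a r -> a < y.
Proof. by rewrite mem_filter mem_iota; lia. Qed.

(* The status after the letters up to [a]: one more letter [z] is waiting at the end of row [r0];
   the letters bigger than [a] are still those of [p]. *)
Definition prow (p P : filling) m a b r0 z r :=
  if r == r0 then (if b then rowL p a r else rowL P a r) ++ tailL p m a r ++ [:: z]
  else rowL P a r ++ tailL p m a r.

(** [z] is the letter that has stopped at the end of row [r0]; the rows below [r0] are still those
    of [p]. *)
Definition hinv (p P : filling) (a : nat) b r0 z :=
  (if b then rowL P a r0 = rcons (rowL p a r0) z else exists L, rowL P a r0 = rcons L z) /\
  (forall c r, c <= a -> r0 < r -> P c r = p c r).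

(** All the letters that cross differ by at least two, because [z] lies strictly between [L] and
    [b], and [b] below [T]. This is the move in which [z] takes the place of [b]. *)
Lemma move_out (L T : seq nat) z b : z < b -> (forall y, y \in L -> y < z) -> (forall y, y \in T -> b < y) ->
  hecke_equiv (L ++ b :: T ++ [:: z]) (b :: rcons L z ++ T).
Proof.
move=> zb hL hT.
apply: (he_trans (b := L ++ b :: z :: T)).
  apply: he_catl; apply: (@he_catl [:: b]); apply: he_sym; apply: he_far.
  by apply/allP => y /hT h; rewrite /far; lia.
have -> : L ++ b :: z :: T = (L ++ [:: b]) ++ z :: T by rewrite -catA.
have -> : b :: rcons L z ++ T = (b :: L) ++ z :: T by rewrite cat_rcons.
by apply: he_catr; apply: he_sym; apply: he_far; apply/allP => y /hL h; rewrite /far; lia.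
Qed.

(** Here [b] remains in its row and a copy leaves. For [b = z+1] this is the braid relation;
    otherwise [b] and [z] commute and idempotence allows one copy of [z] to be traded for one of
    [b]. *)
Lemma move_out2 (L T : seq nat) z b : z < b -> (forall y, y \in L -> y < z) -> (forall y, y \in T -> b < y) ->
  hecke_equiv (rcons L z ++ b :: T ++ [:: z]) (b :: rcons L z ++ b :: T).
Proof.
move=> zb hL hT.
apply: (he_trans (b := L ++ [:: z; b; z] ++ T)).
  rewrite cat_rcons; apply: he_catl; apply: (@he_catl [:: z; b]); apply: he_sym; apply: he_far.
  by apply/allP => y /hT h; rewrite /far; lia.
apply: (he_trans (b := L ++ [:: b; z; b] ++ T)).
  apply: he_ctx; case: (b =P z.+1) => [->|n]; first exact: he_step (@hs_braid [::] [::] z).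
  have f1 : far z b by rewrite /far; lia.
  have c : hecke_equiv [:: z; b] [:: b; z] by apply: (@he_far z [:: b]); rewrite /= f1.
  apply: (he_trans (b := [:: b; z; z])); first exact: (he_catr [:: z] c).
  apply: (he_trans (b := [:: b; z])); first exact: (@he_catl [:: b] _ _ (he_idem z)).
  apply: (he_trans (b := [:: b; b; z])); first exact: (@he_catr [:: z] _ _ (he_sym (he_idem b))).
  exact: (@he_catl [:: b] _ _ (he_sym c)).
have -> : L ++ [:: b; z; b] ++ T = (L ++ [:: b]) ++ [:: z; b] ++ T by rewrite -catA.
have -> : b :: rcons L z ++ b :: T = (b :: L) ++ [:: z; b] ++ T by rewrite cat_rcons.
by apply: he_catr; apply: he_sym; apply: he_far; apply/allP => y /hL h; rewrite /far; lia.
Qed.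

Lemma dup_last (L T : seq nat) z : (forall y, y \in T -> z.+1 < y) ->
  hecke_equiv (rcons L z ++ T ++ [:: z]) (rcons L z ++ T).
Proof.
move=> hT; apply: (he_trans (b := rcons L z ++ z :: T)).
  apply: he_catl; apply: he_sym; apply: he_far.
  by apply/allP => y /hT h; rewrite /far; lia.
rewrite !cat_rcons; apply: he_catl; exact: (@he_catr T _ _ (he_idem z)).
Qed.

Lemma ins_early m p x c : tab m p -> c < x -> ins p x c = p c.
Proof.
move=> tp; case: c => [|c] lt.
  by apply: functional_extensionality => r; case e: (p 0 r) => //; have := tp.1 _ _ e.
rewrite /ins st_early /=; last lia.
by case: eqP => // ?; lia.
Qed.

(** Reading the letter [a+1] affects only the row [r1] of the current status and the row below it,
    so the words are compared on this pair of rows. *)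
Lemma hecke_step_st p m x a : tab m p -> 0 < x <= m -> a < m ->
  (forall b r0, st p x a = Act b r0 -> exists z, hinv p (ins p x) a b r0 z /\
      hecke_equiv (wd (rowL p m) m.+1 ++ [:: x]) (wd (prow p (ins p x) m a b r0 z) m.+1)) ->
  forall b r0, st p x a.+1 = Act b r0 -> exists z, hinv p (ins p x) a.+1 b r0 z /\
      hecke_equiv (wd (rowL p m) m.+1 ++ [:: x]) (wd (prow p (ins p x) m a.+1 b r0 z) m.+1).
Proof.
move=> tp xm am IH b r0.
have /andP [x0 _] := xm; have [i1 i2 _ _] := st_inv x0 tp.2 a.
have e1 : forall i, ins p x a.+1 i = (fstep a.+1 (shape p a) (st p x a) (p a.+1)).2 i by [].
have -> : st p x a.+1 = (fstep a.+1 (shape p a) (st p x a) (p a.+1)).1 by [].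
have pp := shape_part tp.2 a; have hh := tp.2 a.
have W := @st_wait p x a.
have EQ c : c < x -> ins p x c = p c by exact: ins_early tp.
move: (ins p x) IH i1 e1 EQ => P IH i1 e1 EQ.
have RS r : rowL P a.+1 r ++ tailL p m a.+1 r = if P a.+1 r == p a.+1 r then rowL P a r ++ tailL p m a r
    else rowL P a r ++ (if P a.+1 r then [:: a.+1] else [::]) ++ tailL p m a.+1 r.
  by rewrite rowLS -catA (tailLS p r am); case: eqP => [->|].
case: (st p x a) e1 IH i1 i2 W => [y|b1 r1] /= e1 IH i1 i2 W.
  have ? := W _ erefl; subst y; case: eqP e1 => // xa e1; rewrite /bump => eb.
  have : r0 = 0 by move: eb; case: ifP => _ [].
  move=> ?; subst r0; exists x.
  have eP c r : c <= a -> P c r = p c r by move=> ca; rewrite EQ //; lia.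
  have eP' r : 0 < r -> P a.+1 r = p a.+1 r.
    by move=> r1; rewrite e1 /bump; case: (p _ 0) => //=; rewrite /setr; case: eqP => // ?; lia.
  split; first split.
  - case: b eb; rewrite /bump; case q0: (p a.+1 0) => //= _.
      by rewrite !rowLS e1 /bump q0 /= /setr cats0 cats1 -xa (@rowL_eq P p) // => c; apply: eP.
    by exists (rowL P a 0); rewrite rowLS e1 /bump q0 /= q0 cats1 xa.
  - move=> c r; rewrite leq_eqVlt => /orP [/eqP ->|lt] r1; first exact: eP'.
    by apply: eP; lia.
  have e r : 0 < r -> prow p P m a.+1 b 0 x r = rowL p m r.
    move=> r1; rewrite /prow; case: eqP => // [?|_]; first lia.
    rewrite -(row_tail p r am); congr (_ ++ _); apply: rowL_eq => c; rewrite leq_eqVlt => /orP [/eqP ->|lt].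
      exact: eP'.
    by apply: eP; lia.
  have e0 : prow p P m a.+1 b 0 x 0 = rowL p m 0 ++ [:: x].
    rewrite /prow eqxx catA -(row_tail p 0 am); congr ((_ ++ _) ++ _); case: b {e} eb => //.
    case q0: (p a.+1 0) => // _; apply: rowL_eq => c; rewrite leq_eqVlt => /orP [/eqP ->|lt].
      by rewrite e1 /bump q0.
    by apply: eP; lia.
  have -> k : wd (prow p P m a.+1 b 0 x) k.+1 = wd (rowL p m) k.+1 ++ [:: x]; last exact: he_refl.
  elim: k => [|k IHk]; first by rewrite !wdS e0 !cats0.
  by rewrite wdS IHk e // [in RHS]wdS catA.
have [z [[hz1 hz2] hz3]] := IH _ _ erefl.
have A0 := hh r1; have A1 := hh r1.+1; have P1 := pp r1.
case: i1 => i1 i3; have [za hL] : z <= a /\ (forall L, rowL P a r1 = rcons L z -> forall y, y \in L -> y < z).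
  split; first by case: b1 hz1 {e1 IH i1 W hz3} => [|[L]] /rowL_rcons [].
  by move=> L /rowL_rcons [].
have rU : rowL P a r1.+1 = rowL p a r1.+1 by apply: rowL_eq => c ca; apply: hz2.
have T1g y : y \in tailL p m a.+1 r1 -> a.+1 < y by move/tailL_gt.
have stay : (forall i, P a.+1 i = p a.+1 i) -> p a.+1 r1 = false -> Act b1 r1 = Act b r0 ->
  exists z0, hinv p P a.+1 b r0 z0 /\
    hecke_equiv (wd (rowL p m) m.+1 ++ [:: x]) (wd (prow p P m a.+1 b r0 z0) m.+1).
  move=> e q1 [<- <-]; exists z; split; first split.
  - by case: (b1) hz1 => [|[L hl]]; rewrite !rowLS e q1 !cats0 //; exists L.
  - move=> c r; rewrite leq_eqVlt => /orP [/eqP ->|lt] // hr; exact: hz2.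
  suff <- : wd (prow p P m a b1 r1 z) m.+1 = wd (prow p P m a.+1 b1 r1 z) m.+1 by [].
  apply: eq_wd => r _; rewrite /prow; case: eqP => [->|n].
    by rewrite !rowLS e q1 !cats0 (tailLS p r1 am) q1.
  by rewrite RS e eqxx.
have hup b2 : (forall i, r1.+1 < i -> P a.+1 i = p a.+1 i) ->
  (if b2 then ~~ p a.+1 r1.+1 && P a.+1 r1.+1 else P a.+1 r1.+1) -> hinv p P a.+1 b2 r1.+1 a.+1.
  move=> e h; split; last first.
    move=> c r; rewrite leq_eqVlt => /orP [/eqP ->|lt] hr; first exact: e.
    by apply: hz2; lia.
  case: b2 h => [/andP [/negbTE h1 h2]|h]; last by exists (rowL P a r1.+1); rewrite rowLS h cats1.
  by rewrite !rowLS h1 h2 cats0 cats1 rU.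
pose X := rowL p a r1.+1 ++ (if p a.+1 r1.+1 then [:: a.+1] else [::]) ++ tailL p m a.+1 r1.+1.
have moved b2 : p a.+1 r1 -> (forall i, i != r1 -> i != r1.+1 -> P a.+1 i = p a.+1 i) ->
  P a.+1 r1 = ~~ b1 -> (if b2 then ~~ p a.+1 r1.+1 && P a.+1 r1.+1 else p a.+1 r1.+1 && P a.+1 r1.+1) ->
  Act b2 r1.+1 = Act b r0 -> exists z0, hinv p P a.+1 b r0 z0 /\
    hecke_equiv (wd (rowL p m) m.+1 ++ [:: x]) (wd (prow p P m a.+1 b r0 z0) m.+1).
  move=> q1 e e1' e2 [<- <-]; exists a.+1; split.
    apply: hup; first by move=> i hi; apply: e; lia.
    by case: b2 e2 => // /andP [].
  apply: (he_trans hz3); apply: (wd_pair (r0 := r1)).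
  - move=> r n1 n2; rewrite /prow (negbTE n1) (negbTE n2) RS e // eqxx //.
  - by have := tab_row tp q1; lia.
  have -> : prow p P m a b1 r1 z r1.+1 = X by rewrite /prow eqSn rU (tailLS p _ am).
  have -> : prow p P m a.+1 b2 r1.+1 a.+1 r1.+1 = X ++ [:: a.+1].
    rewrite /prow eqxx /X !rowLS rU; case: b2 e2 => /andP [].
      by move=> /negbTE -> _; rewrite cats0 /= catA.
    by move=> -> ->; rewrite -!catA.
  have -> : prow p P m a.+1 b2 r1.+1 a.+1 r1 = rowL P a r1 ++ (if b1 then [::] else [:: a.+1]) ++ 
      tailL p m a.+1 r1.
    by rewrite /prow eqnS rowLS e1' -catA; case: (b1).
  rewrite -catA; apply: he_catl; rewrite /prow eqxx (tailLS p _ am) q1 cat1s.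
  case: b1 hz1 {IH e1 i1 W hz3 stay e1'} => [e3|[L e3]]; rewrite e3.
    by rewrite cat0s; apply: (move_out _ (hL _ e3) T1g).
  by apply: (move_out2 _ (hL _ e3) T1g).
case: b1 e1 IH i1 i2 W hz1 hz2 hz3 stay moved => e1 IH i1 i2 W hz1 hz2 hz3 stay moved;
  case q1: (p a.+1 r1) e1 stay => /= e1 stay; try by apply: stay.
- move: e1; rewrite /bump; case q2: (p a.+1 r1.+1) => /= e1.
    apply: moved => //; [by move=> i n1 n2; rewrite e1 /setr (negbTE n1)|by rewrite e1 /setr eqxx|].
    by rewrite e1 /setr eqSn q2.
  apply: moved => //; [by move=> i n1 n2; rewrite e1 /setr (negbTE n1) (negbTE n2)| |].
    by rewrite e1 /setr eqnS eqxx.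
  by rewrite e1 /setr q2 eqxx.
- move: e1; rewrite /bump; case q2: (p a.+1 r1.+1) => /= e1.
    by apply: moved; rewrite // ?e1 ?q1 ?q2.
  apply: moved => //; [by move=> i n1 n2; rewrite e1 /setr (negbTE n2)| |].
    by rewrite e1 /setr eqnS q1.
  by rewrite e1 /setr q2 eqxx.
case: ifP e1 => [/andP [q2 /eqP sh] e1|_ e1] /=; last by apply: stay.
move=> [<- <-]; exists a.+1; split; first by apply: hup => [i _|]; rewrite e1.
apply: (he_trans hz3); apply: (wd_pair (r0 := r1)).
- by move=> r n1 n2; rewrite /prow (negbTE n1) (negbTE n2) RS e1 eqxx.
- by have := tab_row tp q2; lia.
have [L e3] := hz1; rewrite /prow !eqxx eqnS eqSn !rowLS !e1 /= q1 q2 (tailLS p r1.+1 am) (tailLS p r1 am) q1 q2.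
rewrite cats0 cat0s cat1s -cat_rcons [rowL P a r1.+1 ++ [:: _]]cats1 e3; apply: he_cat.
  (* After the letter [a+1] the rows [r1] and [r1+1] have equal length, so [a+2] cannot occur in row
     [r1+1]; all later letters of this row commute with [a+1]. *)
  apply: he_sym; apply: dup_last => y hy; have y1 := tailL_gt hy.
  case: (y =P a.+2) => [e|]; last by lia.
  move: hy; rewrite e mem_filter => /andP [/(tp.2 a.+1 r1) h _].
  have [s1 s2] : shape p a.+1 r1.+1 = shape p a r1.+1 + p a.+1 r1.+1 /\
    shape p a.+1 r1 = shape p a r1 + p a.+1 r1 by [].
  by move: h; rewrite s1 s2 q1 q2; lia.
by apply: dup_last => y /T1g; lia.
Qed.

Lemma hecke_rword p m x : tab m p -> 0 < x <= m ->
  hecke_equiv (rword p m ++ [:: x]) (rword (ins p x) m).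
Proof.
move=> tp xm; have [b [r [k1 ti _ _]]] := insP tp xm.
have E q : tab m q -> rword q m = wd (rowL q m) m.+1.
  move=> tq; rewrite wdS; suff -> : rowL q m m = [::] by [].
  apply/eqP; rewrite -size_eq0 size_filter eqn0Ngt -has_count.
  by apply/hasPn => c; rewrite mem_iota => hc; apply/negP => /(tab_row tq); lia.
rewrite !E //; have H a : a <= m -> forall b r0, st p x a = Act b r0 -> exists z, hinv p (ins p x) a b r0 z /\
      hecke_equiv (wd (rowL p m) m.+1 ++ [:: x]) (wd (prow p (ins p x) m a b r0 z) m.+1).
  elim: a => [|a IH] lt //; apply: hecke_step_st => //; apply: IH; lia.
have [z [[h1 _] h2]] := H m (leqnn m) b r k1; apply: (he_trans h2).
have t0 r' : tailL p m m r' = [::] by rewrite /tailL subnn.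
apply: (@wd_one _ _ _ r) => [r' n|]; first by rewrite /prow (negbTE n) t0 cats0.
rewrite /prow eqxx t0 cat0s; case: b h1 {k1 h2} => [->|[L ->]]; first by rewrite cats1; exact: he_refl.
by have := @dup_last L [::] z; rewrite cats0; apply.
Qed.

Lemma shape_local p p' a : (forall b, b <= a -> p b = p' b) -> shape p a = shape p' a.
Proof.
elim: a => [|a IH] h //; apply: functional_extensionality => r.
rewrite -[LHS]/(shape p a r + p a.+1 r) -[RHS]/(shape p' a r + p' a.+1 r) h // IH // => b hb.
by apply: h; lia.
Qed.

Lemma comp_local p p' a : (forall b, b <= a -> p b = p' b) -> comp p a = comp p' a.
Proof.
elim: a => [|a IH] h //=; rewrite h // IH ?(@shape_local p p') // => b hb; apply: h; lia.
Qed.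

Lemma st_local p p' x a : (forall b, b <= a -> p b = p' b) -> st p x a = st p' x a.
Proof.
elim: a => [|a IH] h //; rewrite -[LHS]/(fstep a.+1 (shape p a) (st p x a) (p a.+1)).1.
by rewrite h // IH ?(@shape_local p p') // => b hb; apply: h; lia.
Qed.

Lemma ins_local p p' x a : (forall b, b <= a -> p b = p' b) -> ins p x a = ins p' x a.
Proof.
case: a => [|a] h //; rewrite -[LHS]/(fun r => (fstep a.+1 (shape p a) (st p x a) (p a.+1)).2 r).
by rewrite h // (@st_local p p') ?(@shape_local p p') // => b hb; apply: h; lia.
Qed.

(** * Generating functions *)

Definition trunc N (p : filling) : filling := fun a r => (a <= N) && p a r.

Lemma trunc_le N p a : a <= N -> trunc N p a = p a.
Proof. by move=> h; apply: functional_extensionality => r; rewrite /trunc h. Qed.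

Lemma tab_trunc m N p : tab m p -> tab N (trunc N p).
Proof.
move=> tp; split=> [a r /andP [h1 /tp.1]|a]; first by lia.
move=> r /andP [h1 h2]; rewrite (@shape_local _ p); first exact: tp.2.
by move=> b hb; apply: trunc_le; lia.
Qed.

Lemma trunc_ins m N p x : tab m p -> 0 < x <= N -> N <= m -> trunc N (ins p x) = ins (trunc N p) x.
Proof.
move=> tp xN Nm; have [b [r [_ ti _ _]]] := insP (tab_trunc N tp) xN.
apply: functional_extensionality => a; case: (leqP a N) => h.
  rewrite trunc_le //; apply: ins_local => c hc; rewrite trunc_le //; lia.
apply: functional_extensionality => i; rewrite /trunc leqNgt h /=.
by case e: (ins _ _ _ _) => //; have := ti.1 _ _ e; lia.
Qed.

Lemma trunc_ins_big m N p x : tab m p -> N < x -> trunc N (ins p x) = trunc N p.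
Proof.
move=> tp xN; apply: functional_extensionality => a; case: (leqP a N) => h.
  by rewrite !trunc_le //; apply: (ins_early tp); lia.
by apply: functional_extensionality => i; rewrite /trunc leqNgt h.
Qed.

(** The only relation that changes type is the braid with [i = N]: it becomes the idempotence of
    [N+1]. *)
Lemma he_filter N a b : hecke_equiv a b -> 
  hecke_equiv [seq c <- a | N < c] [seq c <- b | N < c].
Proof.
elim=> {a b} [a|a b h|a b _ /he_sym //|a b c _ h1 _ h2]; first exact: he_refl; last exact: he_trans h2.
case: h => [u v i|u v i|u v i j h]; rewrite !filter_cat; apply: he_ctx => /=.
- by case: (N < i); [exact: he_idem|exact: he_refl].
- case: (ltngtP N i) => hi.
  + have -> : N < i.+1 by lia.
    exact: he_step (@hs_braid [::] [::] i).
  + have -> : (N < i.+1) = false by lia.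
    exact: he_refl.
  + have -> : N < i.+1 by lia.
    exact: he_sym (he_idem _).
- by case: (N < i); case: (N < j); try exact: he_refl; exact: he_step (@hs_comm [::] [::] _ _ h).
Qed.

Definition closed (W : seq nat -> Prop) := forall a b, hecke_equiv a b -> W a -> W b.
Definition quo (W : seq nat -> Prop) x : seq nat -> Prop := fun u => W (u ++ [:: x]).

Lemma closed_quo W x : closed W -> closed (quo W x).
Proof. by move=> h a b hab; apply: h; exact: he_catr. Qed.

Lemma closed_iff W a b : closed W -> hecke_equiv a b -> (W a <-> W b).
Proof. by move=> h hab; split; apply: h => //; exact: he_sym. Qed.

(** This is why a run of equal large letters imposes the same condition as a single one. *)
Lemma quo_idem W x u : closed W -> (quo (quo W x) x u <-> quo W x u).
Proof.
move=> h; apply: closed_iff h _; rewrite -catA; apply: he_catl; exact: he_idem.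
Qed.

Definition bigw m N p := [seq c <- rword p m | N < c].
(** Membership is kept as a condition on the small part and one on the large word because undoing an
    insertion preserves this form: a letter at most [N] changes only [D], a larger one only [W]. *)
Definition CL m N (D : filling -> Prop) W p := D (trunc N p) /\ W (bigw m N p).

Lemma CL_small m N D W p x : closed W -> tab m p -> N <= m -> 0 < x <= N ->
  CL m N D W (ins p x) <-> CL m N (fun q => D (ins q x)) W p.
Proof.
move=> cW tp Nm xN; rewrite /CL (trunc_ins tp) //.
suff -> : W (bigw m N (ins p x)) <-> W (bigw m N p) by [].
apply: closed_iff => //; apply: he_sym; have := he_filter N (hecke_rword tp (x := x) ltac:(lia)).
by rewrite filter_cat /= ifF ?cats0 //; lia.
Qed.

Lemma CL_big m N D W p x : closed W -> tab m p -> N < x <= m ->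
  CL m N D W (ins p x) <-> CL m N D (quo W x) p.
Proof.
move=> cW tp xN; rewrite /CL (trunc_ins_big tp); last lia.
suff -> : W (bigw m N (ins p x)) <-> quo W x (bigw m N p) by [].
apply: closed_iff => //; apply: he_sym; have := he_filter N (hecke_rword tp (x := x) ltac:(lia)).
by rewrite filter_cat /= ifT //; lia.
Qed.

Local Open Scope ring_scope.

(** Truncation of [X/(1-X)], which turns a generating function of sets into one of multisets; only
    coefficients up to degree [D] are ever compared. *)
Definition geom (V : comNzRingType) D : {poly V} := \sum_(1 <= i < D.+1) 'X^i.

Lemma geom0 (V : comNzRingType) D : (geom V D)`_0 = 0.
Proof.
by rewrite coef_sum big_nat_cond big1 // => i /andP [/andP [i0 _] _]; rewrite coefXn; case: eqP => // ?; lia.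
Qed.

(** [geom e] is [X] times a polynomial with constant term 1, so the lowest coefficient of [f], say
    in degree [e], reappears unchanged in degree [e] of the composite. *)
Lemma comp_poly_lowinj (V : comNzRingType) (f : {poly V}) :
  (forall D d, (d <= D)%N -> (f \Po geom V D)`_d = 0) -> f = 0.
Proof.
move=> h; apply/polyP => e; rewrite coef0; elim/ltn_ind: e => e IH.
pose c := f`_e; pose h2 := drop_poly e.+1 f.
have fE : f = c%:P * 'X^e + 'X^(e.+1) * h2.
  apply/polyP => i; rewrite coefD coefCM coefXn coefXnM coef_drop_poly ltnS.
  case: (ltngtP i e) => hi; first by rewrite IH // mulr0 addr0.
    by rewrite mulr0 add0r subnK.
  by rewrite hi mulr1 addr0.
have := h e e (leqnn e); have -> : geom V e = 'X * \sum_(i < e) 'X^i.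
  rewrite mulr_sumr /geom big_add1 /= big_mkord; apply: eq_bigr => i _; by rewrite exprS.
rewrite {1}fE comp_polyD !comp_polyM comp_polyC !comp_Xn_poly.
rewrite coefD coefCM !exprMn -(mulrA 'X^(e.+1)) !coefXnM ltnn ltnSn subnn addr0.
rewrite -horner_coef0 horner_exp; rewrite -/c; move: c {IH fE h h2} => c; case: e => [|e]; first by rewrite expr0 mulr1.
rewrite horner_sum big_ord_recl /= expr0 hornerC big1 ?addr0 ?expr1n ?mulr1 //.
by move=> i _; rewrite hornerXn /= expr0n.
Qed.

Section Stage.
Variables (V : comNzRingType) (m N : nat) (g : (nat -> nat) -> V) (G : (seq nat -> Prop) -> V).
Hypothesis Nm : (N <= m)%N.
Hypothesis Gext : forall W W', (forall u, W u <-> W' u) -> G W = G W'.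
(** The product formula for the variables already treated; [stage_poly] adjoins one more, the
    polynomial variable [X]. *)
Hypothesis base : forall D W, closed W ->
  TS m (CL m N D W) (fun p => g (comp p m)) = TS N D (fun p => g (comp p N)) * G W.

(* Generating function of the horizontal strips (with marked corners) of [al] with columns at most [c]. *)
Fixpoint nst c al : {poly V} :=
  if c is k.+1 then
    nst k al + (if hasc m al k.+1 then 'X * (nst k al + nst k (phi m k.+1 al)) else 0)
  else (g al)%:P.

(* Generating function of the sets of letters in [N+1 .. N+j]. *)
Fixpoint SS j W : {poly V} :=
  if j is i.+1 then SS i W + 'X * SS i (quo W (N + i).+1) else (G W)%:P.

Lemma SS_ext j W W' : (forall u, W u <-> W' u) -> SS j W = SS j W'.
Proof.
elim: j W W' => [|j IH] W W' h /=; first by rewrite (Gext h).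
by congr (_ + 'X * _); apply: IH => // u; exact: h.
Qed.

Local Notation U := (geom V).

Lemma UX D (A : {poly V}) d : (d < D)%N -> (U D * A)`_d.+1 = ((1 + U D) * A)`_d.
Proof.
move=> dD; have UE : U D = 'X * (1 + U D) - 'X^(D.+1).
  have -> : 1 + U D = \sum_(i < D.+1) 'X^i by rewrite /geom big_add1 /= big_mkord big_ord_recl expr0.
  rewrite mulr_sumr big_ord_recr /= -exprS addrK /geom big_add1 /= big_mkord.
  by apply: eq_bigr => i _; rewrite exprS.
by rewrite {1}UE mulrBl coefB -mulrA coefXM coefXnM ltnS dD subr0.
Qed.

Lemma SS_comp D j W : SS j.+1 W \Po U D = (SS j W \Po U D) + U D * (SS j (quo W (N + j).+1) \Po U D).
Proof. by rewrite /= comp_polyD comp_polyM comp_polyX. Qed.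

Lemma nst_comp D c al : nst c.+1 al \Po U D = (nst c al \Po U D) +
  (if hasc m al c.+1 then U D * ((nst c al \Po U D) + (nst c (phi m c.+1 al) \Po U D)) else 0).
Proof.
rewrite /= comp_polyD; congr (_ + _); case: ifP => _; last by rewrite comp_poly0.
by rewrite comp_polyM comp_polyX comp_polyD.
Qed.

Lemma NN_recr d c al : NN m g d.+1 c.+1 al = NN m g d.+1 c al +
  (if hasc m al c.+1 then NN m g d c.+1 al + NN m g d c (phi m c.+1 al) else 0).
Proof. by rewrite /= big_mkcond big_nat_recr //= -big_mkcond. Qed.

(** Kept corners may be repeated, so the series of multistrips satisfies [N' = N + X (N' + M)],
    where [N'] allows one more column than [N] and [M] is the series after removing a corner there.
    Hence [N' = N + X/(1-X) (N + M)], which is the recursion of [nst] after substitution. *)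
Lemma NN_nst D c al d : (d <= D)%N -> NN m g d c al = (nst c al \Po U D)`_d.
Proof.
elim: c al d => [|c IH] al d dD.
  by rewrite /= comp_polyC coefC; case: d dD => //= d _; rewrite big_geq.
elim: d dD => [|d IHd] dD.
  rewrite nst_comp coefD -IH //=; case: ifP => _; last by rewrite coef0 addr0.
  by rewrite coef0M geom0 mul0r addr0.
rewrite NN_recr IH // (IH (phi m c.+1 al)); last lia.
rewrite IHd; last lia.
rewrite nst_comp [in RHS]coefD; congr (_ + _); case: ifP => hc; last by rewrite coef0.
by rewrite UX // -coefD hc addrAC mulrDl mul1r.
Qed.

Lemma YY_small d D W a : closed W -> (a <= N)%N ->
  YY g m d a (CL m N D W) = YY g N d a D * G W.
Proof.
move=> cW; elim: d a D => [|d IH] a D aN /=; first exact: base.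
rewrite big_distrl /=; apply: eq_big_nat => x hx; rewrite -IH; last by lia.
apply: YY_eq; first by lia.
by move=> p tp; apply: CL_small => //; lia.
Qed.

Lemma YY_big d j D W : closed W -> (N + j < m)%N ->
  YY g m d.+1 (N + j).+1 (CL m N D W) =
  YY g m d.+1 (N + j) (CL m N D W) + YY g m d (N + j).+1 (CL m N D (quo W (N + j).+1)).
Proof.
move=> cW jm; rewrite /= big_nat_recr //=; congr (_ + _).
apply: YY_eq => // p tp; apply: CL_big => //; lia.
Qed.

Variable D : filling -> Prop.

(** By [quo_idem] all positive powers of a large letter give the same quotient of [W], so each such
    letter contributes either nothing or [X/(1-X)]; the small letters form the separate factor. *)
Lemma YY_SS E d j W : closed W -> (N + j <= m)%N -> (d <= E)%N ->
  YY g m d (N + j) (CL m N D W) = 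
  ((\poly_(i < E.+1) YY g N i N D) * (SS j W \Po U E))`_d.
Proof.
elim: j d W => [|j IH] d W cW jm dE.
  by rewrite addn0 YY_small // /= comp_polyC coefMC coef_poly ltnS dE.
rewrite addnS; set K := \poly_(_ < _) _; move: cW; elim: d dE W => [|d IHd] dE W cW.
  have -> : YY g m 0 (N + j).+1 (CL m N D W) = YY g m 0 (N + j) (CL m N D W) by [].
  rewrite IH //; last by lia.
  rewrite SS_comp mulrDr coefD mulrCA.
  by rewrite [X in _ = _ + X]coef0M geom0 mul0r addr0.
have cq := @closed_quo W (N + j).+1 cW.
rewrite YY_big //; last by lia.
rewrite IH //; last by lia.
rewrite IHd //; last by lia.
have e2 : SS j (quo (quo W (N + j).+1) (N + j).+1) = SS j (quo W (N + j).+1).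
  by apply: SS_ext => u; exact: quo_idem.
rewrite (SS_comp E j W) mulrDr [in RHS]coefD; congr (_ + _).
rewrite [in RHS]mulrCA UX // (SS_comp E j (quo W _)) e2.
set A1 := _ \Po _; have -> : K * (A1 + U E * A1) = (1 + U E) * (K * A1); last by [].
by rewrite -[X in X + _]mul1r -mulrDl mulrCA.
Qed.

Lemma TS_comp M (C : filling -> Prop) (f : filling -> {poly V}) q d :
  (TS M C f \Po q)`_d = TS M C (fun p => (f p \Po q)`_d).
Proof. by rewrite /TS raddf_sum /= coef_sum. Qed.

Lemma nst_stable c c' al : (c <= c')%N -> (forall v, al v <= c)%N -> nst c' al = nst c al.
Proof.
move=> /subnKC <- h; elim: (c' - c)%N => [|k IH]; first by rewrite addn0.
rewrite addnS /= IH; have -> : hasc m al (c + k).+1 = false; last by rewrite addr0.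
by apply/hasPn => v _; apply/eqP => e; have := h v; rewrite e; lia.
Qed.

Lemma comp_leq_letter p a v : (comp p a v <= a)%N.
Proof. clear -p a v.  by elim: a v => //= a IH v; rewrite /grow; have := IH v; case: (_ && _) => /=; lia. Qed.

(** After the substitution both sides count weakly increasing insertion words, where the
    factorization is visible; [comp_poly_lowinj] then removes the substitution. *)
Lemma stage_poly W : closed W ->
  TS m (CL m N D W) (fun p => nst m (comp p m)) =
  TS N D (fun p => nst m (comp p N)) * SS (m - N) W.
Proof.
move=> cW; apply/eqP; rewrite -subr_eq0; apply/eqP; apply: comp_poly_lowinj => E d dE.
rewrite comp_polyB coefB comp_polyM; apply/eqP; rewrite subr_eq0; apply/eqP.
rewrite TS_comp; have := YY_SS (j := m - N) cW _ dE; rewrite subnKC // => /(_ (leqnn _)).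
rewrite (@YY_NN V m g m d _ (leqnn m)).
have -> : TS m (CL m N D W) (fun p => NN m g d m (comp p m)) = TS m (CL m N D W) (fun p => (nst m (comp p m) \Po U E)`_d).
  by apply: TS_eq => // p _ _; exact: NN_nst.
move=> ->; rewrite !coefM; apply: eq_bigr => i _; congr (_ * _).
have iE : (i <= E)%N by have := ltn_ord i; lia.
rewrite coef_poly ltnS iE (@YY_NN V m g N i _ Nm) TS_comp; apply: TS_eq => // p _ _.
rewrite (NN_nst _ _ iE) (@nst_stable N m) // => v; exact: comp_leq_letter.
Qed.
End Stage.

Local Close Scope ring_scope.

(** A new letter in the first column raises the last zero entry, which is its own; hence letters
    above [k] never make an entry up to [k] nonzero. *)
Lemma comp_low p k a : (forall a, addable (shape p a) (p a.+1)) -> k <= a ->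
  ((forall v, 0 < v <= k -> comp p a v = 0) <-> (forall v, 0 < v <= k -> comp p k v = 0)).
Proof.
move=> h /subnKC <-; elim: (a - k) => [|d IH]; first by rewrite addn0.
rewrite addnS -IH; split=> H v hv.
  by have := H v hv; rewrite /= /grow; lia.
rewrite /= /grow (H v hv); case: topbP => [[_ _ /(_ (k + d).+1)]|_]; last by rewrite andbF.
by rewrite comp_out; [lia | rewrite ltnn andbF].
Qed.

Local Open Scope ring_scope.

Lemma TS_single (V : nmodType) m (C : filling -> Prop) (f : filling -> V) p0 :
  tab m p0 -> (forall p, tab m p -> p <> p0 -> f p = 0) ->
  TS m C f = if dec (C p0) then f p0 else 0.
Proof.
move=> t0 h; have ec : dec (tab m (toF (ofF m p0)) /\ C (toF (ofF m p0))) = dec (C p0).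
  by rewrite ofFK //; apply: dec_iff; split=> [[]|].
case: (boolP (dec (C p0))) => [c0|/decP nc].
  rewrite /TS (bigD1 (ofF m p0)) ?ec //= ofFK // big1 ?addr0 // => t /andP [/decP [tt _] ne].
  by apply: h => // e; move: ne; rewrite -e toFK eqxx.
rewrite /TS big1 // => t /decP [tt ct]; apply: h => // e; by case: nc; rewrite -e.
Qed.

Lemma TS_if (V : nmodType) m (C : filling -> Prop) (Z : filling -> Prop) (f : filling -> V) :
  TS m C (fun p => if dec (Z p) then f p else 0) = TS m (fun p => C p /\ Z p) f.
Proof.
rewrite /TS -big_mkcondr /=; apply: eq_bigl => t.
apply/andP/decP => [[/decP [? ?] /decP ?]|[? [? ?]]]; first by split.
by split; apply/decP.
Qed.

Section Iterate.
Variables (V : comNzRingType) (n m N : nat) (x : nat -> V).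
Hypotheses (nN : (n < N)%N) (Nm : (N <= m)%N).

(* [j] variables remain; the letters of the reverse tableaux are then bigger than [n - j]. *)
Fixpoint Fr j (al : nat -> nat) : V :=
  if j is i.+1 then
    if dec (forall v, (0 < v <= n - j)%N -> al v = 0%N) then (nst m (Fr i) m al).[x (n - j)%N] else 0
  else if dec (forall v, (0 < v <= m)%N -> al v = 0%N) then 1 else 0.

Fixpoint GG j (W : seq nat -> Prop) : V :=
  if j is i.+1 then (SS N (GG i) (m - N) W).[x (n - j)%N] else if dec (W [::]) then 1 else 0.

Lemma GG_ext j W W' : (forall u, W u <-> W' u) -> GG j W = GG j W'.
Proof.
elim: j W W' => [|j IH] W W' h /=; first by rewrite (dec_iff (h [::])).
by rewrite (@SS_ext V N (GG j) IH (m - N)%N W _ h).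
Qed.

Definition fempty : filling := fun _ _ => false.
Lemma tab_empty M : tab M fempty. Proof. by split. Qed.

Lemma comp_empty a v : comp fempty a v = 0%N.
Proof.
elim: a v => // a IH v; rewrite /= /grow !IH; case: extbP => [[r [_ //]]|//].
Qed.

Lemma comp_zero M p : tab M p -> (forall v, (0 < v <= M)%N -> comp p M v = 0%N) -> p = fempty.
Proof.
move=> tp h; have [bal _] := comp_balanced M tp.2.
have sh r : shape p M r = 0%N.
  case: (ltnP r M) => rM; last by rewrite (shape_out tp.2).
  by have [v /topbP [v1 <- _]] := bal_top bal rM; exact: h.
have mono a b r : (a <= b)%N -> (shape p a r <= shape p b r)%N.
  move=> /subnKC <-; elim: (b - a)%N => [|d IH]; first by rewrite addn0.
  by rewrite addnS (leq_trans IH) // -[shape p (a + d).+1 r]/(shape p (a + d) r + p _ r)%N leq_addr.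
apply: functional_extensionality => a; apply: functional_extensionality => r.
case e: (p a r) => //; have := tp.1 _ _ e; case: a e => // a e aM.
have := mono a.+1 M r ltac:(lia); rewrite sh -[shape p a.+1 r]/(shape p a r + p a.+1 r)%N e; lia.
Qed.

(** Induction on the number of variables with [stage_poly] as its step. Without variables both
    weights select the empty tableau, and only the conditions [D] and [W] at the empty tableau and
    word remain. *)
Lemma iterate j D W : (j <= n)%N -> closed W ->
  TS m (CL m N D W) (fun p => Fr j (comp p m)) = TS N D (fun p => Fr j (comp p N)) * GG j W.
Proof.
elim: j D W => [|j IH] D W jn cW.
  rewrite (TS_single (p0 := fempty) _ (tab_empty m)) => [|p tp ne] /=; last first.
    by case: decP => // /(comp_zero tp).
  rewrite (TS_single (p0 := fempty) _ (tab_empty N)) => [|p tp ne] /=; last first.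
    case: decP => // h; case: ne; apply: (comp_zero tp) => v hv; apply: h; lia.
  have c0 M : dec (forall v, (0 < v <= m)%N -> comp fempty M v = 0%N).
    by apply/decP => v _; exact: comp_empty.
  rewrite !c0.
  have -> : dec (CL m N D W fempty) = dec (D fempty) && dec (W [::]).
    have e1 : trunc N fempty = fempty.
      by do 2!apply: functional_extensionality => ?; rewrite /trunc andbF.
    have e2 : bigw m N fempty = [::].
      have wdn R : wd (rowL fempty m) R = [::].
        by elim: R => // R IH; rewrite wdS IH cats0 /rowL; elim: (iota 1 m).
      by rewrite /bigw /rword wdn.
    by rewrite /CL e1 e2; apply/decP/andP => [[? ?]|[/decP ? /decP ?]]; [split; apply/decP | split].
  by case: (dec _); case: (dec _); rewrite ?mulr1 ?mul0r ?mulr0.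
set k := (n - j.+1)%N.
rewrite /= -/k.
rewrite (@TS_if V _ _ (fun p => forall v, (0 < v <= k)%N -> comp p m v = 0%N)
               (fun p => (nst m (Fr j) m (comp p m)).[x k])).
rewrite (@TS_if V _ _ (fun p => forall v, (0 < v <= k)%N -> comp p N v = 0%N)
               (fun p => (nst m (Fr j) m (comp p N)).[x k])).
(* By [comp_low] the vanishing condition concerns the truncation at [N] only, so it is moved into
   the arbitrary predicate [D]. *)
pose D' q := D q /\ forall v, (0 < v <= k)%N -> comp q N v = 0%N.
have hor M C (f : filling -> {poly V}) y : TS M C (fun p => (f p).[y]) = (TS M C f).[y].
  by rewrite /TS horner_sum.
rewrite !hor -hornerM; congr (_.[_]).
rewrite -[RHS](@stage_poly V m N (Fr j) (GG j) Nm (@GG_ext j) _ D' W cW) => [|D0 W0 cW0]; last first.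
  by apply: IH => //; lia.
apply: TS_eq => // p tp; rewrite /CL /D'.
have tN := tab_trunc N tp.
have -> : (forall v, (0 < v <= k)%N -> comp p m v = 0%N) <->
          (forall v, (0 < v <= k)%N -> comp (trunc N p) N v = 0%N); last by tauto.
rewrite (@comp_low p k m tp.2) ?(@comp_low _ k N tN.2) //; try lia.
by rewrite (@comp_local p (trunc N p)) // => b hb; rewrite trunc_le //; lia.
Qed.

End Iterate.

Local Close Scope ring_scope.

(** * Keys as greedy matchings on bit sequences *)

(* Greedy picking along a scan: [T] offers, [S] demands, [k] demands pending; [w] tells whether an
   offer can serve the demand occurring at the same place. *)
Fixpoint ob (w : bool) (T S : bitseq) (k : nat) : bitseq :=
  match T, S with
  | t :: T', s :: S' => let b := t && (0 < k + (w && s)) in b :: ob w T' S' (k + s - b)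
  | _, _ => [::]
  end.

(* [S] together with the first element of [U] outside of [S]. *)
Fixpoint exb (S U : bitseq) : bitseq :=
  match S, U with
  | s :: S', u :: U' => if u && ~~ s then true :: S' else s :: exb S' U'
  | _, _ => S
  end.

Definition sub (S U : bitseq) := all2 implb S U.

Lemma size_ob w T S k : size T = size S -> size (ob w T S k) = size S.
Proof. by elim: T S k => [|t T IH] [|s S] k //= [e]; rewrite IH. Qed.

Lemma ob_sub w T S k : size T = size S -> sub (ob w T S k) T.
Proof. by elim: T S k => [|t T IH] [|s S] k //= [e]; apply/andP; split; [case: t; rewrite ?implybT | exact: IH]. Qed.

Lemma ob_mono w T S U k k' : size T = size S -> sub S U -> k <= k' -> sub (ob w T S k) (ob w T U k').
Proof.
elim: T S U k k' => [|t T IH] [|s S] [|u U] k k' //= [e] /andP [su sU] kk.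
apply/andP; split; first by case: (w); case: t; case: s u su => [] [] //=; lia.
by apply: IH => //; case: (w); case: t; case: s u su => [] [] //=; lia.
Qed.

(** The additional demand is served by the first offer left over by [S]; at that place the larger
    supply of demands [U], [k'] also takes the offer, and afterwards the two scans coincide. *)
Lemma ob_exb1 w T S U k k' : size T = size S -> size S = size U -> sub S U -> k < k' ->
  ob w T S k.+1 = exb (ob w T S k) (ob w T U k').
Proof.
elim: T S U k k' => [|t T IH] [|s S] [|u U] k k' //= [e] [e'] /andP [su sU] kk.
have k0 : 0 < k + 0 \/ k = 0 by lia.
case: t => /=; last first.
  by congr (_ :: _); rewrite !subn0 addSn; apply: IH => //; case: s u su => [] [] //=; lia.
have -> : 0 < k.+1 + (w && s) by lia.
have -> : 0 < k' + (w && u) by lia.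
case: (ltnP 0 (k + (w && s))) => h /=.
  have -> : k.+1 + s - 1 = (k + s - 1).+1 by lia.
  by congr (_ :: _); apply: IH => //; case: s u su h => [] [] //=; lia.
by congr (_ :: ob _ _ _ _); lia.
Qed.

(** From the place where [exb] changes [S] there is one more demand; either it is served on the spot
    or it stays pending, which is the situation of [ob_exb1]. *)
Lemma ob_exb w T S U k : size T = size S -> size S = size U -> sub S U ->
  ob w T (exb S U) k = exb (ob w T S k) (ob w T U k).
Proof.
elim: T S U k => [|t T IH] [|s S] [|u U] k //= [e] [e'] /andP [su sU].
case: s u su => [] [] //= _; try (by rewrite IH //=; case: (_ && _)).
case: t => /=; last first.
  rewrite !addn1 !addn0 !subn0 (@ob_exb1 w T S U k k.+1) //.
have X := ob_exb1 w e e' sU; clear IH; case: w X => X; case: k => [|k] //=; rewrite ?addn0 ?addn1 ?subn1 ?subn0 //=.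
- by rewrite (X k k.+1).
- by rewrite (X 0 1).
- by rewrite (X k k.+1).
Qed.

Lemma ob_ext w T S k : size T = size S -> ob w T S k.+1 = exb (ob w T S k) T.
Proof.
elim: T S k => [|t T IH] [|s S] k //= [e]; case: t => /=; last first.
  by rewrite !subn0 addSn IH.
case: (ltnP 0 (k + (w && s))) => h /=.
  by rewrite -IH //; congr (_ :: ob _ _ _ _); case: s h => //=; lia.
by congr (_ :: ob _ _ _ _); lia.
Qed.

Definition Kb w (cs : seq bitseq) := 
  (fix f cs := match cs with [::] => [::] | [:: c] => c | c :: cs' => ob w c (f cs') 0 end) cs.

Section Greedy.
Variables (w : bool) (aft : nat -> nat -> bool) (pk : seq nat -> nat -> option nat).

Fixpoint grec (A ss : seq nat) : seq nat :=
  match ss with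
  | [::] => [::]
  | s :: ss' => match pk A s with Some t => t :: grec (rem t A) ss' | None => grec A ss' end
  end.

(** [aft s t] means that the offer [t] can serve the demand [s]. Along [l] a demand is served only
    by offers that come later, or at its own place when [w] holds. *)
Definition scan l := pairwise (fun v t => aft v t && ~~ aft t v) l && uniq l.

Hypothesis aft_diag : forall v, aft v v = w.
Hypothesis pk_spec : forall l A s, scan l -> uniq A -> {subset A <= l} ->
  pk A s = ohead [seq t <- l | (t \in A) && aft s t].

Lemma grec_none l A ss : scan l -> uniq A -> {subset A <= l} -> 
  (forall s t, s \in ss -> t \in A -> ~~ aft s t) -> grec A ss = [::].
Proof.
move=> sc uA AL; elim: ss => //= s ss IH h; rewrite (pk_spec _ sc uA AL).
rewrite (eq_in_filter (a2 := pred0)) ?filter_pred0 /=.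
  by apply: IH => s' t hs ht; apply: h => //; rewrite inE hs orbT.
by move=> t _; case tA: (t \in A) => //=; apply/negbTE/h => //; rewrite inE eqxx.
Qed.

(** An offer that no remaining demand can use may be discarded, which is what happens when the scan
    moves past it. *)
Lemma grec_dead l A ss v : scan l -> uniq A -> {subset A <= l} -> v \in A ->
  (forall s, s \in ss -> ~~ aft s v) -> grec A ss = grec (rem v A) ss.
Proof.
move=> sc; elim: ss A => //= s ss IH A uA AL vA h.
have us : uniq (rem v A) by exact: rem_uniq.
have AL' : {subset rem v A <= l} by move=> t /mem_rem /AL.
rewrite !(pk_spec _ sc) //.
have -> : [seq t <- l | (t \in rem v A) && aft s t] = [seq t <- l | (t \in A) && aft s t].
  apply: eq_in_filter => t _; rewrite mem_rem_uniq // inE; case: (t =P v) => [->|] //=.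
  by rewrite (negbTE (h s _)) ?andbF // inE eqxx.
case e: (ohead _) => [t|]; last by apply: IH => // s' hs; apply: h; rewrite inE hs orbT.
have : t \in [seq t <- l | (t \in A) && aft s t].
  by case: [seq _ <- _ | _] e => //= t' r [->]; rewrite inE eqxx.
rewrite mem_filter => /andP [/andP [tA st] tl].
have tv : v != t by apply: contraTneq st => <-; apply: h; rewrite inE eqxx.
congr (_ :: _); rewrite (IH (rem t A)) ?rem_uniq //.
- congr grec; rewrite !rem_filter ?rem_uniq ?filter_uniq // -!filter_predI.
  by apply: eq_filter => y /=; rewrite andbC.
- by move=> y /mem_rem /AL.
- by rewrite mem_rem_uniq // inE tv.
- by move=> s' hs; apply: h; rewrite inE hs orbT.
Qed.

(** All pending demands [cs] can use every later offer, so they are interchangeable and only their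
    number matters; this reduces the greedy choice to one pass over bits. *)
Lemma grec_ob l A cs (S : pred nat) : scan l -> uniq A -> {subset A <= l} ->
  (forall s t, s \in cs -> t \in l -> aft s t) ->
  grec A (cs ++ filter S l) = mask (ob w [seq t \in A | t <- l] (map S l) (size cs)) l.
Proof.
elim: l A cs => [|v l IH] A cs sc uA AL hc.
  rewrite mask0s cats0; have -> : A = [::] by case: A AL {uA} => // a A /(_ a); rewrite inE eqxx => /(_ isT).
  by apply: (@grec_none [::]).
have [sc' vl hv] : [/\ scan l, v \notin l & forall t, t \in l -> aft v t && ~~ aft t v].
  move: sc; rewrite /scan /= => /andP [/andP [/allP h1 h2] /andP [h3 h4]]; split=> //; exact/andP.
have AL' : {subset rem v A <= l}.
  by move=> t; rewrite mem_rem_uniq // inE => /andP [tv /AL]; rewrite inE (negbTE tv).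
have uA' : uniq (rem v A) by exact: rem_uniq.
pose cs1 := if S v then rcons cs v else cs.
have -> : cs ++ filter S (v :: l) = cs1 ++ filter S l by rewrite /cs1 /=; case: (S v); rewrite ?cat_rcons.
have hc1 s t : s \in cs1 -> t \in l -> aft s t.
  rewrite /cs1; case: (S v); rewrite ?mem_rcons ?inE => hs tl; last by apply: hc; rewrite ?inE ?tl ?orbT.
  case/orP: hs => [/eqP ->|hs]; first by have /andP [] := hv t tl.
  by apply: hc; rewrite ?inE ?tl ?orbT.
have sz : size cs1 = size cs + S v by rewrite /cs1; case: (S v); rewrite ?size_rcons ?addn1 ?addn0.
have memA : [seq t \in A | t <- l] = [seq t \in rem v A | t <- l].
  apply/eq_in_map => t tl; rewrite mem_rem_uniq // inE; case: (t =P v) => [e|] //=.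
  by move: vl; rewrite -e tl.
rewrite /=; case hb: ((v \in A) && (0 < size cs + (w && S v))) => /=; last first.
  rewrite subn0 -sz memA -IH //.
  case vA: (v \in A); last by rewrite rem_id ?vA.
  apply: (grec_dead sc) => // s; rewrite mem_cat mem_filter => hs.
  move: hb; rewrite vA /= => hb.
  have cs0 : cs = [::] by case: (cs) hb => //=; lia.
  case/orP: hs => [|/andP [_ sl]]; last by have /andP [] := hv s sl.
  move: hb; rewrite /cs1 cs0; case: (S v); rewrite // inE andbT /= => hb /eqP ->.
  by rewrite aft_diag; case: (w) hb.
case/andP: hb => vA hb; rewrite memA.
have step c cs2 : cs1 ++ filter S l = c :: cs2 ++ filter S l -> aft c v ->
    size cs2 = size cs + S v - 1 -> (forall s t, s \in cs2 -> t \in l -> aft s t) ->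
    grec A (cs1 ++ filter S l) = v :: mask (ob w [seq t \in rem v A | t <- l] (map S l) (size cs + S v - 1)) l.
  move=> -> cv <- h; rewrite /= (pk_spec _ sc uA AL) /= vA cv /=; congr (_ :: _); exact: IH.
have [ecs|[c [cs' ecs]]] : cs = [::] \/ exists c cs', cs = c :: cs'.
- by case: (cs) => [|c cs']; [left|right; exists c, cs'].
- have [ew sv] : w /\ S v by move: hb; rewrite ecs add0n; case: (w); case: (S v).
  by apply: (step v [::]); rewrite /cs1 ?ecs ?sv ?aft_diag.
apply: (step c (if S v then rcons cs' v else cs')).
- by rewrite /cs1 ecs; case: (S v).
- by apply: hc; rewrite ?ecs inE eqxx.
- by rewrite ecs; case: (S v); rewrite ?size_rcons /=; lia.
move=> s t hs; apply: hc1; move: hs; rewrite /cs1 ecs; case: (S v) => hs; rewrite ?rcons_cons inE hs orbT //.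
Qed.
End Greedy.

Lemma tri_grec A ss : tri_rec A ss = grec pick_lt A ss.
Proof. by elim: ss A => //= s ss IH A; case: pick_lt => [t|]; rewrite IH. Qed.

Lemma trie_grec A ss : trie_rec A ss = grec pick_ge A ss.
Proof. by elim: ss A => //= s ss IH A; case: pick_ge => [t|]; rewrite IH. Qed.

Lemma map_mem_mask (l : seq nat) b : uniq l -> size b = size l -> [seq x \in mask b l | x <- l] = b.
Proof.
elim: l b => [|v l IH] [|b bs] //= /andP [vl ul] [e].
have nv x : x \in mask bs l -> x != v by move=> /mem_mask xl; apply: contraTneq xl => ->.
congr (_ :: _).
  by case: b; rewrite ?inE ?eqxx //; apply/negP => /nv; rewrite eqxx.
rewrite -[RHS](IH bs) //; apply/eq_in_map => x xl; case: b => //; rewrite inE.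
by case: (x =P v) => // xv; move: vl; rewrite -xv xl.
Qed.

Lemma scan_perm (aft : nat -> nat -> bool) l A (P : pred nat) : uniq l -> uniq A -> {subset A <= l} ->
  perm_eq [seq t <- A | P t] [seq t <- l | (t \in A) && P t].
Proof.
move=> ul uA AL; apply: uniq_perm; rewrite ?filter_uniq // => t.
rewrite !mem_filter; case tA: (t \in A) => /=; last by rewrite andbF.
by rewrite andbT (AL _ tA) andbT.
Qed.

Lemma pick_lt_spec l A s : scan (fun v t => t < v) l -> uniq A -> {subset A <= l} ->
  pick_lt A s = ohead [seq t <- l | (t \in A) && (t < s)].
Proof.
move=> /andP [pl ul] uA AL; rewrite /pick_lt.
have pe := @scan_perm (fun v t => t < v) l A (fun t => t < s) ul uA AL.
case e: [seq t <- l | (t \in A) && (t < s)] pe => [|x F] pe.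
  by rewrite (perm_nilP pe).
have -> : \max_(t <- [seq t <- A | t < s]) t = x.
  rewrite (perm_big _ pe) /= big_cons; apply/eqP; rewrite eqn_leq leq_maxl andbT geq_max leqnn /=.
  apply/bigmax_leqP_seq => t tF _.
  have : pairwise (fun v t => (t < v) && ~~ (v < t)) (x :: F) by rewrite -e; apply: pairwise_filter.
  by rewrite /= => /andP [/allP /(_ t tF) /andP [/ltnW]].
by case: [seq _ <- A | _] (perm_size pe).
Qed.

Lemma pick_ge_spec l A s : scan (fun v t => v <= t) l -> uniq A -> {subset A <= l} ->
  pick_ge A s = ohead [seq t <- l | (t \in A) && (s <= t)].
Proof.
move=> /andP [pl ul] uA AL; rewrite /pick_ge.
have pe := @scan_perm (fun v t => t < v) l A (fun t => s <= t) ul uA AL.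
have -> : sort leq [seq t <- A | s <= t] = [seq t <- l | (t \in A) && (s <= t)].
  apply: (sorted_eq leq_trans anti_leq); [exact: (sort_sorted leq_total)| |by rewrite perm_sort].
  rewrite sorted_pairwise; last exact: leq_trans.
  by apply: pairwise_filter; apply: sub_pairwise pl => x y /andP [].
case: [seq _ <- A | _] (perm_size pe) => [|a F]; case: [seq t <- l | _] => //.
Qed.

Definition bits (l T : seq nat) := [seq x \in T | x <- l].

Lemma scan_down M : scan (fun v t => t < v) (rev (iota 0 M)).
Proof.
rewrite /scan rev_uniq iota_uniq andbT.
have : sorted gtn (rev (iota 0 M)) by rewrite rev_sorted; apply: iota_ltn_sorted.
rewrite (sorted_pairwise (rev_trans ltn_trans)); apply: sub_pairwise => x y /=.
by rewrite -leqNgt => h; rewrite h ltnW.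
Qed.

Lemma scan_up M : scan (fun v t => v <= t) (iota 0 M).
Proof.
rewrite /scan iota_uniq andbT; have := iota_ltn_sorted 0 M.
rewrite (sorted_pairwise ltn_trans); apply: sub_pairwise => x y h.
by rewrite (ltnW h) -ltnNge.
Qed.

Lemma sub_bits l A B : sub (bits l A) (bits l B) -> forall x, x \in l -> x \in A -> x \in B.
Proof.
elim: l => //= v l IH /andP [h1 h2] x; rewrite inE => /orP [/eqP ->|xl]; first exact/implyP.
exact: IH.
Qed.

Lemma tri_bits M T S : all (fun x => x < M) T -> all (fun x => x < M) S ->
  [/\ bits (rev (iota 0 M)) (tri T S) = ob false (bits (rev (iota 0 M)) T) (bits (rev (iota 0 M)) S) 0,
   uniq (tri T S) & {subset tri T S <= T}].
Proof.
move=> hT hS; set l := rev (iota 0 M).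
have ul : uniq l by rewrite rev_uniq iota_uniq.
have ml x : (x \in l) = (x < M) by rewrite mem_rev mem_iota.
have eS : sort geq (undup S) = filter (mem S) l.
  have gt : transitive geq by move=> a b c; rewrite /geq /= => h1 h2; exact: leq_trans h2 h1.
  have ga : antisymmetric geq by move=> a b; rewrite /geq /= andbC; exact: anti_leq.
  apply: (sorted_eq gt ga).
  - by apply: sort_sorted => a b; rewrite /geq /=; exact: leq_total.
  - rewrite (sorted_pairwise gt); apply: pairwise_filter; have /andP [+ _] := scan_down M.
    by apply: sub_pairwise => a b /andP [/ltnW].
  rewrite perm_sort; apply: uniq_perm; rewrite ?undup_uniq ?filter_uniq // => x.
  rewrite mem_undup mem_filter ml; apply/idP/andP => [xS|[] //].
  by split=> //; exact: (allP hS).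
have := @grec_ob false (fun v t => t < v) pick_lt (fun v => ltnn v) pick_lt_spec l (undup T) [::] (mem S)
  (scan_down M) (undup_uniq T) _ _.
rewrite cat0s -eS -tri_grec => E.
have {}E : tri_rec (undup T) (sort geq (undup S)) =  mask (ob false (bits l T) (bits l S) 0) l.
  rewrite E //; last by move=> x; rewrite mem_undup ml => /(allP hT).
  by congr (mask (ob _ _ _ _) _); apply: eq_map => x; rewrite mem_undup.
have sz : size (ob false (bits l T) (bits l S) 0) = size l by rewrite size_ob !size_map.
have e1 : bits l (tri T S) = ob false (bits l T) (bits l S) 0.
  by rewrite -[RHS](map_mem_mask ul sz); apply: eq_map => x; rewrite /tri mem_sort E.
split=> //; first by rewrite /tri sort_uniq E mask_uniq.
move=> x xt; apply: (@sub_bits l (tri T S)) => //; last by move: xt; rewrite /tri mem_sort E => /mem_mask.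
by rewrite e1; apply: ob_sub; rewrite !size_map.
Qed.

Lemma trie_bits M T S : all (fun x => x < M) T -> all (fun x => x < M) S ->
  [/\ bits (iota 0 M) (trie T S) = ob true (bits (iota 0 M) T) (bits (iota 0 M) S) 0,
   uniq (trie T S) & {subset trie T S <= T}].
Proof.
move=> hT hS; set l := iota 0 M.
have ul : uniq l by rewrite iota_uniq.
have ml x : (x \in l) = (x < M) by rewrite mem_iota.
have eS : sort leq (undup S) = filter (mem S) l.
  apply: (sorted_eq leq_trans anti_leq).
  - by apply: sort_sorted; exact: leq_total.
  - rewrite (sorted_pairwise leq_trans); apply: pairwise_filter; have /andP [+ _] := scan_up M.
    by apply: sub_pairwise => a b /andP [].
  rewrite perm_sort; apply: uniq_perm; rewrite ?undup_uniq ?filter_uniq // => x.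
  rewrite mem_undup mem_filter ml; apply/idP/andP => [xS|[] //].
  by split=> //; exact: (allP hS).
have := @grec_ob true (fun v t => v <= t) pick_ge leqnn pick_ge_spec l (undup T) [::] (mem S)
  (scan_up M) (undup_uniq T) _ _.
rewrite cat0s -eS -trie_grec => E.
have {}E : trie_rec (undup T) (sort leq (undup S)) =  mask (ob true (bits l T) (bits l S) 0) l.
  rewrite E //; last by move=> x; rewrite mem_undup ml => /(allP hT).
  by congr (mask (ob _ _ _ _) _); apply: eq_map => x; rewrite mem_undup.
have sz : size (ob true (bits l T) (bits l S) 0) = size l by rewrite size_ob !size_map.
have e1 : bits l (trie T S) = ob true (bits l T) (bits l S) 0.
  by rewrite -[RHS](map_mem_mask ul sz); apply: eq_map => x; rewrite /trie mem_sort E.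
split=> //; first by rewrite /trie sort_uniq E mask_uniq.
move=> x xt; apply: (@sub_bits l (trie T S)) => //; last by move: xt; rewrite /trie mem_sort E => /mem_mask.
by rewrite e1; apply: ob_sub; rewrite !size_map.
Qed.

Lemma iter_bits w l op (bnd : pred nat) cs : 
  (forall T S, all bnd T -> all bnd S -> 
     [/\ bits l (op T S) = ob w (bits l T) (bits l S) 0, uniq (op T S) & {subset op T S <= T}]) ->
  0 < size cs -> all (all bnd) cs -> all uniq cs ->
  [/\ bits l (iter_op op cs) = Kb w (map (bits l) cs), uniq (iter_op op cs) &
    {subset iter_op op cs <= head [::] cs}].
Proof.
move=> hop; elim: cs => [|c [|c' cs] IH] /=.
- by [].
- by rewrite !andbT => _ _ uc; split.
move=> _ /andP [hc hcs] /andP [uc ucs]; have [i1 i2 i3] := IH isT hcs ucs.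
have hK : all bnd (iter_op op (c' :: cs)).
  by apply/allP => x /i3 xc; move: hcs => /= /andP [/allP h _]; exact: h.
by have [j1 j2 j3] := hop _ _ hc hK; split=> //; rewrite j1 i1.
Qed.

Fixpoint KF w (F : nat -> bitseq) i n : bitseq :=
  if n is k.+1 then ob w (F i) (KF w F i.+1 k) 0 else F i.

Lemma Kb_KF w F i n : Kb w [seq F j | j <- iota i n.+1] = KF w F i n.
Proof. by elim: n i => [|n IH] i //; rewrite -[RHS]/(ob w (F i) (KF w F i.+1 n) 0) -IH. Qed.

Lemma eq_KF w F F' i n : (forall j, i <= j <= i + n -> F j = F' j) -> KF w F i n = KF w F' i n.
Proof.
elim: n i => [|n IH] i h /=; first by apply: h; lia.
by rewrite h ?(IH i.+1) //; [move=> j hj; apply: h; lia | lia].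
Qed.

Section Sized.
Variables (w : bool) (s : nat).
Implicit Type F : nat -> bitseq.

Lemma size_KF F i n : (forall j, size (F j) = s) -> size (KF w F i n) = s.
Proof. by move=> h; elim: n i => [|n IH] i //=; rewrite size_ob ?IH. Qed.

Lemma KF_sub F i n : (forall j, size (F j) = s) -> sub (KF w F i n.+1) (KF w F i n).
Proof.
move=> h; elim: n i => [|n IH] i; first by apply: ob_sub; rewrite !h.
apply: (@ob_mono w (F i) (KF w F i.+1 n.+1) (KF w F i.+1 n)) => //.
by rewrite size_KF ?h.
Qed.

(** If the innermost column changes so that the next one gains its first missing element, [ob_exb]
    carries the change through all outer columns, since the successive keys are nested by
    [KF_sub]. *)
Lemma KF_exb F F' X i n : (forall j, size (F j) = s) -> (forall j, j < i + n -> F j = F' j) ->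
  F' (i + n) = X -> size X = s ->
  (forall j, ob w (F j) X 0 = exb (ob w (F j) (F (i + n)) 0) (F j)) ->
  0 < n -> KF w F' i n = exb (KF w F i n) (KF w F i n.-1).
Proof.
move=> h; case: n => // n; elim: n i => [|n IH] i h1 h2 sX h3 _.
  by rewrite /= -h1 ?addn1 // -addn1 h2 h3 addn1.
have E : KF w F' i.+1 n.+1 = exb (KF w F i.+1 n.+1) (KF w F i.+1 n).
  apply: IH => //; first by move=> j hj; apply: h1; lia.
    by rewrite -h2; congr F'; lia.
  by move=> j; rewrite h3; congr (exb (ob _ _ (F _) _) _); lia.
rewrite -[KF w F' i n.+2]/(ob w (F' i) (KF w F' i.+1 n.+1) 0) -h1 ?E; last lia.
by rewrite ob_exb ?size_KF ?h //; exact: (@KF_sub F i.+1 n).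
Qed.
End Sized.

(** The prepended bit is the letter scanned first, the largest. As an offer it meets no demand and
    is lost; in the innermost column it is one more pending demand, which gives the [exb] of two
    consecutive keys. *)
Lemma KF_strict (b : nat -> bool) (F : nat -> bitseq) s i n : (forall j, size (F j) = s) ->
  KF false (fun j => b j :: F j) i n.+1 =
  false :: (if b (i + n.+1) then exb (KF false F i n.+1) (KF false F i n) else KF false F i n.+1).
Proof.
move=> h; elim: n i => [|n IH] i.
  by rewrite /= andbF addn1 subn0; case: (b i.+1); rewrite ?addn0 // -ob_ext ?h.
rewrite -[KF false _ i n.+2]/(ob false (b i :: F i) (KF false (fun j => b j :: F j) i.+1 n.+1) 0) IH.
rewrite -[ob _ _ _ _]/((b i && (0 < 0)) :: ob false (F i) _ (0 + 0 - (b i && (0 < 0)))) andbF addSnnS.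
congr (_ :: _); case: (b _) => //.
by rewrite ob_exb ?(size_KF false (s := s)) ?h //; exact: (KF_sub false (s := s)).
Qed.

Lemma exb_map (ord : rel nat) (f g : nat -> bool) l :
  (forall x, ord x x) -> pairwise (fun x y => ord y x && ~~ ord x y) l ->
  exb [seq f v | v <- l] [seq g v | v <- l] =
  [seq f v || [&& g v, ~~ f v & all (fun u => (g u && ~~ f u) ==> ord u v) l] | v <- l].
Proof.
move=> or; elim: l => //= v l IH /andP [/allP hv hl]; rewrite or implybT /=.
case e: (g v && ~~ f v) => /=.
  have /andP [gv fv] := e; rewrite gv fv (negbTE fv) /=; congr (_ :: _); first symmetry.
    by apply/allP => u /hv /andP [h _]; rewrite h implybT.
  by apply/eq_in_map => u /hv /andP [_ /negbTE ->]; rewrite /= !andbF orbF.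
by rewrite IH // andbA e /= orbF.
Qed.

Arguments comp : simpl never.

Definition colb (p : filling) i a := if a is b.+1 then extb (shape p b) (p b.+1) b.+1 i else false.

Definition dn a := rev (iota 1 a).

Lemma dnS a : dn a.+1 = a.+1 :: dn a.
Proof. by rewrite /dn -{1}[a.+1]addn1 iotaD rev_cat. Qed.

Lemma mem_dn a v : (v \in dn a) = (0 < v <= a).
Proof. by rewrite mem_rev mem_iota; lia. Qed.

Lemma pairwise_dn a : pairwise (fun x y => (y <= x) && ~~ (x <= y)) (dn a).
Proof.
have : sorted gtn (dn a) by rewrite rev_sorted; apply: iota_ltn_sorted.
rewrite (sorted_pairwise (rev_trans ltn_trans)); apply: sub_pairwise => x y /=; lia.
Qed.

(** [KF_strict] is the recursion [grow] in terms of columns: a new largest letter in a column makes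
    its key column gain the largest element of the previous key column that it lacks, and in the
    leftmost column the letter itself enters. *)
Lemma key_comp p a j : KF false (fun i => [seq colb p i v | v <- dn a]) 0 j =
  [seq j < comp p a v | v <- dn a].
Proof.
elim: a j => [|a IH] j.
  by apply/eqP; rewrite -size_eq0 (size_KF false (s := 0)).
have cn : comp p a a.+1 = 0 by rewrite comp_out //; lia.
have gr v : comp p a.+1 v = grow (comp p a) (shape p a) (p a.+1) a.+1 v by [].
have t0 : topb (comp p a) a.+1 0 a.+1 by apply/topbP; split; [lia | exact: cn | move=> u /andP []].
have IH0 := IH 0; rewrite /= in IH0.
have hd : (j < comp p a.+1 a.+1) = (j == 0) && colb p 0 a.+1.
  by rewrite gr /grow cn t0 andbT /=; case: (extb _ _ _ _); case: j {IH0}.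
rewrite dnS [in RHS]/=; case: j hd => [|j] ->.
  rewrite /= -/(colb p 0 a.+1); congr (_ :: _); rewrite IH0; apply/eq_in_map => v.
  rewrite mem_dn => hv; rewrite gr /grow; case: (comp p a v =P 0) => [e|]; last lia.
  rewrite e; case: (topbP _ _ 0 v) => [[_ _ /(_ a.+1)]|_]; last by rewrite andbF.
  by rewrite cn; lia.
rewrite (@KF_strict (fun i => colb p i a.+1) _ a) => [|i]; last by rewrite size_map size_rev size_iota.
congr (_ :: _); rewrite add0n !IH.
rewrite (@exb_map leq _ _ _ leqnn (pairwise_dn a)).
case hc: (colb p j.+1 a.+1); apply/eq_in_map => v; rewrite mem_dn => hv; rewrite gr /grow.
- case: (ltngtP (comp p a v) j.+1) => h /=; rewrite ?orbT //=.
  + by case: (_ && _); lia.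
  + by lia.
  rewrite h -/(colb p j.+1 a.+1) hc /=.
  have -> : (j.+1 < j.+1 + topb (comp p a) a.+1 j.+1 v) = topb (comp p a) a.+1 j.+1 v by lia.
  apply/allP/topbP => [H|[_ _ H]].
    split=> //; first by lia.
    move=> u hu eu; case: (ltngtP u a.+1) => hu'; [|by lia|by move: eu; rewrite hu' cn].
    have := H u; rewrite mem_dn eu ltnn leqnn /= => -> //; lia.
  move=> u; rewrite mem_dn => hu; apply/implyP => hh; apply: H; lia.
case: (ltngtP (comp p a v) j.+1) => h /=.
+ by case: (_ && _); lia.
+ by lia.
by rewrite h -/(colb p j.+1 a.+1) hc addn0 ltnn.
Qed.

(** * Reverse set-valued tableaux *)

Definition rs (T : seq (seq (seq nat))) r := size (nth [::] T r).
Definition cl (T : seq (seq (seq nat))) r c := nth [::] (nth [::] T r) c.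

Definition okcell n k (L : seq nat) := [&& 0 < size L, sorted ltn L & all (fun v => k < v <= n) L].

(* Reverse set-valued tableaux with exactly [n] (possibly empty) rows and letters in [k+1 .. n],
   where [k+1] occurs only in the columns of index less than [c0]. *)
Definition QT n k c0 (T : seq (seq (seq nat))) :=
  [/\ size T = n, forall r, rs T r.+1 <= rs T r,
      forall r c, c < rs T r -> okcell n k (cl T r c) /\ (c0 <= c -> k.+1 \notin cl T r c),
      forall r c, c.+1 < rs T r -> last 0 (cl T r c.+1) <= head 0 (cl T r c) &
      forall r c, c < rs T r.+1 -> last 0 (cl T r.+1 c) < head 0 (cl T r c)].

(** A new bottom cell of the column of index [c0] goes into this row, and the present bottom cell of
    that column lies in the row above it. [okN] and [okM] require the cell concerned to end its
    row. *)
Definition firstshort c0 (T : seq (seq (seq nat))) := find (fun R => size R <= c0) T.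

Definition addN c0 x (T : seq (seq (seq nat))) :=
  let r := firstshort c0 T in set_nth [::] T r (rcons (nth [::] T r) [:: x]).

Definition addM c0 x (T : seq (seq (seq nat))) :=
  let q := (firstshort c0 T).-1 in set_nth [::] T q (rcons (take c0 (nth [::] T q)) (x :: cl T q c0)).

Definition del c0 x (T : seq (seq (seq nat))) :=
  let q := (firstshort c0 T).-1 in
  set_nth [::] T q (if cl T q c0 == [:: x] then take c0 (nth [::] T q)
                    else rcons (take c0 (nth [::] T q)) (behead (cl T q c0))).

Definition okN c0 (T : seq (seq (seq nat))) := rs T (firstshort c0 T) == c0.
Definition okM c0 (T : seq (seq (seq nat))) :=
  (0 < firstshort c0 T) && (rs T (firstshort c0 T).-1 == c0.+1).

Lemma rs_set T q R r : rs (set_nth [::] T q R) r = if r == q then size R else rs T r.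
Proof. by rewrite /rs nth_set_nth /=; case: eqP. Qed.

Lemma cl_set T q R r c : cl (set_nth [::] T q R) r c = if r == q then nth [::] R c else cl T r c.
Proof. by rewrite /cl nth_set_nth /=; case: eqP. Qed.

Lemma okcell_head n k L : okcell n k L -> [/\ L = head 0 L :: behead L, k < head 0 L & 
  head 0 L <= last 0 L <= n].
Proof.
case/and3P; case: L => // a L _ srt /= /andP [h1 h2]; split=> //; first by lia.
apply/andP; split; last by case: (lastP L) h2 => [|s y]; rewrite ?last_rcons ?all_rcons /=; lia.
move: srt; rewrite /= (path_sortedE ltn_trans) => /andP [/allP h _].
case: (lastP L) h => [|s y] h /=; first by [].
by rewrite last_rcons ltnW //; apply: h; rewrite mem_rcons inE eqxx.
Qed.

Lemma okcell_cons n k L : okcell n k (k.+1 :: L) -> L != [::] -> okcell n k L /\ k.+1 \notin L.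
Proof.
case/and3P => _ /= srt /andP [_ h]; move: srt; rewrite (path_sortedE ltn_trans) => /andP [/allP h1 h2].
case: L h h1 h2 => // a L h h1 h2 _; split; first by rewrite /okcell h2 h.
by apply/negP => /h1; rewrite ltnn.
Qed.

Lemma okcell_min n k L : okcell n k L -> k.+1 \in L -> L = k.+1 :: behead L.
Proof.
case/and3P; case: L => // a L _ /= srt /andP [h _]; rewrite inE => /orP [/eqP <- //|aL].
move: srt; rewrite (path_sortedE ltn_trans) => /andP [/allP /(_ _ aL) + _]; lia.
Qed.

Lemma okcell_add n k L : okcell n k L -> k.+1 \notin L -> k < n -> okcell n k (k.+1 :: L).
Proof.
case/and3P => h1 h2 h3 nL kn; rewrite /okcell /= (path_sortedE ltn_trans) h2 h3 ltnSn kn !andbT /=.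
apply/allP => v vL; have := allP h3 v vL; case: (v =P k.+1) => [e|]; last by lia.
by move: nL; rewrite -e vL.
Qed.

Section Steps.
Variables (n k c0 : nat).
Hypothesis kn : k < n.

Section OneT.
Variable T : seq (seq (seq nat)).
Hypothesis QTT : QT n k c0 T.
Local Notation r0 := (firstshort c0 T).

Lemma QT_mono i j : i <= j -> rs T j <= rs T i.
Proof.
case: QTT => _ h _ _ _ /subnKC <-; elim: (j - i) => [|d IH]; first by rewrite addn0.
by rewrite addnS (leq_trans (h _)).
Qed.

Lemma short_before i : i < r0 -> c0 < rs T i.
Proof. by clear kn QTT; move=> h; have := before_find [::] h; rewrite -/(rs T i); lia. Qed.

Lemma short_at : rs T r0 <= c0.
Proof.
case: (ltnP r0 (size T)) => h; last by rewrite /rs nth_default.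
by have := @nth_find _ [::] (fun R : seq (seq nat) => size R <= c0) T; apply; rewrite has_find.
Qed.

Lemma col_bound i c : c < rs T i -> head 0 (cl T i c) + i <= n.
Proof.
case: QTT => _ h1 h2 _ h4; elim: i => [|i IH] hc; have [/okcell_head [_ _ h] _] := h2 _ _ hc.
  by rewrite addn0; case/andP: h; exact: leq_trans.
have := IH (leq_trans hc (h1 i)); have := h4 _ _ hc; move: h.
by move: (head 0 (cl T i c)) (head 0 (cl T i.+1 c)) (last 0 (cl T i.+1 c)); lia.
Qed.

Lemma corner_head i : c0 < rs T i -> k.+1 < head 0 (cl T i c0).
Proof.
case: QTT => _ _ h _ _ /h [/okcell_head [e h1 _] /(_ (leqnn _)) ni].
rewrite ltn_neqAle h1 andbT; apply: contraNneq ni => h2.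
by rewrite [cl T i c0]e -h2 mem_head.
Qed.

(** The letters of the column of index [c0] exceed [k+1] and decrease strictly downwards, so fewer
    than [n - k] cells fit there: one of the [n] rows is free for the letter [k+1]. *)
Lemma short_lt : r0 < n.
Proof.
case: (posnP r0) => [->|h]; first by lia.
have hc : c0 < rs T r0.-1 by apply: short_before; lia.
have := col_bound hc; have := corner_head hc; lia.
Qed.
End OneT.

Lemma short_eq (T : seq (seq (seq nat))) i : size T = n -> i < n -> rs T i <= c0 -> 
  (forall j, j < i -> c0 < rs T j) -> firstshort c0 T = i.
Proof.
clear kn; move=> sT ni h1 h2; rewrite /firstshort; have hs : has (fun R => size R <= c0) T.
  by apply/(has_nthP [::]); exists i; rewrite ?sT.
case: (ltngtP (find (fun R : seq (seq nat) => size R <= c0) T) i) => // lt.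
  by have := h2 _ lt; have := nth_find [::] hs; rewrite /rs; lia.
by have := before_find [::] lt; rewrite -/(rs T i) h1.
Qed.

Lemma short_eq_size (T : seq (seq (seq nat))) : size T = n ->
  (forall j, j < n -> c0 < rs T j) -> firstshort c0 T = n.
Proof.
clear kn; move=> sT h; rewrite /firstshort hasNfind ?sT //; apply/(has_nthP [::]) => -[i]; rewrite sT => /h.
by rewrite /rs; lia.
Qed.

Lemma QT_set c c' T q R : QT n k c T -> q < n ->
  (forall r, r.+1 = q -> size R <= rs T r) -> rs T q.+1 <= size R ->
  (forall i, i < size R -> okcell n k (nth [::] R i) /\ (c' <= i -> k.+1 \notin nth [::] R i)) ->
  (forall i, i.+1 < size R -> last 0 (nth [::] R i.+1) <= head 0 (nth [::] R i)) ->
  (forall r i, r.+1 = q -> i < size R -> last 0 (nth [::] R i) < head 0 (cl T r i)) ->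
  (forall i, i < rs T q.+1 -> last 0 (cl T q.+1 i) < head 0 (nth [::] R i)) ->
  (forall r i, r <> q -> i < rs T r -> c' <= i -> k.+1 \notin cl T r i) ->
  QT n k c' (set_nth [::] T q R).
Proof.
clear kn; case=> sT h1 h2 h3 h4 qn H1 H2 H3 H4 H5 H6 H7; split.
- by rewrite size_set_nth sT; lia.
- move=> r; rewrite !rs_set; case: (r =P q) => [e|ne]; case: (r.+1 =P q) => [e'|ne'] //.
  + by rewrite e.
  + exact: H1.
- move=> r i; rewrite rs_set cl_set; case: (r =P q) => [_|ne]; first exact: H3.
  by move=> hi; split; [case: (h2 _ _ hi) | exact: H7].
- by move=> r i; rewrite rs_set !cl_set; case: (r =P q) => [_|ne]; [exact: H4 | exact: h3].
- move=> r i; rewrite rs_set !cl_set; case: (r.+1 =P q) => [e|ne].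
    by rewrite ifF ?(introF eqP) //; [exact: H5 | lia].
  by case: (r =P q) => [->|_]; [exact: H6 | exact: h4].
Qed.

Lemma QT_addN T : QT n k c0 T -> okN c0 T -> QT n k c0.+1 (addN c0 k.+1 T).
Proof.
move=> qT /eqP ok; have [sT h1 h2 h3 h4] := qT; rewrite /addN; set r0 := firstshort c0 T in ok *.
have sz : size (rcons (nth [::] T r0) [:: k.+1]) = c0.+1 by rewrite size_rcons -/(rs T r0) ok.
have ncell : nth [::] (rcons (nth [::] T r0) [:: k.+1]) c0 = [:: k.+1].
  by rewrite nth_rcons -/(rs T r0) ok ltnn eqxx.
have ocell i : i < c0 -> nth [::] (rcons (nth [::] T r0) [:: k.+1]) i = cl T r0 i.
  by move=> lt; rewrite nth_rcons -/(rs T r0) ok lt.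
have bf r : r < r0 -> c0 < rs T r by exact: short_before.
apply: (QT_set qT (short_lt qT)); rewrite ?sz.
- by move=> r e; apply: bf; rewrite /r0 -e.
- by have := h1 r0; rewrite -/r0; lia.
- move=> i; rewrite ltnS leq_eqVlt => /orP [/eqP ->|lt].
    by rewrite ncell /okcell /= ltnSn kn; split=> //; lia.
  by rewrite ocell //; have [o1 o2] := h2 r0 i ltac:(lia); split=> //; lia.
- move=> i; rewrite ltnS => lt; rewrite [nth _ _ i]ocell //.
  move: (lt); rewrite leq_eqVlt => /orP [/eqP ->|lt'].
    by rewrite ncell /=; have [/okcell_head [_ + _] _] := h2 r0 i ltac:(lia).
  by rewrite ocell //; apply: h3; lia.
- move=> r i e; rewrite ltnS leq_eqVlt => /orP [/eqP ->|lt].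
    by rewrite ncell /=; apply: corner_head qT _ _; apply: bf; rewrite /r0 -e.
  by rewrite ocell // /r0 -e; apply: h4; rewrite e -/r0; lia.
- by move=> i hi; rewrite ocell; [exact: h4 | have := h1 r0; rewrite -/r0 in hi; lia].
- by move=> r i _ hi lt; have [_] := h2 _ _ hi; apply; exact: ltnW.
Qed.

Lemma row_split (T : seq (seq (seq nat))) q : rs T q = c0.+1 -> nth [::] T q = rcons (take c0 (nth [::] T q)) (cl T q c0).
Proof. by move=> e; rewrite /cl -take_nth ?take_oversize // -/(rs T q) e. Qed.

Lemma QT_addM T : QT n k c0 T -> okM c0 T -> QT n k c0.+1 (addM c0 k.+1 T).
Proof.
move=> qT /andP [r0g /eqP ok]; have [sT h1 h2 h3 h4] := qT; rewrite /addM.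
have rn := short_lt qT; have sa := short_at T.
set q := (firstshort c0 T).-1 in ok *.
have fq : firstshort c0 T = q.+1 by rewrite /q; lia.
have st : size (take c0 (nth [::] T q)) = c0 by rewrite size_takel // -/(rs T q) ok.
have sz : size (rcons (take c0 (nth [::] T q)) (k.+1 :: cl T q c0)) = c0.+1 by rewrite size_rcons st.
have [ok1 ok2] := h2 q c0 ltac:(lia); have [ce c1 c2] := okcell_head ok1.
have ncell : nth [::] (rcons (take c0 (nth [::] T q)) (k.+1 :: cl T q c0)) c0 = k.+1 :: cl T q c0.
  by rewrite nth_rcons st ltnn eqxx.
have ocell i : i < c0 -> nth [::] (rcons (take c0 (nth [::] T q)) (k.+1 :: cl T q c0)) i = cl T q i.
  by move=> lt; rewrite nth_rcons st lt nth_take.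
have lc : last 0 (k.+1 :: cl T q c0) = last 0 (cl T q c0) by rewrite ce.
apply: (QT_set qT); rewrite ?sz.
- by lia.
- by move=> r e; rewrite -ok -e.
- by have := h1 q; lia.
- move=> i; rewrite ltnS leq_eqVlt => /orP [/eqP ->|lt].
    by rewrite ncell; split; [apply: okcell_add => //; exact: ok2 | lia].
  by rewrite ocell //; have [o1 o2] := h2 q i ltac:(lia); split=> //; lia.
- move=> i; rewrite ltnS => lt; rewrite [nth _ _ i]ocell //.
  move: (lt); rewrite leq_eqVlt => /orP [/eqP e|lt'].
    by rewrite e ncell lc -e; apply: h3; lia.
  by rewrite ocell //; apply: h3; lia.
- move=> r i e; rewrite ltnS leq_eqVlt => /orP [/eqP ->|lt].
    by rewrite ncell lc -e; apply: h4; rewrite e; lia.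
  by rewrite ocell // -e; apply: h4; rewrite e; lia.
- by move=> i hi; rewrite ocell; [exact: h4 | rewrite fq in sa; lia].
- by move=> r i _ hi lt; have [_] := h2 _ _ hi; apply; exact: ltnW.
Qed.

Lemma del_addN T : QT n k c0 T -> okN c0 T -> del c0 k.+1 (addN c0 k.+1 T) = T.
Proof.
move=> qT /eqP ok; have [sT h1 _ _ _] := qT; have rn := short_lt qT; rewrite /del /addN.
set r0 := firstshort c0 T in ok rn *; set R := rcons _ _; set T2 := set_nth [::] T _ R.
have sR : size R = c0.+1 by rewrite size_rcons -/(rs T r0) ok.
have s2 : size T2 = n by rewrite size_set_nth sT; lia.
have bf r : r <= r0 -> c0 < rs T2 r.
  by rewrite rs_set leq_eqVlt; case: (r =P r0) => [_ _|_ /= /short_before]; rewrite ?sR.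
have -> : (firstshort c0 T2).-1 = r0.
  case: (ltnP r0.+1 n) => h; last first.
    by have -> : firstshort c0 T2 = n; [apply: short_eq_size => // j hj; apply: bf; lia | lia].
  have -> // : firstshort c0 T2 = r0.+1.
  apply: short_eq => //; rewrite rs_set ifF; [|by lia].
  by have := h1 r0; lia.
have -> : cl T2 r0 c0 = [:: k.+1] by rewrite cl_set eqxx nth_rcons -/(rs T r0) ok ltnn eqxx.
have -> : nth [::] T2 r0 = R by rewrite nth_set_nth /= eqxx.
rewrite eqxx /R -cats1 take_size_cat; last exact: ok.
apply: (@eq_from_nth _ [::]) => [|i _]; first by rewrite size_set_nth s2 sT; lia.
by rewrite nth_set_nth /=; case: (i =P r0) => [-> //|ne]; rewrite nth_set_nth /=; case: (i =P r0).
Qed.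

Lemma del_addM T : QT n k c0 T -> okM c0 T -> del c0 k.+1 (addM c0 k.+1 T) = T.
Proof.
move=> qT /andP [r0g /eqP ok]; have [sT h1 h2 _ _] := qT; have rn := short_lt qT; have sa := short_at T.
rewrite /del /addM; set q := (firstshort c0 T).-1 in ok *; set R := rcons _ (_ :: _); set T2 := set_nth [::] T _ R.
have fq : firstshort c0 T = q.+1 by rewrite /q; lia.
have s2 : size T2 = n by rewrite size_set_nth sT; lia.
have st : size (take c0 (nth [::] T q)) = c0 by rewrite size_takel // -/(rs T q) ok.
have sR : size R = c0.+1 by rewrite size_rcons st.
have [ok1 _] := h2 q c0 ltac:(lia); have [ce _ _] := okcell_head ok1.
have -> : (firstshort c0 T2).-1 = q.
  have -> // : firstshort c0 T2 = q.+1; apply: short_eq => //.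
  - by rewrite -fq.
  - by rewrite rs_set ifF -?fq //; lia.
  - move=> j hj; rewrite rs_set; case: (j =P q) => [_|ne]; first by rewrite sR.
    by apply: short_before; lia.
have -> : cl T2 q c0 = k.+1 :: cl T q c0 by rewrite cl_set eqxx nth_rcons st ltnn eqxx.
have -> : nth [::] T2 q = R by rewrite nth_set_nth /= eqxx.
rewrite ifF; last by rewrite ce !eqseq_cons andbF.
have -> : take c0 R = take c0 (nth [::] T q) by rewrite /R -cats1 take_size_cat.
rewrite /= -row_split //.
apply: (@eq_from_nth _ [::]) => [|i _]; first by rewrite size_set_nth s2 sT; lia.
by rewrite nth_set_nth /=; case: (i =P q) => [-> //|ne]; rewrite nth_set_nth /=; case: (i =P q).
Qed.

End Steps.

Lemma short_last n c0 T r : size T = n -> r < n -> rs T r.+1 <= c0 ->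
  (forall j, j <= r -> c0 < rs T j) -> 0 < firstshort c0 T /\ (firstshort c0 T).-1 = r.
Proof.
move=> sT rn h1 h2; case: (ltnP r.+1 n) => h.
  by have -> : firstshort c0 T = r.+1 by apply: (short_eq sT).
have -> : firstshort c0 T = n by apply: (short_eq_size sT) => j hj; apply: h2; lia.
by lia.
Qed.

(** Nothing lies below a cell containing the smallest letter [k+1], and a cell to its right would
    have to contain [k+1] too, which the column bound forbids. The cell is thus a corner, from which
    the letter can be erased. *)
Lemma QT_del n k c0 T r : k < n -> QT n k c0.+1 T -> c0 < rs T r -> k.+1 \in cl T r c0 ->
  QT n k c0 (del c0 k.+1 T) /\ (okN c0 (del c0 k.+1 T) /\ T = addN c0 k.+1 (del c0 k.+1 T) \/
    okM c0 (del c0 k.+1 T) /\ T = addM c0 k.+1 (del c0 k.+1 T)).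
Proof.
move=> kn qT hr kin; have [sT h1 h2 h3 h4] := qT.
have A r' : c0 < rs T r' -> k.+1 \in cl T r' c0 -> rs T r'.+1 <= c0.
  move=> hr' kin'; case: leqP => // lt; have := h4 r' c0 lt.
  have [/okcell_head [_ a1 /andP [a2 _]] _] := h2 _ _ lt.
  have [ok _] := h2 _ _ hr'; rewrite (okcell_min ok kin') /= => a3; exfalso.
  by have := leq_ltn_trans (leq_trans a1 a2) a3; rewrite ltnn.
have [ok _] := h2 _ _ hr; have cE := okcell_min ok kin.
have mono := QT_mono qT.
have rn : r < n by rewrite -sT ltnNge; apply/negP => /(nth_default [::]) e; move: hr; rewrite /rs e.
have rsr : rs T r = c0.+1.
  apply/eqP; rewrite eqn_leq hr andbT leqNgt; apply/negP => lt.
  have [ok1 /(_ (leqnn _)) /negP] := h2 _ _ lt; have [e1 a1 /andP [a2 _]] := okcell_head ok1; apply.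
  have := h3 _ _ lt; rewrite cE /= => a3; rewrite e1 inE eqn_leq a1 /=.
  by rewrite (leq_trans a2 a3).
have ar := A _ hr kin.
have [f0 fr] : 0 < firstshort c0 T /\ (firstshort c0 T).-1 = r.
  by apply: (short_last sT) => // j hj; apply: leq_trans (mono _ _ hj).
have st : size (take c0 (nth [::] T r)) = c0 by rewrite size_takel // -/(rs T r) rsr.
have H7 r' i : r' <> r -> i < rs T r' -> c0 <= i -> k.+1 \notin cl T r' i.
  move=> ne hi; rewrite leq_eqVlt => /orP [/eqP e|lt]; last by have [_] := h2 _ _ hi; exact.
  apply/negP => kin'; rewrite -e in hi kin'; have := A _ hi kin'.
  case: (ltngtP r' r) => // lt; first by have := mono _ _ lt; lia.
  by have := mono _ _ lt; lia.
have spl := row_split rsr; rewrite /del fr; case: ifP => [/eqP e1|ne].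
  set T' := set_nth _ _ _ _.
  have q' : QT n k c0 T'.
    apply: (QT_set qT) => //; rewrite ?st //.
    - by move=> r' e; apply: leq_trans (mono r' r _); lia.
    - by move=> i hi; rewrite nth_take // -/(cl T r i); have [o _] := h2 r i ltac:(lia); split=> //; lia.
    - by move=> i hi; rewrite !nth_take; [apply: h3; lia|lia|lia].
    - by move=> r' i e hi; rewrite nth_take // -/(cl T r i) -e; apply: h4; rewrite e; lia.
    - by move=> i hi; rewrite nth_take; [exact: h4 | lia].
  have r' : rs T' r = c0 by rewrite rs_set eqxx.
  have f' : firstshort c0 T' = r.
    case: (q') => s' _ _ _ _; apply: (short_eq s'); rewrite ?r' // => j hj.
    by rewrite rs_set ifF ?(leq_trans hr (mono _ _ (ltnW hj))) //; lia.
  split=> //; left; split; first by rewrite /okN f' r'.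
  apply: (@eq_from_nth _ [::]) => [|i _]; first by rewrite size_set_nth f'; case: q' => -> _ _ _ _; lia.
  rewrite nth_set_nth /= f'; case: (i =P r) => [->|ne]; last by rewrite nth_set_nth /=; case: (i =P r).
  by rewrite nth_set_nth /= eqxx [LHS]spl e1.
set L := behead _; set T' := set_nth _ _ _ _.
have Ln : L != [::] by apply: contraFneq ne => e; rewrite cE -/L e eqxx.
have [okL kL] : okcell n k L /\ k.+1 \notin L by apply: okcell_cons Ln; rewrite -cE.
have lL : last 0 L = last 0 (cl T r c0) by rewrite cE -/L; case: (L) Ln.
have sz : size (rcons (take c0 (nth [::] T r)) L) = c0.+1 by rewrite size_rcons st.
have ncell : nth [::] (rcons (take c0 (nth [::] T r)) L) c0 = L by rewrite nth_rcons st ltnn eqxx.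
have ocell i : i < c0 -> nth [::] (rcons (take c0 (nth [::] T r)) L) i = cl T r i.
  by move=> lt; rewrite nth_rcons st lt nth_take.
have q' : QT n k c0 T'.
  apply: (QT_set qT) => //; rewrite ?sz //.
  - by move=> r' e; apply: leq_trans (mono r' r _); lia.
  - by lia.
  - move=> i; rewrite ltnS leq_eqVlt => /orP [/eqP ->|lt]; first by rewrite ncell.
    by rewrite ocell //; have [o _] := h2 r i ltac:(lia); split=> //; lia.
  - move=> i; rewrite ltnS => lt; rewrite [nth _ _ i]ocell //.
    move: (lt); rewrite leq_eqVlt => /orP [/eqP e|lt']; last by rewrite ocell //; apply: h3; lia.
    by rewrite e ncell lL -e; apply: h3; lia.
  - move=> r' i e; rewrite ltnS leq_eqVlt => /orP [/eqP ->|lt].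
      by rewrite ncell lL -e; apply: h4; rewrite e; lia.
    by rewrite ocell // -e; apply: h4; rewrite e; lia.
  - by move=> i hi; rewrite ocell; [exact: h4 | lia].
have r' : rs T' r = c0.+1 by rewrite rs_set eqxx.
have [f1 f2] : 0 < firstshort c0 T' /\ (firstshort c0 T').-1 = r.
  case: (q') => s' _ _ _ _; apply: (short_last s') => //.
    by rewrite rs_set ifF //; lia.
  move=> j hj; rewrite rs_set; case: ifP => _; first by rewrite sz.
  by apply: leq_trans (mono _ _ hj).
split=> //; right; split; first by rewrite /okM f1 f2 r' eqxx.
apply: (@eq_from_nth _ [::]) => [|i _]; first by rewrite size_set_nth f2; case: q' => -> _ _ _ _; lia.
rewrite nth_set_nth /= f2; case: (i =P r) => [->|ni]; last by rewrite nth_set_nth /=; case: (i =P r).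
rewrite /cl nth_set_nth /= eqxx ncell [LHS]spl cE -/L -cats1 -[in RHS]cats1 -[rcons _ L]cats1.
by rewrite take_size_cat.
Qed.

Lemma count_off (P Q : pred nat) (l : seq nat) (u : nat) : uniq l -> u \in l -> (forall v, v != u -> P v = Q v) ->
  count P l + Q u = count Q l + P u.
Proof.
elim: l => //= v l IH /andP [vl ul]; rewrite inE => /orP [/eqP eu|ur] h.
  suff -> : count P l = count Q l by rewrite eu addnAC [RHS]addnAC [P v + _]addnC.
  by apply: eq_in_count => x xl; apply: h; apply: contraNneq vl => e; rewrite -eu -e.
have := IH ul ur h; rewrite (h v); first by rewrite -!addnA => ->.
by apply: contraNneq vl => e; move: ur; rewrite e.
Qed.

Lemma count_lt (T : eqType) (P Q : pred T) l u : u \in l -> (forall v, P v -> Q v) -> Q u -> ~~ P u ->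
  count P l < count Q l.
Proof.
move=> + h qu /negbTE pu; elim: l => //= v l IH; have s : count P l <= count Q l by apply: sub_count.
rewrite inE => /orP [/eqP <-|/IH lt]; first by rewrite qu pu; lia.
by case e: (P v); rewrite ?(h _ e); lia.
Qed.

(** * The dominance order on keys, in terms of weights *)

Definition lk k n := iota k.+1 (n - k).

Lemma mem_lk k n v : (v \in lk k n) = (k < v <= n).
Proof. by rewrite mem_iota; lia. Qed.

Lemma lkS k n : k < n -> lk k n = k.+1 :: lk k.+1 n.
Proof. by move=> h; rewrite /lk -subnSK. Qed.

(** Two columns of equal height compare entrywise exactly when, for every threshold [t], the numbers
    of their elements at least [t] compare; this avoids sorting the columns. *)
Definition cge k m (f : nat -> nat) c t := count (fun v => (t <= v) && (c <= f v)) (lk k m).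
Definition clt k m (f : nat -> nat) c t := count (fun v => (v < t) && (c <= f v)) (lk k m).

(* Dominance of the keys with column [c] equal to [{v | c <= g v}] and [{v | c <= f v}]. *)
Definition dl k m (g f : nat -> nat) :=
  [/\ forall v, ~~ (k < v <= m) -> f v = 0, forall c t, cge k m g c t <= cge k m f c t &
      forall c, cge k m g c 0 = cge k m f c 0].

Section Dominance.
Variables k m : nat.
Local Notation cg := (cge k m).
Local Notation cl_ := (clt k m).

Lemma cge_clt f c t : cg f c 0 = cg f c t + cl_ f c t.
Proof.
rewrite /cge /clt; elim: (lk k m) => //= v l ->.
by case: (leqP t v) => h; case: (c <= f v) => /=; lia.
Qed.

Lemma clt_drop f c t u : k < u <= m -> f u = c -> u < t -> cl_ f c.+1 t < cl_ f c t.
Proof.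
move=> hu e ut; apply: (@count_lt _ _ _ _ u); rewrite ?mem_lk ?e ?ut ?leqnn ?ltnn //.
by move=> v /andP [-> /ltnW ->].
Qed.

Lemma clt_same f c t : (forall u, k < u <= m -> u < t -> f u <> c) -> cl_ f c.+1 t = cl_ f c t.
Proof.
move=> h; apply: eq_in_count => v; rewrite mem_lk => /h hv; case: ltnP => //= /hv.
by case: (ltngtP c (f v)) => // ->.
Qed.

Section Change.
Variables (f f' : nat -> nat) (u c : nat).
Hypothesis hu : k < u <= m.
Hypothesis fu : f' u = c.
Hypothesis ff : forall v, f v = f' v + (v == u).

Lemma cge_change d t : cg f d t = cg f' d t + (d == c.+1) && (t <= u).
Proof.
have := @count_off (fun v => (t <= v) && (d <= f v)) (fun v => (t <= v) && (d <= f' v)) (lk k m) u.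
rewrite iota_uniq mem_lk hu => /(_ isT isT) h; rewrite /cge; move: h.
rewrite ff eqxx fu addn1 => h; have := h _; case: (t <= u) => /= H.
  by have := H ltac:(by move=> v /negbTE nv; rewrite ff nv addn0); case: (ltngtP d c.+1) => ?; case: (leqP d c) => ?; lia.
by have := H ltac:(by move=> v /negbTE nv; rewrite ff nv addn0); rewrite andbF; lia.
Qed.
End Change.

Lemma phi_dec f c : (forall v, ~~ (k < v <= m) -> f v = 0) -> hasc m f c.+1 ->
  exists u, [/\ k < u <= m, f u = c.+1, forall v, k < v < u -> f v <> c.+1, phi m c.+1 f u = c &
    forall v, f v = phi m c.+1 f v + (v == u)].
Proof.
move=> s /hasP [v1 hv1 /eqP e1]; have ex : exists v, (0 < v <= m) && (f v == c.+1).
  by exists v1; rewrite e1 eqxx andbT; move: hv1; rewrite mem_iota; lia.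
case: (ex_minnP ex) => u /andP [u1 /eqP u2] u3.
have hu : k < u <= m by case: (boolP (k < u <= m)) => // /s; rewrite u2.
have b v : botb f m c.+1 v = (v == u).
  apply/botbP/eqP => [[h1 h2 h3]|->].
    have := h3 u u1 u2; have := u3 v; rewrite h1 h2 eqxx => /(_ isT); lia.
  by split=> // w h1 h2; apply: u3; rewrite h1 h2 eqxx.
exists u; split=> //.
- move=> v vu e; have := u3 v; rewrite e eqxx andbT; lia.
- by rewrite /phi b eqxx u2 subn1.
- by move=> v; rewrite /phi b; case: (v =P u) => [->|]; rewrite ?u2; lia.
Qed.

(** Passing to [g'] and to [phi] of [f] changes only the counts of column [c+1], by [t <= v0] and by
    [t <= u], where [u] is the first entry of [f] equal to [c+1]. Where the two changes disagree
    unfavourably, the missing unit comes from the neighbouring column: [c+2] in one direction, [c]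
    in the other, because [u] and [v0] are first entries of their value. *)
Lemma dl_step (g g' f : nat -> nat) v0 c : (forall v, ~~ (k < v <= m) -> f v = 0) ->
  k < v0 <= m -> g' v0 = c ->
  (forall v, k < v < v0 -> g' v <> c) -> (forall v, g v = g' v + (v == v0)) ->
  dl k m g f <-> hasc m f c.+1 /\ dl k m g' (phi m c.+1 f).
Proof.
move=> s hv gv mv gg; have Cg := cge_change hv gv gg.
split=> [[_ d1 d2]|[hc [_ d1 d2]]].
- have hc : hasc m f c.+1.
    have lt : cg g c.+2 0 < cg g c.+1 0.
      apply: (@count_lt _ _ _ _ v0); rewrite ?mem_lk //=; [|by rewrite gg gv eqxx; lia|by rewrite gg gv eqxx; lia].
      by move=> v /ltnW.
    apply: contraTT lt => /hasPn nh; rewrite !d2 -leqNgt; apply: eq_leq; apply: eq_in_count => v /=.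
    rewrite mem_lk => hv'; have := nh v; rewrite mem_iota => /(_ ltac:(lia)); lia.
  split=> //; have [u [u1 u2 u3 u4 u5]] := phi_dec s hc; have Cf := cge_change u1 u4 u5.
  split=> [v nv|d t|d].
  + by have := u5 v; rewrite (s v nv); lia.
  + have := d1 d t; rewrite Cg Cf; case: (d =P c.+1) => [->|_] /=; last by rewrite !addn0.
    case: (leqP t v0) => h1; case: (leqP t u) => h2 /=; try lia.
    have E1 := cge_clt f c.+1 t; have E2 := cge_clt f c.+2 t.
    have E3 := cge_clt g c.+1 t; have E4 := cge_clt g c.+2 t.
    have := d1 c.+2 t; have := d2 c.+1; have := d2 c.+2.
    have : cl_ f c.+2 t = cl_ f c.+1 t by apply: clt_same => w hw wt; apply: u3; lia.
    have : cl_ g c.+2 t < cl_ g c.+1 t by apply: (@clt_drop _ _ _ v0) => //; rewrite gg gv eqxx addn1.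
    have := Cg c.+1 t; have := Cf c.+1 t; rewrite eqxx h2 leqNgt h1 /=; lia.
  + by have := d2 d; rewrite Cg Cf; case: (d == c.+1) => /=; lia.
have [u [u1 u2 u3 u4 u5]] := phi_dec s hc; have Cf := cge_change u1 u4 u5.
split=> [//|d t|d]; last by rewrite Cg Cf d2 !leq0n.
have := d1 d t; rewrite Cg Cf; case: (d =P c.+1) => [->|_] /=; last by rewrite !addn0.
case: (leqP t v0) => h1; case: (leqP t u) => h2 /=; try lia.
set f' := phi m c.+1 f in Cf d1 d2 u4 u5 *.
have E1 := cge_clt f' c.+1 t; have E2 := cge_clt f' c t.
have E3 := cge_clt g' c.+1 t; have E4 := cge_clt g' c t.
have := d1 c t; have := d2 c.+1; have := d2 c.
have : cl_ g' c.+1 t = cl_ g' c t by apply: clt_same => w hw wt; apply: mv; lia.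
have : cl_ f' c.+1 t < cl_ f' c t by apply: (@clt_drop _ _ _ u).
lia.
Qed.
End Dominance.

(** * The left key of the largest letters of a reverse set-valued tableau *)

Definition ent (T : seq (seq (seq nat))) j v := has (fun R => (j < size R) && (last 0 (nth [::] R j) == v)) T.

Lemma entP T j v : reflect (exists r, j < rs T r /\ last 0 (cl T r j) = v) (ent T j v).
Proof.
apply: (iffP (has_nthP [::])) => [[r _ /andP [h1 /eqP h2]]|[r [h1 h2]]]; first by exists r.
exists r; last by rewrite -/(rs T r) h1 -/(cl T r j) h2 eqxx.
by rewrite ltnNge; apply/negP => /(nth_default [::]) e; move: h1; rewrite /rs e.
Qed.

Definition cntR (T : seq (seq (seq nat))) j := count (fun R => j < size R) T.
Definition colT T l j := [seq ent T j v | v <- l].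

(* [g] is the weight of the left key of the tableau of maximal letters. *)
Definition good n k T (g : nat -> nat) :=
  [/\ forall v, ~~ (k < v <= n) -> g v = 0,
      forall j, KF true (colT T (lk k n)) 0 j = [seq j < g v | v <- lk k n] &
      forall j, count (fun v => j < g v) (lk k n) = cntR T j].

(** The letter scanned first is the smallest and can serve only an equal demand, so it has to be
    present in the innermost column to survive. *)
Lemma KF_weak (b : nat -> bool) (F : nat -> bitseq) i n : ~~ b (i + n.+1) ->
  KF true (fun j => b j :: F j) i n.+1 = false :: KF true F i n.+1.
Proof.
elim: n i => [|n IH] i h; first by move: h; rewrite addn1 /= => /negbTE ->; rewrite andbF.
rewrite -[KF true _ i n.+2]/(ob true (b i :: F i) (KF true (fun j => b j :: F j) i.+1 n.+1) 0).
by rewrite IH ?addSnnS //= andbF.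
Qed.

Lemma good_ext n k T T2 g : (forall r, rs T2 r = rs T r) -> size T2 = size T ->
  (forall r j, j < rs T r -> last 0 (cl T2 r j) = last 0 (cl T r j)) -> good n k T g -> good n k T2 g.
Proof.
move=> h1 h2 h3 [g1 g2 g3].
have E j v : ent T2 j v = ent T j v.
  by apply/entP/entP => -[r [a1 a2]]; exists r; move: a1 a2; rewrite h1 => a1; rewrite h3.
split=> // j.
  by rewrite -g2; apply: eq_KF => i _; apply: eq_map => v; exact: E.
rewrite g3 /cntR -!(count_map size (fun s => j < s)); congr count.
apply: (@eq_from_nth _ 0) => [|i]; first by rewrite !size_map.
by rewrite size_map => hi; rewrite (nth_map [::]) // (nth_map [::]) ?h2 // -/(rs T2 i) h1.
Qed.

Lemma good_addM n k c0 T g : k < n -> QT n k c0 T -> okM c0 T -> good n k T g -> good n k (addM c0 k.+1 T) g.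
Proof.
move=> kn qT /andP [f0 /eqP ok]; have [sT _ h2 _ _] := qT; have rn := short_lt kn qT.
set q := (firstshort c0 T).-1 in ok.
have st : size (take c0 (nth [::] T q)) = c0 by rewrite size_takel // -/(rs T q) ok.
apply: good_ext.
- by move=> r; rewrite rs_set; case: (r =P _) => [->|] //; rewrite -/q size_rcons st ok.
- by rewrite size_set_nth sT; lia.
move=> r j; rewrite cl_set -/q; case: (r =P _) => [->|] //; rewrite ok ltnS leq_eqVlt => /orP [/eqP ->|lt].
  by rewrite nth_rcons st ltnn eqxx; have [/okcell_head [-> _ _] _] := h2 q c0 ltac:(lia).
by rewrite nth_rcons st lt nth_take.
Qed.

(** Only the column of index [c0] changes. Seen from an earlier column, the new smallest letter
    either serves itself or is one more pending demand; by [KF_exb] the key column gains the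
    smallest element of the previous one that it lacks. Later key columns do not change, by
    [KF_weak]. *)
Lemma good_addN n k c0 T g : k < n -> QT n k c0 T -> okN c0 T -> good n k T g ->
  exists v0, [/\ k < v0 <= n, g v0 = c0, forall v, k < v < v0 -> g v <> c0 &
    good n k (addN c0 k.+1 T) (fun v => g v + (v == v0))].
Proof.
move=> kn qT /eqP ok [g1 g2 g3]; have [sT h1 h2 h3 h4] := qT; have rn := short_lt kn qT.
rewrite /addN; set r0 := firstshort c0 T in ok rn *; set R := rcons _ _; set T2 := set_nth _ _ _ _.
have sR : size R = c0.+1 by rewrite size_rcons -/(rs T r0) ok.
have E j v : ent T2 j v = ent T j v || ((j == c0) && (v == k.+1)).
  apply/entP/orP => [[r []]|[/entP [r [e1 e2]]|/andP [/eqP -> /eqP ->]]].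
  - rewrite rs_set cl_set; case: (r =P r0) => [_|_ e1 e2]; last by left; apply/entP; exists r.
    rewrite sR ltnS leq_eqVlt nth_rcons -/(rs T r0) ok => /orP [/eqP ->|lt].
      by rewrite ltnn eqxx /= => <-; right; rewrite eqxx.
    by rewrite lt => e; left; apply/entP; exists r0; rewrite ok.
  - exists r; rewrite rs_set cl_set; case: (r =P r0) e1 e2 => [->|] //; rewrite ok => lt e.
    by rewrite sR nth_rcons -/(rs T r0) ok lt; split=> //; lia.
  - by exists r0; rewrite rs_set cl_set eqxx sR nth_rcons -/(rs T r0) ok ltnn eqxx.
have nb j : c0 <= j -> ent T j k.+1 = false.
  move=> le; apply/entP => -[r [e1 e2]]; have [/okcell_head [e _ _] /(_ le) /negP] := h2 _ _ e1.
  by apply; rewrite e -[X in X \in _]e2 {1}e; apply: mem_last.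
pose F0 := colT T (lk k.+1 n).
have cT j : colT T (lk k n) j = ent T j k.+1 :: F0 j by rewrite /colT (lkS kn).
have cT2 j : j != c0 -> colT T2 (lk k n) j = colT T (lk k n) j.
  by move=> /negbTE nj; apply: eq_map => v; rewrite E nj orbF.
have cTc : colT T2 (lk k n) c0 = true :: F0 c0.
  rewrite /colT (lkS kn) /= E !eqxx orbT; congr (_ :: _); apply/eq_in_map => v.
  by rewrite mem_lk => hv; rewrite E [v == _]gtn_eqF ?andbF ?orbF //; lia.
(* Row [r0] has length [c0], so the column before is strictly taller and some entry equals [c0]; for
   [c0 = 0] the letter [k+1] itself is such an entry. *)
have ex : exists v, (k < v <= n) && (g v == c0).
  case: (posnP c0) => [e|c0p].
    exists k.+1; rewrite ltnSn kn; have := g2 0; rewrite /= cT (lkS kn) /= nb ?e // => -[+ _].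
    by case: (g k.+1).
  have lt : cntR T c0 < cntR T c0.-1.
    apply: (@count_lt _ _ _ _ (nth [::] T r0)); rewrite ?mem_nth ?sT -?/(rs T r0) ?ok //; [|lia|lia].
    by move=> x; lia.
  have : has (fun v => g v == c0) (lk k n).
    apply: contraTT lt => /hasPn nh; rewrite -!g3 -leqNgt; apply: eq_leq; apply: eq_in_count => v /nh; lia.
  by case/hasP => v; rewrite mem_lk => hv /eqP e; exists v; rewrite hv e eqxx.
case: (ex_minnP ex) => v0 /andP [v1 /eqP v2] v3; exists v0; split=> //.
  by move=> v hv e; have := v3 v; rewrite e eqxx andbT; lia.
split=> [v nv|j|j].
- by rewrite g1 //; case: (v =P v0) => [e|]; first by move: nv; rewrite e v1.
- case: (ltngtP j c0) => hj.
  + rewrite (@eq_KF _ _ (colT T (lk k n))) => [|i hi]; last by apply: cT2; lia.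
    by rewrite g2; apply/eq_map => v; case: (v =P v0) => [->|]; lia.
  + rewrite [RHS](_ : _ = [seq j < g v | v <- lk k n]); last first.
      by apply/eq_map => v; case: (v =P v0) => [->|]; lia.
    rewrite -g2; case: j hj => // j hj.
    rewrite [RHS](@eq_KF _ _ (fun j => ent T j k.+1 :: F0 j)); last by move=> i _; exact: cT.
    rewrite [LHS](@eq_KF _ _ (fun j => (ent T j k.+1 || (j == c0)) :: F0 j)); last first.
      move=> i _; case: (i =P c0) => [->|/eqP ne]; first by rewrite cTc orbT.
      by rewrite cT2 // cT orbF.
    by rewrite !KF_weak ?add0n ?nb //; lia.
  + subst j; case: (posnP c0) => [e|c0p].
      have cT0 := cTc; rewrite e in cT0 *; rewrite /= cT0 (lkS kn) /=; have vk : v0 = k.+1.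
        apply/eqP; rewrite eqn_leq; apply/andP; split; last by lia.
        apply: v3; rewrite ltnSn kn e; have := g2 0; rewrite /= cT (lkS kn) /= nb ?e // => -[+ _].
        by case: (g k.+1).
      rewrite vk eqxx addn1 ltn0Sn; congr (_ :: _).
      have := g2 0; rewrite /= cT (lkS kn) /= => -[_ ->]; apply/eq_in_map => v.
      by rewrite mem_lk => hv; rewrite [v == _]gtn_eqF ?addn0 //; lia.
    have sz i : size (colT T (lk k n) i) = size (lk k n) by rewrite size_map.
    have := @KF_exb true (size (lk k n)) (colT T (lk k n)) (colT T2 (lk k n)) (true :: F0 c0) 0 c0 sz.
    rewrite add0n => -> //; last 1 first.
    * move=> i; rewrite !cT (nb c0 (leqnn _)) /=; case: (ent T i k.+1) => //=.
      by rewrite subn0 ob_ext // /F0 /colT ?size_map.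
    * rewrite !g2 (@exb_map geq); [|by move=> x; exact: leqnn|].
        apply/eq_in_map => v; rewrite mem_lk => hv.
        case: (ltngtP c0 (g v)) => h /=; [lia| |].
          by rewrite [c0.-1 < _](_ : _ = false) /=; [case: (v =P v0) => [e|]; lia|lia].
        rewrite -h prednK // leqnn /=.
        have -> : (c0 < c0 + (v == v0)) = (v == v0) by case: (v == v0); lia.
        apply/allP/eqP => [H|-> u hu].
          have := H v0; rewrite mem_lk v1 v2 ltnn leqnn /= => /(_ isT).
          by have := v3 v; rewrite hv -h eqxx => /(_ isT); rewrite /geq /=; lia.
        apply/implyP => hh; have := v3 u; rewrite mem_lk in hu; rewrite hu /geq /=.
        by move=> H; apply: H; lia.
      have := iota_ltn_sorted k.+1 (n - k); rewrite (sorted_pairwise ltn_trans).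
      by apply: sub_pairwise => x y; rewrite /geq /=; lia.
    * by move=> i hi; rewrite cT2 //; lia.
    * by rewrite /= /F0 /colT size_map (lkS kn).
- have := @count_off (fun v => j < g v + (v == v0)) (fun v => j < g v) (lk k n) v0 (iota_uniq _ _).
  rewrite mem_lk v1 v2 eqxx => /(_ isT) h0; have {}h0 := h0 ltac:(by move=> v /negbTE ->; rewrite addn0).
  have cR T' : cntR T' j = count (fun r => j < rs T' r) (iota 0 (size T')).
    by rewrite /cntR -{1}[T'](mkseq_nth [::]) /mkseq count_map.
  have s2 : size T2 = size T by rewrite size_set_nth sT; lia.
  have := @count_off (fun r => j < rs T2 r) (fun r => j < rs T r) (iota 0 n) r0 (iota_uniq _ _).
  rewrite mem_iota rn => /(_ isT) h; have {}h := h _; rewrite rs_set eqxx sR ok -sT -{1}s2 -!cR in h.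
  rewrite g3 in h0; have {}h := h ltac:(by move=> v /negbTE nv; rewrite rs_set nv).
  by move: h0 h; lia.
Qed.

Lemma addN_neq n k c0 T T' : k < n -> QT n k c0 T -> QT n k c0 T' -> okN c0 T -> okM c0 T' ->
  addN c0 k.+1 T <> addM c0 k.+1 T'.
Proof.
move=> kn qT qT' ok ok' e; have E : T = T' by rewrite -(del_addN kn qT ok) e (del_addM kn qT' ok').
case/andP: (ok') => f0 _; have := congr1 (fun T => rs T (firstshort c0 T')) e.
rewrite E /addN /addM !rs_set eqxx ifF; last by lia.
by rewrite size_rcons; have := short_at c0 T'; rewrite /rs; lia.
Qed.

Lemma notQT_addN n k c0 T : k < n -> QT n k c0 T -> okN c0 T -> ~ QT n k c0 (addN c0 k.+1 T).
Proof.
move=> kn qT /eqP ok [_ _ h _ _]; have := h (firstshort c0 T) c0.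
rewrite rs_set cl_set eqxx size_rcons -/(rs T _) ok => /(_ (leqnn _)) [_ /(_ (leqnn _))].
by rewrite nth_rcons -/(rs T _) ok ltnn eqxx inE eqxx.
Qed.

Lemma notQT_addM n k c0 T : k < n -> QT n k c0 T -> okM c0 T -> ~ QT n k c0 (addM c0 k.+1 T).
Proof.
move=> kn qT /andP [_ /eqP ok] [_ _ h _ _]; have := h (firstshort c0 T).-1 c0.
have st : size (take c0 (nth [::] T (firstshort c0 T).-1)) = c0 by rewrite size_takel // -/(rs T _) ok.
rewrite rs_set cl_set eqxx size_rcons st => /(_ (leqnn _)) [_ /(_ (leqnn _))].
by rewrite nth_rcons st ltnn eqxx inE eqxx.
Qed.

Lemma row_ex T j : cntR T j.+1 < cntR T j -> exists r, rs T r = j.+1.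
Proof.
move=> lt; have : has (fun R => size R == j.+1) T.
  apply: contraTT lt => /hasPn nh; rewrite -leqNgt; apply: eq_leq; apply: eq_in_count => R /nh; lia.
by case/(has_nthP [::]) => r _ /eqP; exists r.
Qed.

Lemma okM_iff n k c0 T : QT n k c0 T -> okM c0 T = (cntR T c0.+1 < cntR T c0).
Proof.
move=> qT; apply/andP/idP => [[f0 /eqP e]|].
  apply: (@count_lt _ _ _ _ (nth [::] T (firstshort c0 T).-1)); rewrite -?/(rs T _) ?e ?leqnn ?ltnn //.
    apply: mem_nth; rewrite ltnNge; apply/negP => /(nth_default [::]) e'; move: e; rewrite /rs e' //.
  by move=> R /ltnW.
move/row_ex => [r e]; have mono := QT_mono qT.
have lt : r < firstshort c0 T.
  by rewrite ltnNge; apply/negP => /mono; have := short_at c0 T; rewrite e; lia.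
split; first by lia.
have le : r <= (firstshort c0 T).-1 by lia.
by have := mono _ _ le; rewrite e; have := @short_before c0 T (firstshort c0 T).-1; lia.
Qed.

Lemma okN_of n k c0 T : QT n k c0 T -> c0 = 0 \/ cntR T c0 < cntR T c0.-1 -> okN c0 T.
Proof.
move=> qT; have sa := short_at c0 T; case=> [e|]; first by rewrite /okN; lia.
case: c0 qT sa => [|c0] qT sa; first by rewrite ltnn.
move/row_ex => [r e]; have mono := QT_mono qT.
have le : firstshort c0.+1 T <= r.
  by rewrite leqNgt; apply/negP => /short_before; rewrite e ltnn.
by have := mono _ _ le; rewrite /okN e; lia.
Qed.

Lemma good_inj n k T g g' : good n k T g -> good n k T g' -> g = g'.
Proof.
case=> g1 g2 _ [h1 h2 _]; apply: functional_extensionality => v.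
case: (boolP (k < v <= n)) => hv; last by rewrite g1 ?h1.
have E j : (j < g v) = (j < g' v).
  have := g2 j; rewrite h2 => /eq_in_map /(_ v); rewrite mem_lk => /(_ hv); exact: esym.
by have := E (g v); have := E (g' v); rewrite !ltnn; lia.
Qed.

Lemma QT_up n k c T : QT n k 0 T -> (forall r, rs T r <= c) -> QT n k.+1 c T.
Proof.
move=> [sT h1 h2 h3 h4] hc; split=> // r j hj; have [ok /(_ (leq0n _)) nk] := h2 _ _ hj.
split; last by have := hc r; lia.
case/and3P: ok => a1 a2 /allP a3; apply/and3P; split=> //; apply/allP => v hv; have := a3 v hv.
by have : v != k.+1 by [apply: contraNneq nk => <-]; lia.
Qed.

Lemma QT_down n k c T : QT n k.+1 c T -> QT n k 0 T.
Proof.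
move=> [sT h1 h2 h3 h4]; split=> // r j hj; have [/and3P [a1 a2 /allP a3] _] := h2 _ _ hj.
split; last by move=> _; apply/negP => /a3; lia.
by apply/and3P; split=> //; apply/allP => v /a3; lia.
Qed.

Lemma good_level n k T g : k < n -> (forall j, ent T j k.+1 = false) -> good n k T g <-> good n k.+1 T g.
Proof.
move=> kn nb.
have cT j : colT T (lk k n) j = false :: colT T (lk k.+1 n) j by rewrite /colT (lkS kn) /= nb.
have K j : KF true (colT T (lk k n)) 0 j = false :: KF true (colT T (lk k.+1 n)) 0 j.
  rewrite (@eq_KF _ _ (fun j => false :: colT T (lk k.+1 n) j)); last by move=> i _; exact: cT.
  by case: j => // j; rewrite (@KF_weak (fun=> false)).
split=> -[g1 g2 g3].
- have g0 : g k.+1 = 0 by have := g2 0; rewrite K (lkS kn) /= => -[+ _]; case: (g k.+1).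
  split=> [v nv|j|j].
  + by case: (v =P k.+1) => [->|ne] //; apply: g1; lia.
  + by have := g2 j; rewrite K (lkS kn) /= => -[_ ->].
  + by rewrite -g3 (lkS kn) /= g0.
split=> [v nv|j|j].
- by apply: g1; lia.
- by rewrite K (lkS kn) /= g2 (g1 k.+1) //; lia.
- by rewrite (lkS kn) /= g3 (g1 k.+1) //; lia.
Qed.

Lemma QT_noent n k T j : QT n k 0 T -> ent T j k.+1 = false.
Proof.
move=> [_ _ h _ _]; apply/entP => -[r [h1 h2]]; have [/okcell_head [e _ _] /(_ (leq0n _)) /negP] := h _ _ h1.
by apply; rewrite e -[X in X \in _]h2 {1}e; apply: mem_last.
Qed.

Lemma QT_case n k c T : k < n -> QT n k c.+1 T -> QT n k c T \/
  exists T', QT n k c T' /\ (okN c T' /\ T = addN c k.+1 T' \/ okM c T' /\ T = addM c k.+1 T').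
Proof.
move=> kn qT; case: (boolP (has (fun r => (c < rs T r) && (k.+1 \in cl T r c)) (iota 0 n))).
  case/hasP => r _ /andP [h1 h2]; right; exists (del c k.+1 T); exact: (QT_del kn qT h1 h2).
move=> /hasPn nh; left; have [sT h1 h2 h3 h4] := qT; split=> // r j hj; have [o1 o2] := h2 _ _ hj.
split=> //; rewrite leq_eqVlt => /orP [/eqP e|]; last exact: o2.
have rn : r < n by rewrite -sT ltnNge; apply/negP => /(nth_default [::]) e'; move: hj; rewrite /rs e'.
by have := nh r; rewrite mem_iota rn e hj => /(_ isT).
Qed.

(** Deleting the smallest letters one at a time reduces every tableau to the empty one; [good_addN]
    and [good_addM] rebuild the weight on the way back. *)
Lemma good_ex n k c T : k <= n -> QT n k c T -> exists g, good n k T g.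
Proof.
move=> kn; have [d] := ubnP (n - k); elim: d k c T kn => // d IHd k c T kn hd.
case: (ltnP k n) => [lt|ge].
  elim: c T => [|c IHc] T qT.
    have nb j := QT_noent j qT; have [|||g hg] := IHd k.+1 (rs T 0) T; [lia|lia| |].
      by apply: QT_up => // r; apply: (QT_mono qT).
    by exists g; apply/good_level.
  case: (QT_case lt qT) => [/IHc //|[T' [qT' [[ok ->]|[ok ->]]]]]; have [g hg] := IHc _ qT'.
    by have [v0 [_ _ _ hv]] := good_addN lt qT' ok hg; exists (fun v => g v + (v == v0)).
  by exists g; apply: good_addM.
move=> [sT h1 h2 h3 h4]; exists (fun=> 0).
have r0 r : rs T r = 0.
  case e: (rs T r) => [|j] //; have [/okcell_head [_ a1 /andP [a2 a3]] _] := h2 r 0 ltac:(lia).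
  by have := leq_trans a1 (leq_trans a2 a3); lia.
have E : lk k n = [::] by rewrite /lk (_ : n - k = 0) //; lia.
split=> // j; rewrite E.
  by apply/eqP; rewrite -size_eq0 (size_KF true (s := 0)).
rewrite /cntR /=; symmetry; apply/eqP; rewrite -leqn0 leqNgt -has_count; apply/(has_nthP [::]) => -[i _].
by rewrite -/(rs T i) r0.
Qed.

(** The tableaux of the Lascoux polynomial of [f], at the intermediate stage where the letters
    exceed [k] and [k+1] is confined to the columns of index less than [c]. *)
Definition OKP n m k c f T := QT n k c T /\ exists g, good n k T g /\ dl k m g f.

Section Split.
Variables n m : nat.
Hypothesis nm : n <= m.

Lemma cge_good k T g j : k <= n -> good n k T g -> cge k m g j.+1 0 = cntR T j.
Proof.
move=> kn [g1 _ <-]; rewrite /cge /lk (_ : m - k = (n - k) + (m - n)) ?iotaD ?count_cat; last by lia.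
rewrite [X in _ + X](_ : _ = 0) ?addn0 //; apply/eqP; rewrite -leqn0 leqNgt -has_count; apply/hasP => -[v].
by rewrite mem_iota => hv; rewrite g1 //; lia.
Qed.

Lemma hasc_iff k f c : (forall v, ~~ (k < v <= m) -> f v = 0) -> 
  hasc m f c.+1 = (cge k m f c.+2 0 < cge k m f c.+1 0).
Proof.
move=> s; apply/hasP/idP => [[v hv /eqP e]|].
  apply: (@count_lt _ _ _ _ v); rewrite ?e ?leqnn ?ltnn //; last by move=> u /ltnW.
  by rewrite mem_lk; case: (boolP (k < v <= m)) => // /s; rewrite e.
move=> lt; have : has (fun v => f v == c.+1) (lk k m).
  apply: contraTT lt => /hasPn nh; rewrite -leqNgt; apply: eq_leq; apply: eq_in_count => v /nh /=; lia.
by case/hasP => v; rewrite mem_lk => hv e; exists v => //; rewrite mem_iota; lia.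
Qed.

(** Dominance forces equal column heights, so whether a corner sits in the given column can be read
    off [f] alone. *)
Lemma OKM k c f T : k < n -> (forall v, ~~ (k < v <= m) -> f v = 0) -> OKP n m k c f T ->
  okM c T = hasc m f c.+1.
Proof.
move=> kn s [qT [g [gg [_ _ d]]]]; rewrite (okM_iff qT) (hasc_iff _ s) -!d.
by rewrite !(cge_good _ _ gg) // ltnW.
Qed.

Lemma OKN k c f T : k < n -> (forall v, ~~ (k < v <= m) -> f v = 0) -> hasc m f c.+1 ->
  OKP n m k c (phi m c.+1 f) T -> okN c T.
Proof.
move=> kn s hc [qT [g [gg [_ _ d]]]]; apply: (okN_of qT); case: c hc qT d => [|c] hc qT d; [by left|right].
have [u [u1 u2 _ u4 u5]] := phi_dec s hc.
rewrite -!(cge_good _ (ltnW kn) gg) !d; apply: (@count_lt _ _ _ _ u); rewrite ?mem_lk ?u4 ?leqnn ?ltnn //.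
by move=> v /ltnW.
Qed.

(** This is the recursion of [nst] for sets of tableaux: [k+1] is absent from the column of index
    [c], or joins its bottom cell, or forms a new cell there. [dl_step] says that the last case
    replaces [f] by [phi]. *)
Lemma OKP_split k c f T : k < n -> (forall v, ~~ (k < v <= m) -> f v = 0) ->
  OKP n m k c.+1 f T <-> OKP n m k c f T \/ hasc m f c.+1 /\
    ((exists2 T', OKP n m k c f T' & T = addM c k.+1 T') \/
     exists2 T', OKP n m k c (phi m c.+1 f) T' & T = addN c k.+1 T').
Proof.
move=> kn s; split=> [[qT [g [gg dg]]]|].
  case: (QT_case kn qT) => [q|[T' [q [[ok e]|[ok e]]]]]; first by left; split=> //; exists g.
    right; have [g' hg'] := good_ex (ltnW kn) q; have [v0 [v1 v2 v3 v4]] := good_addN kn q ok hg'.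
    rewrite e in gg; have eg := good_inj gg v4.
    have hv : k < v0 <= m by lia.
    have [/(_ dg) [hc hd] _] := @dl_step k m g g' f v0 c s hv v2 v3 ltac:(by rewrite eg).
    by split=> //; right; exists T' => //; split=> //; exists g'.
  right; have [g' hg'] := good_ex (ltnW kn) q; have eg := good_addM kn q ok hg'.
  rewrite e in gg; have E := good_inj gg eg; subst g'.
  have okp : OKP n m k c f T' by split=> //; exists g.
  by split; [rewrite -(OKM kn s okp) | left; exists T'].
have up T' : QT n k c T' -> QT n k c.+1 T'.
  move=> [h1 h2 h3 h4 h5]; split=> // r j hj; have [o1 o2] := h3 _ _ hj; split=> // lt; apply: o2; lia.
case=> [[q ex]|[hc [[T' ok ->]|[T' ok ->]]]]; first by split=> //; exact: up.
  have okm := OKM kn s ok; case: ok => q [g [gg dg]]; rewrite hc in okm.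
  by split; [exact: QT_addM | exists g; split=> //; exact: good_addM].
have okn := OKN kn s hc ok; case: ok => q [g [gg dg]].
have [v0 [v1 v2 v3 v4]] := good_addN kn q okn gg.
split; first exact: QT_addN.
exists (fun v => g v + (v == v0)); split=> //.
have hv : k < v0 <= m by lia.
by apply/(@dl_step k m _ g f v0 c s hv v2 v3).
Qed.

Lemma dl_level k g f : k < m -> g k.+1 = 0 -> dl k m g f <-> f k.+1 = 0 /\ dl k.+1 m g f.
Proof.
move=> km g0; have E h c t : cge k m h c t = ((t <= k.+1) && (c <= h k.+1)) + cge k.+1 m h c t.
  by rewrite /cge (lkS km).
have E1 h c : cge k.+1 m h c k.+2 = cge k.+1 m h c 0.
  by apply: eq_in_count => v; rewrite mem_lk => hv; rewrite /=; case: ltnP => //; lia.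
split=> [[s d1 d2]|[f0 [s d1 d2]]].
  have f0 : f k.+1 = 0.
    by have := d1 1 k.+2; have := d2 1; rewrite !E !E1 g0 ltnn /=; case: (f k.+1) => //= ?; lia.
  split=> //; split=> [v nv|c t|c].
  - by case: (v =P k.+1) => [-> //|ne]; apply: s; lia.
  - by have := d1 c t; rewrite !E f0 g0; lia.
  - by have := d2 c; rewrite !E f0 g0; lia.
split=> [v nv|c t|c]; first by apply: s; lia.
- by rewrite !E f0 g0; have := d1 c t; lia.
- by rewrite !E f0 g0 d2.
Qed.

(** Once [k+1] is absent from all columns, it cannot occur in the key, so [f] vanishes there. The
    next letter starts without a real column restriction because row lengths are at most [m]. *)
Lemma OKP_level k f T : k < n -> (forall v, f v <= m) ->
  OKP n m k 0 f T <-> f k.+1 = 0 /\ OKP n m k.+1 m f T.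
Proof.
move=> kn fm; have km : k < m by lia.
split=> [[q [g [gg dg]]]|[f0 [q [g [gg dg]]]]].
  have nb j := QT_noent j q; have gg' : good n k.+1 T g by apply/(good_level _ kn nb).
  have g0 : g k.+1 = 0 by case: gg' => + _ _; apply; rewrite ltnn.
  have [f0 dg'] : f k.+1 = 0 /\ dl k.+1 m g f by apply/dl_level.
  split=> //; split; last by exists g.
  apply: QT_up => // r; case: dg => _ _ /(_ m.+1); rewrite (cge_good _ (ltnW kn) gg).
  rewrite [RHS](_ : _ = 0); last first.
    by apply/eqP; rewrite -leqn0 leqNgt -has_count; apply/hasP => -[v _ /=]; have := fm v; lia.
  move/eqP; rewrite -leqn0 leqNgt -has_count => /(has_nthP [::]) nh; rewrite leqNgt; apply/negP => lt.
  apply: nh; exists r => //; rewrite ltnNge; apply/negP => /(nth_default [::]) e; move: lt; rewrite /rs e //.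
have qd := QT_down q; split=> //; exists g; split.
  by apply/good_level => // j; exact: (QT_noent j qd).
apply/dl_level => //; case: gg => + _ _; apply; rewrite ltnn //.
Qed.
End Split.

(** * The recursion [Fr] as a sum over reverse set-valued tableaux *)

Local Open Scope ring_scope.

Section Enum.
Variables (V : comNzRingType) (x : nat -> V).

Definition wR (R : seq (seq nat)) : V := \prod_(L <- R) \prod_(v <- L) x v.-1.
Definition wT (T : seq (seq (seq nat))) : V := \prod_(R <- T) wR R.

Lemma wT_set T r R y : (r < size T)%N -> wR R = wR (nth [::] T r) * y -> wT (set_nth [::] T r R) = wT T * y.
Proof.
rewrite /wT; elim: T r => [|R' T IH] [|r] //= h e; rewrite !big_cons; first by rewrite e mulrAC.
by rewrite IH // mulrA.
Qed.

Variables (n m : nat).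
Hypothesis nm : (n <= m)%N.

Lemma wT_addN k c T : (k < n)%N -> QT n k c T -> wT (addN c k.+1 T) = wT T * x k.
Proof.
move=> kn qT; apply: wT_set; first by case: (qT) => -> _ _ _ _; exact: (short_lt kn qT).
by rewrite /wR big_rcons /= big_seq1.
Qed.

Lemma wT_addM k c T : (k < n)%N -> QT n k c T -> okM c T -> wT (addM c k.+1 T) = wT T * x k.
Proof.
move=> kn qT /andP [_ /eqP ok]; apply: wT_set; first by case: (qT) => -> _ _ _ _; have := short_lt kn qT; lia.
by rewrite [in RHS](row_split ok) /wR !big_rcons /= big_cons [x k * _]mulrC mulrA.
Qed.

Lemma uniq_step k c f s1 s2 : (k < n)%N -> (forall v, ~~ (k < v <= m)%N -> f v = 0%N) -> hasc m f c.+1 ->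
  uniq s1 -> (forall T, T \in s1 <-> OKP n m k c f T) ->
  uniq s2 -> (forall T, T \in s2 <-> OKP n m k c (phi m c.+1 f) T) ->
  uniq (s1 ++ (map (addM c k.+1) s1 ++ map (addN c k.+1) s2)).
Proof.
move=> kn s hc u1 h1 u2 h2.
have M T : T \in s1 -> QT n k c T /\ okM c T by move/h1 => o; split; [case: o | rewrite (OKM nm kn s o)].
have N T : T \in s2 -> QT n k c T /\ okN c T by move/h2 => o; split; [case: o | exact: (OKN nm kn s hc o)].
rewrite cat_uniq u1 cat_uniq !map_inj_in_uniq ?u1 ?u2 /=.
- rewrite andbT; apply/andP; split; apply/hasPn => T.
    rewrite mem_cat => /orP [/mapP [T' /M [q o] ->]|/mapP [T' /N [q o] ->]]; apply/negP => /M [].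
      by move/(notQT_addM kn q o).
    by move/(notQT_addN kn q o).
  move=> /mapP [T' /N [q o] ->]; apply/negP => /mapP [T2 /M [q2 o2]].
  exact: (addN_neq kn q q2 o o2).
- move=> T T' /N [q o] /N [q' o'] e; have := congr1 (del c k.+1) e.
  by rewrite (del_addN kn q o) (del_addN kn q' o').
- move=> T T' /M [q o] /M [q' o'] e; have := congr1 (del c k.+1) e.
  by rewrite (del_addM kn q o) (del_addM kn q' o').
Qed.

(** The sets of tableaux are given by explicit duplicate-free lists, as [fsum] requires; the three
    pieces of [OKP_split] are disjoint by [uniq_step], and each added letter contributes one
    factor. *)
Lemma enum_step j : (j < n)%N ->
  (forall f, (forall v, f v <= m)%N -> (forall v, ~~ (0 < v <= m)%N -> f v = 0%N) ->
    exists s, [/\ uniq s, forall T, T \in s <-> OKP n m (n - j) m f T & \sum_(T <- s) wT T = Fr n m x j f]) ->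
  forall c f, (forall v, f v <= m)%N -> (forall v, ~~ (n - j.+1 < v <= m)%N -> f v = 0%N) ->
    exists s, [/\ uniq s, forall T, T \in s <-> OKP n m (n - j.+1) c f T &
      \sum_(T <- s) wT T = (nst m (Fr n m x j) c f).[x (n - j.+1)%N]].
Proof.
move=> jn IH; have kn : (n - j.+1 < n)%N by lia.
have kS : ((n - j.+1).+1 = n - j)%N by lia.
elim=> [|c IHc] f fm s.
  have s' v : ~~ (0 < v <= m)%N -> f v = 0%N by move=> hv; apply: s; lia.
  have [l [l1 l2 l3]] := IH f fm s'; rewrite /= hornerC.
  case: (f (n - j.+1).+1 =P 0%N) => [f0|fn].
    exists l; split=> // T; rewrite l2; split; last by rewrite (OKP_level _ _ kn) // kS => -[].
    by move=> o; apply/(OKP_level _ _ kn) => //; rewrite kS in f0 *.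
  exists [::]; split=> // [T|]; first by split=> //; move/(OKP_level nm _ kn fm) => -[].
  rewrite big_nil; case: (j) jn fn => [|i] jn fn /=.
    case: decP => // h; case: fn; apply: h; lia.
  case: decP => // h; case: fn; apply: h; lia.
have [l1 [u1 m1 e1]] := IHc f fm s; rewrite /= hornerD.
case hc: (hasc m f c.+1); last first.
  exists l1; split=> // [T|]; last by rewrite horner0 addr0.
  by rewrite m1 (OKP_split nm _ _ kn s) hc; split=> [|[//|[]]] //; left.
have pm v : (phi m c.+1 f v <= m)%N by rewrite /phi; have := fm v; lia.
have ps v : ~~ (n - j.+1 < v <= m)%N -> phi m c.+1 f v = 0%N by move=> hv; rewrite /phi s.
have [l2 [u2 m2 e2]] := IHc _ pm ps.
exists (l1 ++ (map (addM c (n - j.+1).+1) l1 ++ map (addN c (n - j.+1).+1) l2)); split.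
- exact: (uniq_step kn s hc u1 m1 u2 m2).
- move=> T; rewrite (OKP_split nm _ _ kn s) hc !mem_cat; split.
    case/orP => [/m1|/orP [/mapP [T' /m1 h ->]|/mapP [T' /m2 h ->]]]; first by left.
      by right; split=> //; left; exists T'.
    by right; split=> //; right; exists T'.
  case=> [/m1 -> //|[_ [[T' /m1 h ->]|[T' /m2 h ->]]]]; rewrite map_f ?orbT //.
rewrite hornerM hornerX hornerD -e1 -e2 !big_cat !big_map /= mulrDr; congr (_ + (_ + _)).
  rewrite mulr_sumr big_seq [RHS]big_seq; apply: eq_bigr => T /m1 o; case: (o) => q _.
  by rewrite wT_addM ?(OKM nm kn s o) // mulrC.
rewrite mulr_sumr big_seq [RHS]big_seq; apply: eq_bigr => T /m2 [q _].
by rewrite wT_addN // mulrC.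
Qed.

Lemma enum_Fr j f : (j <= n)%N -> (forall v, f v <= m)%N -> (forall v, ~~ (0 < v <= m)%N -> f v = 0%N) ->
  exists s, [/\ uniq s, forall T, T \in s <-> OKP n m (n - j) m f T & \sum_(T <- s) wT T = Fr n m x j f].
Proof.
elim: j f => [|j IH] f jn fm s.
  have Q0 T : QT n n m T <-> T = nseq n [::].
    split=> [[sT h1 h2 h3 h4]|->].
      have r0 r : rs T r = 0%N.
        case e: (rs T r) => [|i] //; have [/okcell_head [_ a1 /andP [a2 a3]] _] := h2 r 0%N ltac:(lia).
        by have := leq_trans a1 (leq_trans a2 a3); lia.
      apply: (@eq_from_nth _ [::]) => [|i hi]; first by rewrite size_nseq.
      by rewrite nth_nseq if_same; apply/eqP; rewrite -size_eq0 -/(rs T i) r0.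
    have r0 r : rs (nseq n [::]) r = 0%N by rewrite /rs nth_nseq if_same.
    by split=> [|r|r c|r c|r c]; rewrite ?size_nseq ?r0.
  have g0 : good n n (nseq n [::]) (fun=> 0%N).
    have [] := @good_ex n n m (nseq n [::]) (leqnn n); first exact/Q0.
    move=> g hg; suff <- : g = (fun=> 0%N) by [].
    case: hg => h _ _; apply: functional_extensionality => v; apply: h; lia.
  rewrite /= subn0; case: decP => h.
    exists [:: nseq n [::]]; split=> // [T|]; last first.
      by rewrite big_seq1 /wT big_seq big1 // => R; rewrite mem_nseq => /andP [_ /eqP ->]; rewrite /wR big_nil.
    have f0 v : f v = 0%N by case: (boolP (0 < v <= m)%N) => hv; [exact: h | exact: s].
    rewrite inE; split=> [/eqP ->|[/Q0 -> _]] //; split; first exact/Q0.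
    exists (fun=> 0%N); split=> //; rewrite (_ : f = fun=> 0%N); last exact: functional_extensionality.
    by split.
  exists [::]; rewrite big_nil; split=> // T; split=> // -[/Q0 -> [g [gg [s1 _ d]]]]; case: h => v hv.
  have eg := good_inj gg g0; subst g; apply/eqP; rewrite -leqn0 leqNgt; apply/negP => fv.
  have := d 1%N; rewrite /cge [LHS](_ : _ = 0)%N; last by apply/eqP; rewrite -leqn0 leqNgt -has_count; apply/hasPn.
  move/esym/eqP; rewrite -leqn0 leqNgt -has_count => /hasPn /(_ v) /=; rewrite mem_lk fv => H.
  by case: (boolP (n < v <= m)%N) => hv'; [have := H hv' | move: fv; rewrite s1].
case: (boolP [forall v : 'I_(n - j.+1), f v.+1 == 0%N]) => h; last first.
  exists [::]; split=> // [T|].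
    split=> // -[_ [g [_ [s1 _ _]]]]; case/forallP: h => -[v hv] /=; rewrite s1 //; lia.
  rewrite big_nil /=; case: decP => // h'; case/forallP: h => -[v hv] /=; rewrite h' //; lia.
have f0 v : (0 < v <= n - j.+1)%N -> f v = 0%N.
  case: v => // v hv; have hv' : (v < n - j.+1)%N by lia.
  by have /forallP /(_ (Ordinal hv')) /eqP := h.
have s' v : ~~ (n - j.+1 < v <= m)%N -> f v = 0%N.
  by move=> hv; case: (boolP (0 < v <= m)%N) => [hv'|/s //]; apply: f0; lia.
have [l [l1 l2 l3]] := enum_step jn (fun f => IH f (ltnW jn)) m fm s'.
by exists l; split=> //; rewrite l3 /=; case: decP.
Qed.
End Enum.

(* From lists of rows to columns, and back to the Lascoux polynomial *)
Local Close Scope ring_scope.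

(** Common form of [col] and of the rows produced by [of_cols]: transposition of a Young diagram. *)
Definition sel (A : Type) (x0 : A) (j : nat) (T : seq (seq A)) := [seq nth x0 r j | r <- T & j < size r].

Lemma sel_size (A : eqType) (x0 : A) j T r : sorted geq (map size T) -> (r < size (sel x0 j T)) = (j < size (nth [::] T r)).
Proof.
elim: T r => [|R T IH] r /=; first by rewrite nth_nil.
rewrite (path_sortedE (rev_trans leq_trans)) => /andP [/allP h srt]; rewrite /sel /=; case: (ltnP j (size R)) => hj.
  by case: r => [|r] //=; rewrite ltnS; exact: IH.
have -> : [seq r <- T | j < size r] = [::].
  apply/eqP; rewrite -size_eq0 size_filter -leqn0 leqNgt -has_count; apply/hasPn => R' h'.
  by have := h _ (map_f size h'); rewrite /geq /=; lia.
case: r => [|r] /=; first by lia.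
case: (ltnP r (size T)) => hr; last by rewrite nth_default.
have := h (size (nth [::] T r)); rewrite map_f ?mem_nth // /geq /=; lia.
Qed.

Lemma sel_nth (A : eqType) (x0 : A) j T r : sorted geq (map size T) -> j < size (nth [::] T r) -> 
  nth x0 (sel x0 j T) r = nth x0 (nth [::] T r) j.
Proof.
elim: T r => [|R T IH] r /=; first by rewrite nth_nil.
rewrite (path_sortedE (rev_trans leq_trans)) => /andP [/allP h srt]; rewrite /sel /=; case: (ltnP j (size R)) => hj.
  by case: r => [|r] //=; exact: IH.
case: r => [|r] /=; first by lia.
case: (ltnP r (size T)) => hr; last by rewrite nth_default.
have := h (size (nth [::] T r)); rewrite map_f ?mem_nth // /geq /=; lia.
Qed.

Lemma of_cols_row (A : eqType) (x0 : A) cs r : sorted geq (map size cs) -> nth [::] (of_cols x0 cs) r = sel x0 r cs.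
Proof.
move=> srt; case: (ltnP r (size (head [::] cs))) => hr.
  by rewrite (nth_map 0) ?size_iota // nth_iota.
rewrite nth_default ?size_map ?size_iota //; apply/esym/eqP; rewrite -size_eq0.
by have := @sel_size _ x0 r cs 0 srt; rewrite nth0; case: (size (sel _ _ _)) => //; lia.
Qed.

Lemma count_nth_leq t (A : seq nat) r : sorted geq A -> r < size A -> (t <= nth 0 A r) = (r < count (leq t) A).
Proof.
elim: A r => //= a A IH r; rewrite (path_sortedE (rev_trans leq_trans)) => /andP [/allP h srt].
case: r => [|r] /=; rewrite ?ltnS => hr.
  case e: (t <= a) => //=; rewrite add0n; apply/esym/negbTE; rewrite -leqNgt leqn0 -[_ == _]negbK -lt0n -has_count.
  by apply/hasPn => x /h; rewrite /geq /=; lia.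
rewrite IH //; case e: (t <= a) => //=; rewrite add0n.
have -> : count (leq t) A = 0; last by [].
by apply/eqP; rewrite -leqn0 leqNgt -has_count; apply/hasPn => x /h; rewrite /geq /=; lia.
Qed.

Definition dcol n (h : nat -> nat) j := rev [seq i <- iota 1 n | j < h i].

Lemma count_dcol n h j t : count (leq t) (dcol n h j) = cge 0 n h j.+1 t.
Proof. by rewrite /dcol count_rev count_filter /cge /lk subn0; apply: eq_count => v /=; rewrite andbC. Qed.

Lemma size_dcol n h j : size (dcol n h j) = cge 0 n h j.+1 0.
Proof. by rewrite -count_dcol -[LHS](count_predT) ; apply: eq_count. Qed.

Lemma sorted_dcol n h j : sorted geq (dcol n h j).
Proof.
rewrite rev_sorted; apply: sorted_filter; first exact: leq_trans.
by have := iota_sorted 1 n; apply: sub_sorted => x y.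
Qed.

Lemma cge_anti k n h c d t : c <= d -> cge k n h d t <= cge k n h c t.
Proof. by move=> le; apply: sub_count => v /andP [-> /=]; apply: leq_trans. Qed.

Lemma shape_dcol n h s d : sorted geq (map size [seq dcol n h j | j <- iota s d]).
Proof.
apply/(sortedP 0) => i; rewrite !size_map size_iota => hi.
rewrite !(nth_map [::]) ?(nth_map 0) ?size_map ?size_iota ?nth_iota; try lia.
by rewrite !size_dcol /geq /= cge_anti //; lia.
Qed.

(* Both tables of columns are padded with empty columns, so that only the counts matter. *)
Lemma tab_le_dcol n g f d e : (forall j, cge 0 n g j.+1 0 = cge 0 n f j.+1 0) ->
  (forall j, d <= j -> cge 0 n g j.+1 0 = 0) -> (forall j, e <= j -> cge 0 n f j.+1 0 = 0) ->
  tab_le (of_cols 0 [seq dcol n g j | j <- iota 0 d]) (of_cols 0 [seq dcol n f j | j <- iota 0 e]) <->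
  forall c t, cge 0 n g c.+1 t <= cge 0 n f c.+1 t.
Proof.
move=> tot hd he.
have E h b j : (forall j, b <= j -> cge 0 n h j.+1 0 = 0) -> nth [::] [seq dcol n h j | j <- iota 0 b] j = dcol n h j.
  move=> hb; case: (ltnP j b) => hj; first by rewrite (nth_map 0) ?size_iota // nth_iota.
  rewrite nth_default ?size_map ?size_iota //; apply/esym/eqP; rewrite -size_eq0 size_dcol hb //.
have row h b r c : (forall j, b <= j -> cge 0 n h j.+1 0 = 0) -> r < size (dcol n h c) ->
    nth 0 (nth [::] (of_cols 0 [seq dcol n h j | j <- iota 0 b]) r) c = nth 0 (dcol n h c) r.
  by move=> hb hr; rewrite of_cols_row ?shape_dcol // sel_nth ?shape_dcol ?E.
have siz h b r c : (forall j, b <= j -> cge 0 n h j.+1 0 = 0) ->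
    (c < size (nth [::] (of_cols 0 [seq dcol n h j | j <- iota 0 b]) r)) = (r < size (dcol n h c)).
  by move=> hb; rewrite of_cols_row ?shape_dcol // sel_size ?shape_dcol ?E.
have ss c : size (dcol n g c) = size (dcol n f c) by rewrite !size_dcol.
split=> [h c t|h r c].
  rewrite -!count_dcol leqNgt; apply/negP => lt.
  have hr : count (leq t) (dcol n f c) < size (dcol n g c).
    by apply: leq_trans lt _; exact: count_size.
  have := h (count (leq t) (dcol n f c)) c; rewrite siz // hr !row -?ss // => /(_ isT).
  have := count_nth_leq t (sorted_dcol n g c) hr; rewrite lt => h1.
  have := @count_nth_leq t _ _ (sorted_dcol n f c); rewrite -ss => /(_ _ hr); rewrite ltnn; lia.
rewrite siz // => hr; rewrite !row -?ss //.
rewrite count_nth_leq -?ss ?sorted_dcol // count_dcol; apply: leq_trans (h _ _).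
by rewrite -count_dcol -count_nth_leq // sorted_dcol.
Qed.

Definition wv (al : seq nat) v := if v is u.+1 then nth 0 al u else 0.

Lemma key_rev_dcol n al : size al = n -> key_rev n al = of_cols 0 [seq dcol n (wv al) j | j <- iota 0 (\max_(a <- al) a)].
Proof.
move=> sa; rewrite /key_rev (iotaDl 1 0 (\max_(a <- al) a)) -map_comp; congr of_cols; apply: eq_map => j.
rewrite /dcol /=; congr rev; apply: eq_in_filter => -[|v]; rewrite ?mem_iota //=.
Qed.

Lemma wv_max n al j : size al = n -> \max_(a <- al) a <= j -> cge 0 n (wv al) j.+1 0 = 0.
Proof.
move=> sa h; apply/eqP; rewrite -leqn0 leqNgt -has_count; apply/hasPn => -[|v]; rewrite mem_lk //= => hv.
have h2 : nth 0 al v <= \max_(a <- al) a by apply: (@leq_bigmax_seq _ al predT id) => //; rewrite mem_nth ?sa.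
by have := leq_trans h2 h; lia.
Qed.

(** [QT] works with exactly [n] rows, some of them empty, whereas a tableau lists only its nonempty
    rows. *)
Definition pad n (T : seq (seq (seq nat))) := T ++ nseq (n - size T) [::].
Definition unpad (T : seq (seq (seq nat))) := [seq R <- T | R != [::]].

Lemma nth_pad n T r : nth [::] (pad n T) r = nth [::] T r.
Proof.
rewrite nth_cat; case: ltnP => // h; by rewrite nth_nseq if_same nth_default.
Qed.

Lemma unpad_pad n T : all (fun R => 0 < size R) T -> unpad (pad n T) = T.
Proof.
move=> /allP h; rewrite /unpad /pad filter_cat [X in _ ++ X](_ : _ = [::]); last first.
  by apply/eqP; rewrite -size_eq0 size_filter count_nseq.
rewrite cats0; apply/all_filterP; apply/allP => R /h; by case: R.
Qed.

Lemma pad_unpad n T : size T = n -> (forall r, rs T r.+1 <= rs T r) -> pad n (unpad T) = T.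
Proof.
move=> <- {n}; elim: T => //= R T IH h; have h' r : rs T r.+1 <= rs T r by exact: (h r.+1).
case: R h => [|C R] h; last by rewrite /unpad /= /pad /= subSS; congr (_ :: _); exact: IH.
have z r : rs T r = 0.
  by elim: r => [|r IHr]; [have := h 0; rewrite /rs /=; lia | have := h r.+1; rewrite /rs /= -/(rs T r); lia].
have e : T = nseq (size T) [::].
  apply: (@eq_from_nth _ [::]) => [|i hi]; first by rewrite size_nseq.
  by rewrite nth_nseq hi; apply/eqP; rewrite -size_eq0 -/(rs T i) z.
rewrite /unpad /= (_ : [seq R <- T | _] = [::]) /pad ?subn0 /=; first by rewrite -e.
by rewrite e; apply/eqP; rewrite -size_eq0 size_filter count_nseq.
Qed.

Lemma ent_pad n T j v : ent (pad n T) j v = ent T j v.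
Proof. by rewrite /ent has_cat [X in _ || X](_ : _ = false) ?orbF //; elim: (n - _). Qed.

Lemma cntR_pad n T j : cntR (pad n T) j = cntR T j.
Proof. by rewrite /cntR count_cat [X in _ + X](_ : _ = 0) ?addn0 // count_nseq. Qed.

Lemma shapeP (A : eqType) (T : seq (seq A)) : sorted geq (map size T) <-> forall r, size (nth [::] T r.+1) <= size (nth [::] T r).
Proof.
split=> [/(sortedP 0) h r|h].
  case: (ltnP r.+1 (size T)) => hr; last by rewrite nth_default.
  by have := h r; rewrite size_map !(nth_map [::]) // ?(ltnW hr) //; exact.
apply/(sortedP 0) => r; rewrite size_map => hr; rewrite !(nth_map [::]) ?(ltnW hr) //; exact: h.
Qed.

Lemma rsvt_pad n m T : rsvt n T -> size T <= n -> (forall r, rs T r <= m) -> QT n 0 m (pad n T).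
Proof.
case=> /andP [/shapeP sh _] [cells [rows cols]] sT hm.
have E r : rs (pad n T) r = rs T r by rewrite /rs nth_pad.
have Ec r c : cl (pad n T) r c = cl T r c by rewrite /cl nth_pad.
split=> [|r|r c|r c|r c]; rewrite ?E ?Ec.
- by rewrite size_cat size_nseq; lia.
- exact: sh.
- move=> hc; split; last by have := hm r; lia.
  have hr : r < size T by rewrite ltnNge; apply/negP => /(nth_default [::]) e; move: hc; rewrite /rs e.
  by have := allP (allP cells _ (mem_nth [::] hr)) _ (mem_nth [::] hc).
- exact: rows.
- exact: cols.
Qed.

Lemma QT_rsvt n m T : QT n 0 m T -> rsvt n (unpad T).
Proof.
move=> qT; have [sT h1 h2 h3 h4] := qT; have pu := pad_unpad sT h1.
have E r : nth [::] (unpad T) r = nth [::] T r by rewrite -[in RHS]pu nth_pad.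
split; [|split; [|split]].
- apply/andP; split; first by apply/shapeP => r; rewrite !E; exact: h1.
  by apply/allP => R; rewrite mem_filter; case: R.
- apply/(all_nthP [::]) => r _; rewrite E; apply/(all_nthP [::]) => c hc.
  by have [] := h2 r c hc.
- by move=> r c; rewrite !E; exact: h3.
- by move=> r c; rewrite !E; exact: h4.
Qed.

Lemma mem_colmax n T j v : rsvt n T -> (v \in col 0 (Lmax T) j) = ent T j v.
Proof.
move=> _; apply/mapP/hasP => [[R']|[R hR /andP [h1 /eqP h2]]].
  rewrite mem_filter => /andP [h /mapP [R hR e]] ->; exists R => //; move: h; rewrite e size_map => h.
  by rewrite h (nth_map [::]) // eqxx.
exists (map (last 0) R); first by rewrite mem_filter size_map h1 map_f.
by rewrite (nth_map [::]).
Qed.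

Lemma size_Lmax T : map size (Lmax T) = map size T.
Proof. by rewrite /Lmax -map_comp; apply: eq_map => R; rewrite /= size_map. Qed.

Lemma uniq_colmax n T j : rsvt n T -> uniq (col 0 (Lmax T) j).
Proof.
case=> /andP [sh _] [cells [_ cols]]; apply: (@sorted_uniq _ gtn).
- by move=> a b c /=; lia.
- by move=> a /=; exact: ltnn.
have shL : sorted geq (map size (Lmax T)) by rewrite size_Lmax.
apply/(sortedP 0) => r; rewrite -/(sel 0 j (Lmax T)) sel_size // => hr1.
have hr : j < size (nth [::] (Lmax T) r) by apply: leq_trans hr1 _; exact: (proj1 (shapeP _) shL).
rewrite !sel_nth //.
have nL i : j < size (nth [::] (Lmax T) i) -> i < size T /\ j < size (nth [::] T i).
  case: (ltnP i (size T)) => hi; first by rewrite (nth_map [::]) // size_map.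
  by rewrite nth_default // size_map.
have [a1 a2] := nL _ hr1; have [b1 b2] := nL _ hr.
rewrite /Lmax !(nth_map [::]) //; apply: leq_trans (cols r j a2) _.
have := allP (allP cells _ (mem_nth [::] b1)) _ (mem_nth [::] b2).
by move=> /(@okcell_head n 0) [_ _ /andP []].
Qed.

Lemma left_key_dcol n T g : rsvt n T -> good n 0 T g ->
  left_key_rev (Lmax T) = of_cols 0 [seq dcol n g j | j <- iota 0 (ncols T)].
Proof.
move=> rT [g1 g2 _]; rewrite /left_key_rev; have nc : ncols (Lmax T) = ncols T.
  by rewrite /ncols; case: (T) => //= R T' ; rewrite size_map.
rewrite nc; congr of_cols; apply/eq_in_map => j; rewrite mem_iota => hj.
have bnd i : all (fun x => x < n.+1) (col 0 (Lmax T) i) /\ all (leq 1) (col 0 (Lmax T) i).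
  have cb v : v \in col 0 (Lmax T) i -> 0 < v <= n.
    rewrite (mem_colmax _ _ rT) => /entP [r [h1 <-]]; case: rT => _ [cells _].
    have hr : r < size T by rewrite ltnNge; apply/negP => /(nth_default [::]) e; move: h1; rewrite /rs e.
    have := allP (allP cells _ (mem_nth [::] hr)) _ (mem_nth [::] h1).
    by move=> /(@okcell_head n 0) [_ a1 /andP [a2 a3]]; rewrite a3 (leq_trans a1 a2).
  by split; apply/allP => v /cb; lia.
have -> : take j.+1 (columns 0 (Lmax T)) = [seq col 0 (Lmax T) i | i <- iota 0 j.+1].
  by rewrite /columns -map_take take_iota nc (minn_idPl _) //; lia.
have [||| b1 b2 b3] := @iter_bits true (iota 0 n.+1) trie (fun x => x < n.+1) [seq col 0 (Lmax T) i | i <- iota 0 j.+1] (@trie_bits n.+1).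
- by rewrite size_map size_iota.
- by apply/allP => c /mapP [i _ ->]; case: (bnd i).
- by apply/allP => c /mapP [i _ ->]; apply: uniq_colmax rT.
set K := iter_op _ _ in b1 b2 b3 *.
have nb i : 0 \in col 0 (Lmax T) i = false by apply/negP => h; have [_ /allP /(_ _ h)] := bnd i.
have memK v : (v \in K) = (0 < v <= n) && (j < g v).
  (* The scan starts at 0 while letters start at 1, hence the leading [false]. *)
  move: b1; rewrite -map_comp Kb_KF (@eq_KF _ _ (fun i => false :: colT T (lk 0 n) i)); last first.
    move=> i _; rewrite /bits /= nb /lk subn0; congr (_ :: _); apply: eq_map => u; exact: mem_colmax rT.
  have -> : KF true (fun i => false :: colT T (lk 0 n) i) 0 j = false :: KF true (colT T (lk 0 n)) 0 j.
    by case: (j) => // i; rewrite (@KF_weak (fun=> false)).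
  rewrite g2 /bits /lk subn0 /= => -[k0 /eq_in_map kk]; case: (boolP (0 < v <= n)) => hv /=.
    by rewrite kk // mem_iota; lia.
  apply/negP => vK; have hc := b3 _ vK; rewrite /= in hc; have [/allP a1 /allP a2] := bnd 0.
  by have := a1 _ hc; have := a2 _ hc; lia.
have gt : transitive geq by move=> a b c; rewrite /geq /= => h1 h2; exact: leq_trans h2 h1.
apply: (sorted_eq gt).
- by move=> a b; rewrite /geq /= andbC; exact: anti_leq.
- by apply: sort_sorted => a b; rewrite /geq /=; exact: leq_total.
- exact: sorted_dcol.
rewrite perm_sort; apply: uniq_perm => //; first by rewrite /dcol rev_uniq filter_uniq ?iota_uniq.
by move=> v; rewrite memK mem_rev mem_filter mem_iota andbC; congr (_ && _); lia.
Qed.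

Lemma cge_supp n m h c t : n <= m -> (forall v, ~~ (0 < v <= n) -> h v = 0) -> cge 0 m h c.+1 t = cge 0 n h c.+1 t.
Proof.
move=> nm s; rewrite /cge /lk (_ : m - 0 = (n - 0) + (m - n)) ?iotaD ?count_cat; last by lia.
rewrite [X in _ + X](_ : _ = 0) ?addn0 //; apply/eqP; rewrite -leqn0 leqNgt -has_count; apply/hasP => -[v].
by rewrite mem_iota => hv; rewrite s ?andbF //; lia.
Qed.

Lemma cge01 m h c : cge 0 m h c 0 = cge 0 m h c 1.
Proof. by apply: eq_in_count => v; rewrite mem_lk => /andP [-> _]. Qed.

Lemma cge_bound n h c t : 0 < t -> cge 0 n h c t <= n.+1 - t.
Proof.
move=> t0; apply: (@leq_trans (count (leq t) (iota 1 n))).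
  by rewrite /cge /lk subn0; apply: sub_count => v /andP [].
rewrite -size_filter; case: (leqP t n.+1) => ht.
  rewrite (_ : n = (t - 1) + (n.+1 - t)); last by lia.
  rewrite iotaD filter_cat (_ : [seq _ <- iota 1 _ | _] = [::]); last first.
    by apply/eqP; rewrite -size_eq0 size_filter -leqn0 leqNgt -has_count; apply/hasPn => v; rewrite mem_iota; lia.
  by rewrite /= size_filter; apply: leq_trans (count_size _ _) _; rewrite size_iota; lia.
rewrite size_filter (_ : count _ _ = 0) //; apply/eqP; rewrite -leqn0 leqNgt -has_count.
by apply/hasPn => v; rewrite mem_iota; lia.
Qed.

(* The columns of the key of [a] are those of the key of [f], capped at [n]. *)
Definition capped n m (f a : nat -> nat) :=
  [/\ forall v, ~~ (0 < v <= m) -> f v = 0, forall v, ~~ (0 < v <= n) -> a v = 0,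
      forall c, cge 0 m f c.+1 0 <= n &
      forall c t, 0 < t -> cge 0 n a c.+1 t = minn (cge 0 m f c.+1 t) (n.+1 - t)].

Lemma capped_tot n m f a c : capped n m f a -> cge 0 n a c.+1 0 = cge 0 m f c.+1 0.
Proof. by case=> _ _ /(_ c) h1 /(_ c 1 isT); rewrite !cge01 in h1 *; lia. Qed.

(** A weight supported on [[n]] has at most [n+1-t] indices from [t] on, so the minimum with [n+1-t]
    in [capped] never affects the comparison. *)
Lemma dl_cap n m f a g : n <= m -> capped n m f a -> (forall v, ~~ (0 < v <= n) -> g v = 0) ->
  dl 0 m g f <-> dl 0 n g a.
Proof.
move=> nm cap s; have tot c := capped_tot c cap; case: cap => sf sa _ cap.
split=> -[_ d1 d2]; split=> // c; case: c => [|c].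
- by move=> t; apply: eq_leq; apply: eq_count.
- case=> [|t]; first by rewrite tot -d2 (cge_supp _ _ nm s).
  by rewrite cap // leq_min cge_bound // -(cge_supp _ _ nm s) d1.
- by apply: eq_count.
- by rewrite tot -d2 (cge_supp _ _ nm s).
- by move=> t; apply: eq_leq; apply: eq_count.
- case=> [|t]; first by rewrite -tot -d2 (cge_supp _ _ nm s).
  by rewrite (cge_supp _ _ nm s); have := d1 c.+1 t.+1; rewrite cap // leq_min => /andP [].
- by apply: eq_count.
- by rewrite -tot -d2 (cge_supp _ _ nm s).
Qed.

Lemma cnt_of_cols (A : eqType) (x0 : A) cs j : sorted geq (map size cs) ->
  count (fun R => j < size R) (of_cols x0 cs) = size (nth [::] cs j).
Proof.
move=> srt; rewrite -size_filter -(size_map (fun r => nth x0 r j)).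
have sh : sorted geq (map size (of_cols x0 cs)).
  apply/shapeP => r; rewrite !of_cols_row // leqNgt; apply/negP; rewrite sel_size // => h.
  have := @sel_size _ x0 r cs (size (sel x0 r cs)) srt; rewrite ltnn (ltnW h) //.
have E r : (r < size (sel x0 j (of_cols x0 cs))) = (r < size (nth [::] cs j)).
  by rewrite sel_size // of_cols_row // sel_size.
rewrite -/(sel x0 j (of_cols x0 cs)).
have := E (size (sel x0 j (of_cols x0 cs))); have := E (size (nth [::] cs j)); rewrite !ltnn; lia.
Qed.

Lemma sizes_eq s s' : sorted geq s -> sorted geq s' -> all (leq 1) s -> all (leq 1) s' ->
  (forall j, count (leq j.+1) s = count (leq j.+1) s') -> s = s'.
Proof.
move=> h1 h2 /[dup] p1; rewrite all_count => /eqP e1 /[dup] p2; rewrite all_count => /eqP e2 h.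
have e : size s = size s' by rewrite -e1 -e2 h.
apply: (@eq_from_nth _ 0) => // i hi.
have E t : (t < nth 0 s i) = (t < nth 0 s' i) by rewrite !count_nth_leq -?e // h.
by have := E (nth 0 s i); have := E (nth 0 s' i); rewrite !ltnn; lia.
Qed.

Lemma sumn_count s M : all (fun a => a <= M) s -> sumn s = \sum_(j < M) count (leq j.+1) s.
Proof.
elim: s => [|a s IH] /=; first by rewrite big1.
case/andP=> aM /IH ->; rewrite big_split /=; congr (_ + _).
transitivity (\sum_(j < M | j < a) 1); last by rewrite big_mkcond /=; apply: eq_bigr => j _; case: ifP.
by rewrite sum1_card -[LHS](card_ord a) -!sum1_card (big_ord_widen_cond _ predT (fun=> 1) aM).
Qed.

Lemma count_wv n al j : size al = n -> count (leq j.+1) al = cge 0 n (wv al) j.+1 0.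
Proof.
move=> sa; have e : al = [seq wv al v | v <- iota 1 n].
  apply: (@eq_from_nth _ 0) => [|i hi]; first by rewrite size_map size_iota.
  by rewrite (nth_map 0) ?size_iota -?sa // nth_iota // add1n.
by rewrite {1}e count_map /cge /lk subn0; apply: eq_count.
Qed.

Section Lascoux.
Variables (n m : nat) (f : nat -> nat) (al : seq nat).
Hypotheses (nm : n <= m) (fm : forall v, f v <= m) (sal : size al = n) (cap : capped n m f (wv al)).

Definition lasc T := rsvt n T /\ map size T = map size (key_rev n al) /\ tab_le (left_key_rev (Lmax T)) (key_rev n al).

Lemma cntR_size (T : seq (seq (seq nat))) j : cntR T j = count (leq j.+1) (map size T).
Proof. by rewrite /cntR count_map. Qed.

Lemma key_rev_cnt j : count (fun R => j < size R) (key_rev n al) = cge 0 n (wv al) j.+1 0.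
Proof.
rewrite (key_rev_dcol sal) cnt_of_cols ?shape_dcol //.
case: (ltnP j (\max_(a <- al) a)) => hj.
  by rewrite (nth_map 0) ?size_iota // nth_iota // size_dcol.
by rewrite nth_default ?size_map ?size_iota // wv_max.
Qed.

Lemma key_rev_shape : sorted geq (map size (key_rev n al)) /\ all (leq 1) (map size (key_rev n al)).
Proof.
rewrite (key_rev_dcol sal); pose cs := [seq dcol n (wv al) j | j <- iota 0 (\max_(a <- al) a)]; rewrite -/cs; have srt : sorted geq (map size cs) by apply: shape_dcol.
split.
  apply/shapeP => r; rewrite !of_cols_row // leqNgt; apply/negP; rewrite sel_size // => h.
  have := @sel_size _ 0 r cs (size (sel 0 r cs)) srt; rewrite ltnn (ltnW h) //.
apply/(all_nthP 0) => r; rewrite size_map => hr; rewrite (nth_map [::]) // of_cols_row // sel_size // nth0.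
by move: hr; rewrite /of_cols size_map size_iota.
Qed.

Lemma shape_iff T : rsvt n T -> map size T = map size (key_rev n al) <-> forall j, cntR T j = cge 0 n (wv al) j.+1 0.
Proof.
case=> /andP [sh pos] _; have [k1 k2] := key_rev_shape.
split=> [e j|h]; first by rewrite cntR_size e -key_rev_cnt count_map.
apply: sizes_eq => // [|j]; first by rewrite all_map.
by rewrite -cntR_size h -key_rev_cnt count_map.
Qed.

Lemma good_pad k T g : good n k (pad n T) g <-> good n k T g.
Proof.
have E j : colT (pad n T) (lk k n) j = colT T (lk k n) j by apply: eq_map => v; exact: ent_pad.
by split=> -[h1 h2 h3]; split=> // j; try (by rewrite h3 cntR_pad); rewrite -h2; apply: eq_KF => i _; rewrite E.
Qed.

Lemma lasc_good T g : rsvt n T -> good n 0 T g ->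
  lasc T <-> (forall j, cntR T j = cge 0 n (wv al) j.+1 0) /\ dl 0 n g (wv al).
Proof.
move=> rT gg; have := shape_iff rT; have sa v : ~~ (0 < v <= n) -> wv al v = 0 by case: cap => _ + _ _; exact.
have tg j : cge 0 n g j.+1 0 = cntR T j by exact: cge_good gg.
have E : (forall j, cntR T j = cge 0 n (wv al) j.+1 0) ->
    tab_le (left_key_rev (Lmax T)) (key_rev n al) <-> forall c t, cge 0 n g c.+1 t <= cge 0 n (wv al) c.+1 t.
  move=> tot; rewrite (left_key_dcol rT gg) (key_rev_dcol sal); apply: tab_le_dcol => j; first by rewrite tg tot.
    move=> hj; rewrite tg; apply/eqP; rewrite -leqn0 leqNgt -has_count; apply/(has_nthP [::]) => -[r hr].
    case: rT => /andP [/shapeP sh _] _.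
    have : size (nth [::] T r) <= size (nth [::] T 0) by elim: (r) => // i; apply: leq_trans.
    by rewrite nth0 -/(ncols T); lia.
  exact: wv_max.
move=> sz; split=> [[_ [/sz tot /(E tot) le]]|[tot [_ d1 d2]]].
  split=> //; split=> // [[|c] t|[|c]]; [by apply: eq_leq; apply: eq_count| exact: le |by apply: eq_count|by rewrite tg tot].
by split=> //; split; [exact/sz | apply/E].
Qed.

Lemma lasc_OKP T : OKP n m 0 m f T -> lasc (unpad T) /\ pad n (unpad T) = T.
Proof.
case=> qT [g [gg dg]]; have rT := QT_rsvt qT; have [sT h1 _ _ _] := qT.
have pu := pad_unpad sT h1; split=> //; have gu : good n 0 (unpad T) g by apply/good_pad; rewrite pu.
apply/(lasc_good rT gu); have dn : dl 0 n g (wv al) by apply/(dl_cap nm cap); case: (gg).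
by split=> // j; case: dn => _ _ <-; rewrite (cge_good (leqnn n) _ (leq0n n) gu).
Qed.

Lemma OKP_lasc T : lasc T -> OKP n m 0 m f (pad n T) /\ unpad (pad n T) = T.
Proof.
move=> lT; have [rT [sz _]] := lT; have cT := (shape_iff rT).1 sz.
have pos : all (fun R => 0 < size R) T by case: rT => /andP [].
have sT : size T <= n.
  have := cT 0; rewrite (capped_tot _ cap); case: cap => _ _ /(_ 0) + _; rewrite /cntR.
  by move: pos; rewrite all_count => /eqP ->; lia.
have rm r : rs T r <= m.
  have := cT m; rewrite (capped_tot _ cap) => e; rewrite leqNgt; apply/negP => lt.
  have : 0 < cntR T m.
    rewrite /cntR -has_count; apply/(has_nthP [::]); exists r => //.
    by rewrite ltnNge; apply/negP => /(nth_default [::]) e'; move: lt; rewrite /rs e'.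
  rewrite e -has_count => /hasP [v _ /=]; have := fm v; lia.
have qT := rsvt_pad rT sT rm; have [g gg] := good_ex (leq0n n) qT.
split; last exact: unpad_pad; split=> //; exists g; split=> //.
apply/(dl_cap nm cap); first by case: gg.
by have /(lasc_good rT) [/(_ lT) []] : good n 0 T g by apply/good_pad.
Qed.
End Lascoux.

Lemma all_flatten (A : Type) (p : pred A) ss : all p (flatten ss) = all (all p) ss.
Proof. by elim: ss => //= s ss <-; rewrite all_cat. Qed.

(** * Monomials of tableaux and the homogenizing variable *)

Section Weights.
Variables (R : comNzRingType) (n : nat).
Local Open Scope ring_scope.

(** Each variable carries a factor [X], so the power of [X] counts the letters of a term; [Phi]
    later reads the power of [beta] off it. *)
Definition xv (k : nat) : {poly {mpoly R[n]}} := (oapp (fun i : 'I_n => 'X_i) 0 (insub k : option 'I_n))%:P * 'X.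

Lemma prod_xv u : all (fun v => (0 < v <= n)%N) u ->
  \prod_(v <- u) xv v.-1 = (monomial R n (wt_seq n u))%:P * 'X^(size u).
Proof.
have nw (s : seq nat) i : (i < n)%N -> nth 0%N (wt_seq n s) i = count_mem i.+1 s.
  by move=> hi; rewrite /wt_seq (nth_map 0%N) ?size_iota // nth_iota // add1n.
elim: u => [|v u IH] /=.
  by move=> _; rewrite big_nil expr0 mulr1 /monomial big1 // => i _; rewrite nw // expr0.
case/andP=> hv /IH e; have vn : (v.-1 < n)%N by lia.
rewrite big_cons e /xv insubT /= exprS mulrACA -polyCM; congr (_%:P * _).
rewrite /monomial (bigD1 (Ordinal vn)) //= [in RHS](bigD1 (Ordinal vn)) //= mulrA; congr (_ * _).
  by rewrite -exprS !nw //= prednK ?eqxx ?add1n //; lia.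
by apply: eq_bigr => i ni; rewrite !nw //= (_ : (v == i.+1) = false) //; apply/negbTE; apply: contraNneq ni => e'; rewrite -val_eqE /= e'.
Qed.

Lemma sumn_wt u : all (fun v => (0 < v <= n)%N) u -> sumn (wt_seq n u) = size u.
Proof.
move=> h; rewrite /wt_seq sumnE big_map; elim: u h => [|v u IH] /=; first by rewrite big1.
case/andP => hv /IH e; rewrite big_split /= e -[RHS]add1n; congr (_ + _)%N.
rewrite (bigD1_seq v) ?iota_uniq ?mem_iota ?add1n ?ltnS //= eqxx big1 // => i ni.
by rewrite eq_sym (negbTE ni).
Qed.

Definition letters (T : seq (seq (seq nat))) := flatten (flatten T).

Lemma letters_ok T : rsvt n T -> all (fun v => (0 < v <= n)%N) (letters T).
Proof.
case=> _ [cells _]; rewrite /letters !all_flatten; apply: sub_all cells => R' /allP h.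
by apply/allP => C /h /and3P [].
Qed.

Lemma wt_svE T : rsvt n T -> wt_sv n T = wt_seq n (letters T).
Proof.
case=> _ [cells _]; apply: eq_map => i; rewrite /letters.
have : all uniq (flatten T).
  rewrite all_flatten; apply: sub_all cells => R' /allP h; apply/allP => C /h /and3P [_ s _].
  by apply: (@sorted_uniq _ ltn) s => //; [exact: ltn_trans | exact: ltnn].
elim: (flatten T) => //= C F IH /andP [uC /IH ->].
by rewrite count_cat (count_uniq_mem _ uC).
Qed.

Lemma wT_letters T : wT xv T = \prod_(v <- letters T) xv v.-1.
Proof. by rewrite /wT /letters !big_flatten /=. Qed.

Lemma size_letters T : rsvt n T -> (sumn (map size T) <= size (letters T))%N.
Proof.
case=> _ [cells _]; rewrite /letters -size_flatten.
have : all (fun C => 0 < size C)%N (flatten T).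
  by rewrite all_flatten; apply: sub_all cells => R' /allP h; apply/allP => C /h /and3P [].
by elim: (flatten T) => //= C F IH /andP [c /IH]; rewrite size_cat; lia.
Qed.

Lemma wT_pad (x : nat -> {poly {mpoly R[n]}}) T : wT x (pad n T) = wT x T.
Proof.
rewrite /wT big_cat /= [X in _ * X]big1_seq ?mulr1 // => R'; rewrite mem_nseq => /andP [_ /andP [_ /eqP ->]].
by rewrite /wR big_nil.
Qed.

Lemma lascoux_Fr m f al : (n <= m)%N -> (forall v, f v <= m)%N -> size al = n -> capped n m f (wv al) ->
  exists s, [/\ uniq s, forall T, T \in s <-> lasc n al T, forall T, T \in s -> (sumn al <= sumn (wt_sv n T))%N &
    Fr n m xv n f = \sum_(T <- s) (monomial R n (wt_sv n T))%:P * 'X^(sumn (wt_sv n T))].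
Proof.
move=> nm fm sal cap; have sf v : ~~ (0 < v <= m)%N -> f v = 0%N by case: cap => + _ _ _; exact.
have [s [us ms es]] := enum_Fr xv nm (leqnn n) fm sf; rewrite subnn in ms.
have L T : T \in s -> lasc n al (unpad T) /\ pad n (unpad T) = T by move/ms; exact: lasc_OKP.
have mem T : T \in map unpad s <-> lasc n al T.
  split=> [/mapP [T' /L [h _] ->] //|h].
  have [h1 h2] := OKP_lasc nm fm sal cap h.
  by rewrite -h2; apply: map_f; apply/ms.
exists (map unpad s); split=> //.
- by rewrite map_inj_in_uniq // => T T' /L [_ e] /L [_ e'] h; rewrite -e h e'.
- move=> T /mem lT; have [rT _] := lT; rewrite wt_svE // sumn_wt ?letters_ok //.
  apply: leq_trans (size_letters rT); have cT := (shape_iff sal rT).1 lT.2.1.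
  pose M := (\max_(a <- al) a + \max_(a <- map size T) a)%N.
  have bd (l : seq nat) a : a \in l -> (a <= \max_(a <- l) a)%N by move=> h; apply: (@leq_bigmax_seq _ l predT id).
  rewrite !(@sumn_count _ M); last 2 first.
    by apply/allP => a /bd h; apply: leq_trans h _; first [exact: leq_addr | exact: leq_addl].
  - by apply/allP => a /bd h; apply: leq_trans h _; first [exact: leq_addr | exact: leq_addl].
  by apply: leq_sum => j _; rewrite (count_wv _ sal) -cT cntR_size.
rewrite -es big_map big_seq [RHS]big_seq; apply: eq_bigr => T /L [[rT _] e].
by rewrite -{1}e wT_pad wT_letters prod_xv ?letters_ok // wt_svE // sumn_wt ?letters_ok.
Qed.
End Weights.

Local Close Scope ring_scope.

(** * Hecke words *)

Local Notation pw := perm_of_word.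

Lemma s_K i : involutive (s_ i).
Proof. by move=> x; rewrite /s_; do ! case: eqP => //; lia. Qed.

Lemma pw_cat a b x : pw (a ++ b) x = pw a (pw b x).
Proof. by elim: a => //= i a ->. Qed.

Lemma pw_revK a : cancel (pw a) (pw (rev a)).
Proof. by elim: a => //= i a IH x; rewrite rev_cons -cats1 pw_cat /= s_K IH. Qed.

Lemma pw_Krev a : cancel (pw (rev a)) (pw a).
Proof. by move=> x; rewrite -{1}(revK a) pw_revK. Qed.

Definition pos := all (leq 1).

(* Exchange: the crossing of two wires that end up inverted may be removed. *)
Lemma exchange b p q : pos b -> p < q -> pw b q < pw b p ->
  exists c, [/\ pos c, size c < size b & forall x, pw c x = pw b (if x == p then q else if x == q then p else x)].
Proof.
move=> + pq; elim: b => [|j b IH] /= hp lt; first by lia.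
case/andP: hp => j0 hp.
have inj : injective (pw b) by apply: can_inj (@pw_revK b).
have nij : pw b p <> pw b q by move=> /inj; lia.
case: (ltngtP (pw b p) (pw b q)) => // h; last first.
  have [c [c1 c2 c3]] := IH hp h; exists (j :: c); split=> //=; first by rewrite j0.
  by move=> x; rewrite c3.
exists b; split=> // x; have ep : pw b p = j by move: lt h; rewrite /s_; do ! case: eqP => //; lia.
have eq : pw b q = j.+1 by move: lt h; rewrite /s_; do ! case: eqP => //; lia.
case: (x =P p) => [->|xp]; first by rewrite ep eq /s_ eqxx; case: eqP => //; lia.
case: (x =P q) => [->|xq]; first by rewrite ep eq /s_ eqxx.
rewrite /s_; case: eqP => [e|_]; first by case: xp; apply: inj; rewrite e.
by case: eqP => [e|_] //; case: xq; apply: inj; rewrite e.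
Qed.

(** The action of a 0-Hecke generator, sorting the values at [i] and [i+1] into decreasing order. It
    satisfies the Hecke relations, so [dem] depends only on the Hecke class. *)
Definition op i (g : nat -> nat) z :=
  if z == i then maxn (g i) (g i.+1) else if z == i.+1 then minn (g i) (g i.+1) else g z.

Definition dem a := foldr op id a.

Lemma dem_cat a b : dem (a ++ b) = foldr op (dem b) a.
Proof. by rewrite /dem foldr_cat. Qed.

Lemma dem_hecke a b : hecke_equiv a b -> dem a = dem b.
Proof.
elim=> [//|{}a {}b|? ? _ ->|? ? ? _ -> _ ->] //.
case=> [u v i|u v i|u v i j ij]; rewrite !dem_cat; congr foldr; rewrite /dem /=;
  move: (foldr op id v) => g; apply: functional_extensionality => z; rewrite /op ?eqxx.
- by case: eqP => // _; do ! case: eqP => //; lia.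
- by do ! case: eqP => //; lia.
- by do ! case: eqP => //; lia.
Qed.

Lemma reducedS w i b : reduced_word w (i :: b) -> reduced_word (pw b) b.
Proof.
case=> /andP [i0 pb] [e mn]; split=> //; split=> // c pc ec.
have := mn (i :: c); rewrite /= i0 pc ltnS; apply=> // x.
by rewrite /= ec -e.
Qed.

(** In a reduced word every letter creates a new inversion, since otherwise [exchange] would shorten
    the word; sorting and swapping then coincide. *)
Lemma dem_reduced w b : reduced_word w b -> dem b = pw (rev b).
Proof.
elim: b w => [|i b IH] w rb //; have rb' := reducedS rb; have {IH} E := IH _ rb'.
rewrite /= -/(dem b) E; apply: functional_extensionality => z; rewrite rev_cons -cats1 pw_cat /=.
have lt : pw (rev b) i < pw (rev b) i.+1.
  rewrite ltnNge leq_eqVlt; apply/negP => /orP [/eqP /(can_inj (@pw_Krev b))|lt]; first lia.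
  case: rb => /andP [i0 pb] [e mn].
  have [|c [c1 c2 c3]] := @exchange b _ _ pb lt; first by rewrite !pw_Krev.
  have := mn c c1; rewrite /= leqNgt ltnW // => H; suff: false by []; apply: H => x.
  rewrite -e c3 /=; case: (x =P _) => [->|xp]; first by rewrite !pw_Krev /s_ eqxx; case: eqP => //; lia.
  case: (x =P _) => [->|xq]; first by rewrite !pw_Krev /s_ eqxx.
  rewrite /s_; case: eqP => [h|_]; first by case: xq; rewrite -h pw_revK.
  by case: eqP => [h|_] //; case: xp; rewrite -h pw_revK.
by rewrite /op /s_; do ! case: eqP => //; lia.
Qed.

Lemma dem_word a : pos a -> exists c, [/\ pos c, size c <= size a & dem a = pw (rev c)].
Proof.
elim: a => [|i a IH] /=; first by exists [::].
case/andP => i0 /IH [c [c1 c2 c3]]; rewrite -/(dem a) c3.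
case: (ltnP (pw (rev c) i) (pw (rev c) i.+1)) => h.
  exists (i :: c); split=> //=; first by rewrite i0.
  apply: functional_extensionality => z; rewrite rev_cons -cats1 pw_cat /= /op /s_.
  by do ! case: eqP => //; lia.
exists c; split=> //; first by rewrite ltnW.
by apply: functional_extensionality => z; rewrite /op; do ! case: eqP => [->|] //; lia.
Qed.

Lemma hecke_mem a b : hecke_equiv a b -> forall x, (x \in a) = (x \in b).
Proof.
elim=> [//|{}a {}b|? ? _ h x|? ? ? _ h1 _ h2 x]; [|by rewrite h|by rewrite h1].
by case=> [u v i|u v i|u v i j ij] x; rewrite !mem_cat !inE; do ! case: (_ == _) => //; rewrite ?orbT.
Qed.

Lemma reduced_size w b c : reduced_word w b -> reduced_word w c -> size b = size c.
Proof.
case=> p1 [e1 m1] [p2 [e2 m2]]; have := m1 c p2 e2; have := m2 b p1 e1; lia.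
Qed.

Lemma ellE w b : reduced_word w b -> ell w = size b.
Proof.
move=> rb; rewrite /ell; case: excluded_middle_informative => [H|nH]; last by case: nH; exists b.
by case: constructive_indefinite_description => c rc /=; exact: reduced_size rc rb.
Qed.

(** Dropping the letters of [a] on which the sorting action is idle leaves an ordinary word of the
    same permutation. *)
Lemma hecke_size w a : hecke_word w a -> ell w <= size a.
Proof.
case=> b [rb ab]; rewrite (ellE rb); have [pb [e mn]] := rb.
have pa : pos a by apply/allP => x; rewrite (hecke_mem ab) => /(allP pb).
have [c [c1 c2 c3]] := dem_word pa; apply: leq_trans c2; apply: mn => // x.
have E : pw (rev c) =1 pw (rev b) by move=> y; rewrite -c3 (dem_hecke ab) (dem_reduced rb).
by rewrite -e -(pw_Krev c (pw b x)) E pw_revK.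
Qed.

Lemma hecke_rev a b : hecke_equiv a b -> hecke_equiv (rev a) (rev b).
Proof.
elim=> [*|{}a {}b|? ? _ h|? ? ? _ h1 _ h2]; [exact: he_refl| |exact: he_sym|exact: he_trans h1 h2].
by case=> [u v i|u v i|u v i j ij]; rewrite !rev_cat -!catA; apply: he_step; [exact: hs_idem|exact: hs_braid|apply: hs_comm; lia].
Qed.

Lemma reduced_rev w v b : cancel w v -> cancel v w -> reduced_word w b -> reduced_word v (rev b).
Proof.
move=> wv vw [pb [e mn]]; split; first by rewrite all_rev.
split=> [x|c pc ec]; first by rewrite -{1}(vw x) -e pw_revK.
rewrite size_rev -(size_rev c); apply: mn => [|x]; first by rewrite all_rev.
by rewrite -{1}(wv x) -ec pw_revK.
Qed.

Lemma hecke_word_rev w v a : cancel w v -> cancel v w -> hecke_word w a -> hecke_word v (rev a).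
Proof.
by move=> wv vw [b [rb ab]]; exists (rev b); split; [exact: reduced_rev rb | exact: hecke_rev].
Qed.

(* Erasing the wires outside of [N+1 .. M] from the wiring diagram of [b] leaves the word [c]. *)
Section Erase.
Variables N M : nat.
Hypothesis NM : N <= M.

(** Number of kept wires among the first [y] positions behind [b], which becomes the relative
    position once the other wires are erased. *)
Definition rk b y := count (fun z => N < pw (rev b) z <= M) (iota 1 y).

Lemma rkS b y : rk b y.+1 = rk b y + (N < pw (rev b) y.+1 <= M).
Proof. by rewrite /rk -{1}[y.+1]addn1 iotaD count_cat /= addn0 add1n. Qed.

Lemma rk_mono b y z : y <= z -> rk b y <= rk b z.
Proof. by move/subnKC <-; elim: (z - y) => [|d IH]; rewrite ?addn0 // addnS rkS; lia. Qed.

Lemma rk_step i b y : 0 < i -> rk (i :: b) y = if y == i then rk b i.-1 + (N < pw (rev b) i.+1 <= M) else rk b y.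
Proof.
move=> i0; have E z : pw (rev (i :: b)) z = pw (rev b) (s_ i z) by rewrite rev_cons -cats1 pw_cat.
elim: y => [|y IH]; first by rewrite ifF //; lia.
rewrite rkS IH E /s_; case: (y =P i) => [->|ne].
  rewrite (_ : i.+1 == i = false); last by lia.
  by rewrite eqxx -[in rk b i.+1](prednK i0) !rkS prednK //; lia.
case: (y.+1 =P i) => [e|ne']; first by rewrite -e.
by rewrite rkS ifF //; lia.
Qed.

Lemma rk_total b y : rk b y <= M - N.
Proof.
rewrite /rk -size_filter -(size_map (pw (rev b))) -(size_iota N.+1 (M - N)); apply: uniq_leq_size.
  by rewrite map_inj_uniq ?filter_uniq ?iota_uniq //; exact: can_inj (@pw_Krev b).
by move=> x /mapP [z]; rewrite mem_filter => /andP [h _] ->; rewrite mem_iota; lia.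
Qed.

Definition inside := all (fun i => (N < i) && (i < M)).

Lemma inside_fix c x : inside c -> ~~ (N < x <= M) -> pw c x = x.
Proof.
by move=> + nx; elim: c => //= i c IH /andP [hi /IH ->]; rewrite /s_; do ! case: eqP => //; lia.
Qed.

Lemma inside_rev c : inside (rev c) = inside c. Proof. exact: all_rev. Qed.

Lemma erase b : pos b -> exists c, [/\ inside c, size c <= size b, 
  forall x, N < x <= M -> pw c x = N + rk b (pw b x) & size c = size b -> inside b].
Proof.
elim: b => [|i b IH] /=.
  exists [::]; split=> // x hx; rewrite /rk /=; elim: x hx => // x IHx hx.
  rewrite -{2}[x.+1]addn1 iotaD count_cat /= add1n (_ : N < x.+1 <= M) //.
  case: (boolP (N < x <= M)) => [/IHx|nx]; first by lia.
  rewrite (_ : count _ _ = 0); first by lia.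
  by apply/eqP; rewrite -leqn0 leqNgt -has_count; apply/hasPn => z; rewrite mem_iota /=; lia.
case/andP => i0 /IH [c [c1 c2 c3 c4]].
have kept x : N < x <= M -> (N < pw (rev b) (pw b x) <= M) by rewrite pw_revK.
have R y : rk b y = rk b y.-1 + (0 < y) && (N < pw (rev b) y <= M).
  by case: y => [|y]; rewrite ?addn0 // rkS.
have Ri := R i; have Ri1 := R i.+1; rewrite i0 /= in Ri Ri1.
case k1: (N < pw (rev b) i <= M) Ri; case k2: (N < pw (rev b) i.+1 <= M) Ri1 => Ri1 Ri.
(* A crossing survives only if both of its wires are kept; its new index is [N] plus the number of
   kept wires up to position [i]. *)
- exists (N + rk b i :: c); split=> //=.
  + by rewrite c1 andbT; have := rk_total b i.+1; lia.
  + move=> x hx; rewrite c3 //; have kx := kept x hx; rewrite rk_step // /s_.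
    have Ry := R (pw b x); rewrite kx andbT in Ry.
    case: (pw b x =P i) => [e|ne]; first by rewrite e; move: Ri1; rewrite addn1; do ! case: eqP => //; lia.
    case: (pw b x =P i.+1) => [e|ne']; first by rewrite e eqxx k2; do ! case: eqP => //; lia.
    rewrite (introF eqP ne); case: (ltngtP (pw b x) i) => h //.
      by have := @rk_mono b (pw b x) i.-1 ltac:(lia); do ! case: eqP => //; lia.
    by have := @rk_mono b i.+1 (pw b x).-1 ltac:(lia); do ! case: eqP => //; lia.
  + move=> [/c4 ib]; rewrite ib andbT.
    have fx z : ~~ (N < z <= M) -> pw (rev b) z = z by apply: inside_fix; rewrite inside_rev.
    case: (boolP (N < i <= M)) => hi; last by move: k1; rewrite fx // (negbTE hi).
    by case: (boolP (N < i.+1 <= M)) => hi'; [lia | move: k2; rewrite fx // (negbTE hi')].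
all: exists c; split=> //; [exact: leqW| |lia]; move=> x hx; rewrite c3 //; have kx := kept x hx; rewrite rk_step // /s_.
all: case: (pw b x =P i) => [e|ne]; first by (move: kx; rewrite e ?k1 // => _; rewrite gtn_eqF //; lia).
all: case: (pw b x =P i.+1) => [e|ne']; first by (move: kx; rewrite e ?k2 // => _; rewrite eqxx; lia).
all: by rewrite (introF eqP ne).
Qed.

(** As [w] fixes the other wires, the erased word still represents [w]. Minimality forbids any loss
    of length, and without loss every letter lies inside. *)
Lemma reduced_inside w b : (forall x, ~~ (N < x <= M) -> w x = x) -> reduced_word w b -> inside b.
Proof.
move=> fx [pb [e mn]]; have [c [c1 c2 c3 c4]] := erase pb; apply: c4.
have fr z : ~~ (N < z <= M) -> pw (rev b) z = z by move=> hz; rewrite -{1}(fx z hz) -e pw_revK.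
have fb x : N < x <= M -> N < pw b x <= M.
  move=> hx; case: (boolP (N < pw b x <= M)) => // h; have := fr _ h; rewrite pw_revK => e'.
  by move: h; rewrite -e' hx.
have rkb y : y <= M -> N <= y -> rk b y = y - N.
  elim: y => [|y IHy] yM Ny; first by rewrite /rk.
  move: Ny; rewrite leq_eqVlt => /orP [/eqP <-|Ny].
    rewrite subnn /rk; apply/eqP; rewrite -leqn0 leqNgt -has_count; apply/hasPn => z; rewrite mem_iota => hz.
    by rewrite fr; lia.
  rewrite rkS IHy; try lia; suff -> : N < pw (rev b) y.+1 <= M by lia.
  case: (boolP (N < pw (rev b) y.+1 <= M)) => // h.
  have := fx _ h; rewrite -e pw_Krev => e'; move: h; rewrite -e'; lia.
apply/eqP; rewrite eqn_leq c2; apply: mn => [|x]; first by apply: sub_all c1 => i /andP [h _]; lia.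
case: (boolP (N < x <= M)) => hx; last by rewrite (inside_fix c1 hx) fx.
by rewrite c3 // rkb -?e; have := fb x hx; lia.
Qed.
End Erase.

(** * Compatible pairs and the recursion [GG] *)

Definition rlt (p q : nat * nat) := (p.2 < q.2) || ((p.2 == q.2) && (q.1 < p.1)).

Lemma rlt_trans : transitive rlt.
Proof. by move=> [a i] [b j] [c k]; rewrite /rlt /=; lia. Qed.

Lemma compatE q : compatible (unzip1 q, unzip2 q) = sorted rlt q.
Proof.
rewrite /compatible !size_map eqxx /=.
have n1 j : j < size q -> nth 0 (unzip1 q) j = (nth (0, 0) q j).1 by move=> h; rewrite (nth_map (0, 0)).
have n2 j : j < size q -> nth 0 (unzip2 q) j = (nth (0, 0) q j).2 by move=> h; rewrite (nth_map (0, 0)).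
apply/andP/(sortedP (0, 0)) => [[/(sortedP 0) h1 /allP h2] j hj|h].
  have := h1 j; rewrite size_map => /(_ hj); have := h2 j; rewrite mem_iota.
  by rewrite !n1 ?n2 ?(ltnW hj) // => H; have := H ltac:(lia); rewrite /rlt; lia.
split; first by apply/(sortedP 0) => j; rewrite size_map => hj; rewrite !n2 ?(ltnW hj) //; have := h j hj; rewrite /rlt; lia.
apply/allP => j; rewrite mem_iota => hj; have hj' : j.+1 < size q by lia.
by rewrite !n1 ?n2 ?(ltnW hj') //; have := h j hj'; rewrite /rlt; lia.
Qed.

Section EnumG.
Variables (V : comNzRingType) (n m N : nat) (x : nat -> V).
Hypothesis Nm : N <= m.
Local Open Scope ring_scope.

(** Compatible pairs with indices above [k], stored as lists of pairs, in which the index [k+1] is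
    used only with letters at most [b]. The word is reversed because [groth] takes Hecke words of
    the inverse of [w]. *)
Definition PP k b (W : seq nat -> Prop) q :=
  [/\ sorted rlt q, all (fun p => [&& N < p.1 <= m, k < p.2 <= n & (p.2 == k.+1) ==> (p.1 <= b)]%N) q & W (rev (unzip1 q))].

Definition xw (q : seq (nat * nat)) : V := \prod_(p <- q) x p.2.-1.

Lemma PP_level k W q : PP k N W q <-> PP k.+1 m W q.
Proof. by split=> -[h1 h2 h3]; split=> //; apply: sub_all h2 => p; lia. Qed.

(** The first pair has the smallest index and, for that index, the largest letter; after reversal
    this letter is the last one, whence the right quotient. *)
Lemma PP_split k b W q : (k < n)%N -> (N <= b < m)%N -> 
  PP k b.+1 W q <-> PP k b W q \/ exists2 q', PP k b (quo W b.+1) q' & q = (b.+1, k.+1) :: q'.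
Proof.
move=> kn hb; have up W' q' : PP k b W' q' -> PP k b.+1 W' q'.
  by case=> h1 h2 h3; split=> //; apply: sub_all h2 => p; lia.
split=> [[h1 h2 h3]|[/up //|[q' [h1 h2 h3] ->]]]; last first.
  split=> /=; [|by apply/andP; split; [lia | apply: sub_all h2 => p; lia]|by rewrite rev_cons -cats1].
  rewrite (path_sortedE rlt_trans) h1 andbT; apply: sub_all h2 => p; rewrite /rlt /=; lia.
case: q h1 h2 h3 => [|[a i] q]; first by left.
rewrite /= (path_sortedE rlt_trans) => /andP [/allP h0 h1] /andP [h2 /allP h3] h4.
case: ((a, i) =P (b.+1, k.+1)) => [[ea ei]|ne].
  subst; right; exists q => //; split=> //; last by move: h4; rewrite rev_cons -cats1.
  by apply/allP => p hp; have := h3 p hp; have := h0 p hp; rewrite /rlt /=; lia.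
have ne' : ~ (a = b.+1 /\ i = k.+1) by case=> ea ei; apply: ne; rewrite ea ei.
left; split=> //=; first by rewrite (path_sortedE rlt_trans) h1 andbT; apply/allP.
apply/andP; split; first by move: h2 => /=; lia.
by apply/allP => p hp; have := h3 p hp; have := h0 p hp; rewrite /rlt /=; lia.
Qed.

Lemma enum_GG j W : (j <= n)%N -> exists s, [/\ uniq s, forall q, q \in s <-> PP (n - j) m W q & \sum_(q <- s) xw q = GG n m N x j W].
Proof.
elim: j W => [|j IH] W jn.
  have P0 q : PP (n - 0) m W q <-> q = [::] /\ W [::].
    split=> [[_ + h]|[-> h]] //; case: q h => [|p q] //= _ /andP [+ _]; lia.
  rewrite /=; case: decP => h.
    by exists [:: [::]]; split=> // [q|]; [rewrite P0 inE; split=> [/eqP ->|[->]] | rewrite big_seq1 /xw big_nil].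
  by exists [::]; rewrite big_nil; split=> // q; rewrite P0; split=> // -[].
have kn : (n - j.+1 < n)%N by lia.
have kS : ((n - j.+1).+1 = n - j)%N by lia.
have inner l : (l <= m - N)%N -> forall W, exists s, [/\ uniq s, forall q, q \in s <-> PP (n - j.+1) (N + l) W q &
    \sum_(q <- s) xw q = (SS N (GG n m N x j) l W).[x (n - j.+1)%N]].
  elim: l => [|l IHl] hl W'.
    have [s [s1 s2 s3]] := IH W' (ltnW jn); exists s; split=> // [q|]; last by rewrite /= hornerC.
    by rewrite addn0 PP_level kS.
  have [s1 [u1 m1 e1]] := IHl (ltnW hl) W'; have [s2 [u2 m2 e2]] := IHl (ltnW hl) (quo W' (N + l).+1).
  have hb : (N <= N + l < m)%N by lia.
  exists (s1 ++ map (cons ((N + l).+1, (n - j.+1).+1)) s2); split.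
  - rewrite cat_uniq u1 map_inj_uniq ?u2 ?andbT /=; last by move=> a b [].
    apply/hasPn => q /mapP [q' _ ->]; apply/negP => /m1 [_ /= /andP [+ _] _]; rewrite /= ; lia.
  - move=> q; rewrite addnS (PP_split _ _ kn hb) mem_cat; split.
      by case/orP => [/m1|/mapP [q' /m2 h ->]]; [left | right; exists q'].
    by case=> [/m1 ->|[q' /m2 h ->]] //; rewrite map_f ?orbT.
  - rewrite big_cat big_map /= hornerD hornerM hornerX -e1 -e2 mulr_sumr; congr (_ + _).
    by apply: eq_bigr => q _; rewrite /xw big_cons.
have [s [s1 s2 s3]] := inner _ (leqnn _) W; exists s; split=> // q.
by rewrite s2 subnKC.
Qed.
End EnumG.

Definition grothc n w (p : seq nat * seq nat) :=
  compatible p /\ all (fun k => (0 < k) && (k <= n)) p.2 /\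
  exists v : nat -> nat, (forall x, v (w x) = x /\ w (v x) = x) /\ hecke_word v p.1.

Lemma groth_GG (R : comNzRingType) n m N w : N <= m -> in_Splus w -> (forall x, ~~ (N < x <= m) -> w x = x) ->
  exists s, [/\ uniq s, forall p, p \in s <-> grothc n w p, forall p, p \in s -> ell w <= size p.1 &
    GG n m N (@xv R n) n (hecke_word w) = (\sum_(p <- s) (monomial R n (wt_seq n p.2))%:P * 'X^(size p.1))%R].
Proof.
move=> Nm [[v wv vw] _] fx; have [s [us ms es]] := enum_GG (@xv R n) Nm (hecke_word w) (leqnn n).
rewrite subnn in ms; pose h (q : seq (nat * nat)) := (unzip1 q, unzip2 q).
have hz p : size p.1 = size p.2 -> h (zip p.1 p.2) = p.
  by case: p => a i /= e; rewrite /h unzip1_zip ?unzip2_zip ?e.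
have hK q : zip (h q).1 (h q).2 = q by rewrite /h /= zip_unzip.
have W p : (exists v : nat -> nat, (forall x, v (w x) = x /\ w (v x) = x) /\ hecke_word v p.1) <-> hecke_word w (rev p.1 : seq nat).
  split=> [[v' [h1 h2]]|hw]; first by apply: hecke_word_rev h2 => x; case: (h1 x).
  exists v; split=> [x|]; first by rewrite wv vw.
  by rewrite -(revK p.1); apply: hecke_word_rev hw.
have inm a : hecke_word w a -> all (fun c => N < c <= m) a.
  case=> b [rb ab]; apply/allP => c; rewrite (hecke_mem ab) => cb.
  by have /allP /(_ c cb) := reduced_inside Nm fx rb; lia.
have mem p : p \in map h s <-> grothc n w p.
  split=> [/mapP [q /ms [h1 h2 h3] ->]|[h1 [h2 /W h3]]].
    split; first by rewrite compatE.
    split; last exact/W.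
    by rewrite /= all_map; apply: sub_all h2 => y /=; lia.
  have sz : size p.1 = size p.2 by case: p h1 {h2 h3} => a i /andP [/eqP].
  rewrite -(hz p sz); apply: map_f; apply/ms; split.
  - by rewrite -compatE -/(h _) hz.
  - have := inm _ h3; rewrite all_rev => h4; apply/allP => -[a i] hai /=.
    have := (map_f fst hai); have := (map_f snd hai); rewrite -/(unzip1 _) -/(unzip2 _) unzip1_zip ?unzip2_zip ?sz //=.
    by move=> /(allP h2) hi /(allP h4); lia.
  - by rewrite unzip1_zip ?sz.
exists (map h s); split=> //.
- by rewrite map_inj_uniq // => q q' e; rewrite -(hK q) e hK.
- by move=> p /mem [_ [_ /W /hecke_size]]; rewrite size_rev.
rewrite -es big_map big_seq [RHS]big_seq; apply: eq_bigr => q /ms [_ h2 _].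
rewrite -[size _](_ : size (unzip2 q) = _); last by rewrite !size_map.
rewrite -prod_xv ?big_map // all_map; apply: sub_all h2 => y /=; lia.
Qed.

Local Close Scope ring_scope.

(** * Increasing tableaux as fillings *)

Definition fil (P : seq (seq nat)) : filling := fun a r => a \in nth [::] P r.
Definition nonnil (A : eqType) (T : seq (seq A)) := [seq R <- T | R != [::]].
Definition tabl m p := nonnil [seq rowL p m r | r <- iota 0 m].

Lemma count_nth_geq t (A : seq nat) r : sorted ltn A -> (r < count (fun x => x <= t) A) = (r < size A) && (nth 0 A r <= t).
Proof.
elim: A r => //= a A IH r; rewrite (path_sortedE ltn_trans) => /andP [/allP h srt].
case: (leqP a t) => e.
  by case: r => [|r] /=; rewrite ?add1n ?ltnS ?e ?IH.
rewrite (_ : count _ _ = 0); last first.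
  by apply/eqP; rewrite -leqn0 leqNgt -has_count; apply/hasPn => x /h /=; lia.
case: r => [|r] /=; first by lia.
rewrite ltnS; case: (ltnP r (size A)) => // hr; have /= := h _ (mem_nth 0 hr).
by move: (nth 0 A r); lia.
Qed.

Lemma shapeE p a r : shape p a r = size (rowL p a r).
Proof.
elim: a => [|a IH] //; rewrite rowLS size_cat -IH; rewrite [LHS]/shape -/shape; by case: (p a.+1 r).
Qed.

Lemma ncols_pos (P : seq (seq nat)) : is_shape P -> forall r, (r < size P) = (0 < size (nth [::] P r)).
Proof.
case/andP => _ /allP h r; case: ltnP => hr; last by rewrite nth_default.
by rewrite h // mem_nth.
Qed.

Lemma columnP (P : seq (seq nat)) j : sorted geq (map size P) -> 
  sorted ltn (col 0 P j) <-> forall r, j < size (nth [::] P r.+1) -> nth 0 (nth [::] P r) j < nth 0 (nth [::] P r.+1) j.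
Proof.
move=> sh; rewrite -/(sel 0 j P); split=> [/(sortedP 0) h r hr|h].
  have hr' : j < size (nth [::] P r) by apply: leq_trans hr _; exact: (proj1 (shapeP _) sh).
  by have := h r; rewrite sel_size // !sel_nth //; apply.
apply/(sortedP 0) => r; rewrite sel_size // => hr.
by rewrite !sel_nth //; [exact: h | apply: leq_trans hr _; exact: (proj1 (shapeP _) sh)].
Qed.

Lemma columns_sorted (P : seq (seq nat)) : sorted geq (map size P) ->
  all (sorted ltn) (columns 0 P) <-> forall j, sorted ltn (col 0 P j).
Proof.
move=> sh; split=> [/allP h j|h]; last by apply/allP => c /mapP [j _ ->].
case: (ltnP j (ncols P)) => hj; first by apply: h; apply: map_f; rewrite mem_iota.
suff -> : col 0 P j = [::] by [].
apply/eqP; rewrite -size_eq0; have := @sel_size _ 0 j P 0 sh; rewrite nth0 -/(ncols P) [in RHS]ltnNge hj /=.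
by rewrite /sel -/(col 0 P j); case: (size _).
Qed.

Section OneP.
Variables (m : nat) (P : seq (seq nat)).
Hypotheses (incP : increasing_tableau P) (leP : all (all (fun x => x <= m)) P).
Local Notation p := (fil P).

Lemma row_sorted r : sorted ltn (nth [::] P r).
Proof.
case/and4P: incP => _ _ /allP h _; case: (ltnP r (size P)) => hr; last by rewrite nth_default.
by apply: h; rewrite mem_nth.
Qed.

Lemma row_bound r : all (fun x => 0 < x <= m) (nth [::] P r).
Proof.
case/and4P: incP => _ /allP h _ _; case: (ltnP r (size P)) => hr; last by rewrite nth_default.
apply/allP => x hx; have := allP (h _ (mem_nth [::] hr)) _ hx.
by have := allP (allP leP _ (mem_nth [::] hr)) _ hx; rewrite /=; lia.
Qed.

Lemma shape_incr : sorted geq (map size P). Proof. by case/and4P: incP => /andP []. Qed.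

Lemma col_incr j r : j < size (nth [::] P r.+1) -> nth 0 (nth [::] P r) j < nth 0 (nth [::] P r.+1) j.
Proof.
case/and4P: incP => _ _ _ h; have /(columns_sorted shape_incr) /(_ j) := h.
by move/(columnP _ shape_incr); exact.
Qed.

Lemma rowL_fil a r : rowL p a r = [seq x <- nth [::] P r | x <= a].
Proof.
apply: (irr_sorted_eq ltn_trans ltnn); try (apply: (sorted_filter ltn_trans)); [exact: iota_ltn_sorted|exact: row_sorted|].
move=> x; rewrite !mem_filter mem_iota /fil; case xL: (x \in _); rewrite ?andbF //=.
by have := allP (row_bound r) x xL; lia.
Qed.

Lemma rowL_full r : rowL p m r = nth [::] P r.
Proof. by rewrite rowL_fil; apply/all_filterP; apply: sub_all (row_bound r) => x /andP []. Qed.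

Lemma shape_full r : shape p m r = size (nth [::] P r).
Proof. by rewrite shapeE rowL_full. Qed.

Lemma shape_fil a r : shape p a r = count (fun x => x <= a) (nth [::] P r).
Proof. by rewrite shapeE rowL_fil size_filter. Qed.

Lemma shape_index a r : p a.+1 r -> shape p a r < size (nth [::] P r) /\ nth 0 (nth [::] P r) (shape p a r) = a.+1.
Proof.
move=> h; have hi : index a.+1 (nth [::] P r) < size (nth [::] P r) by rewrite index_mem.
have e := nth_index 0 h; suff -> : shape p a r = index a.+1 (nth [::] P r) by [].
set i := index _ _ in hi e *; rewrite shape_fil.
have A := @count_nth_geq a _ i (row_sorted r); rewrite hi e /= in A.
case: (posnP i) => [e0|i0]; first by rewrite e0 in A *; lia.
have := @count_nth_geq a _ i.-1 (row_sorted r).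
have -> : nth 0 (nth [::] P r) i.-1 <= a.
  rewrite -ltnS -e; have := sortedP 0 (row_sorted r) i.-1; rewrite prednK // => H; exact: H.
by lia.
Qed.

Lemma fil_tab : tab m p.
Proof.
split=> [a r h|a r h]; first by have := allP (row_bound r) a h.
have [h1 h2] := shape_index h; rewrite [X in _ < X]shape_fil.
rewrite count_nth_geq ?row_sorted //; have lt := col_incr h1; rewrite h2 in lt.
by apply/andP; split; [apply: leq_trans h1 _; exact: (proj1 (shapeP _) shape_incr) | lia].
Qed.

Lemma size_le : size P <= m.
Proof.
rewrite leqNgt; apply/negP => lt; have := ncols_pos (P := P) ltac:(by case/and4P: incP) m.
rewrite lt -shape_full => /esym; rewrite (shape_out fil_tab.2) //.
Qed.

Lemma nonnil_nth (A : eqType) (T : seq (seq A)) M : size T <= M -> nonnil [seq nth [::] T r | r <- iota 0 M] = nonnil T.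
Proof.
move=> h; rewrite -(subnKC h) iotaD map_cat -/(mkseq _ _) mkseq_nth /nonnil filter_cat.
rewrite [X in _ ++ X](_ : _ = [::]) ?cats0 //; apply/eqP; rewrite -size_eq0 size_filter -leqn0 leqNgt -has_count.
by apply/hasPn => R /mapP [r]; rewrite mem_iota add0n => /andP [hr _] ->; rewrite nth_default.
Qed.

Lemma filK : tabl m p = P.
Proof.
rewrite /tabl (eq_map rowL_full) nonnil_nth ?size_le //; apply/all_filterP.
by case/and4P: incP => /andP [_ h] _ _ _; apply: sub_all h => R; case: R.
Qed.

Lemma restrictE N : N <= m -> restrict N P = tabl N (trunc N p).
Proof.
move=> Nm; have e r : rowL (trunc N p) N r = filter (fun x => x <= N) (nth [::] P r).
  by rewrite -rowL_fil; apply: rowL_eq => b hb; rewrite /trunc hb.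
have z r : N <= r -> filter (fun x => x <= N) (nth [::] P r) = [::].
  by move=> h; rewrite -rowL_fil; apply/eqP; rewrite -size_eq0 -shapeE (shape_out fil_tab.2).
rewrite /tabl (eq_map e) /restrict -/(nonnil _).
transitivity (nonnil [seq filter (fun x => x <= N) (nth [::] P r) | r <- iota 0 (maxn N (size P))]).
  rewrite -(@nonnil_nth _ (map _ P) (maxn N (size P))) ?size_map ?leq_maxr //; congr nonnil; apply: eq_map => r.
  case: (ltnP r (size P)) => hr; first by rewrite (nth_map [::]).
  by rewrite !nth_default ?size_map.
rewrite -(subnKC (leq_maxl N (size P))) iotaD map_cat /nonnil filter_cat.
rewrite [X in _ ++ X](_ : _ = [::]) ?cats0 //; apply/eqP; rewrite -size_eq0 size_filter -leqn0 leqNgt -has_count.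
by apply/hasPn => R /mapP [r]; rewrite mem_iota => hr ->; rewrite z //; lia.
Qed.
End OneP.

Section OneF.
Variables (m : nat) (p : filling).
Hypothesis tp : tab m p.

Lemma tabl_nth r : nth [::] (tabl m p) r = rowL p m r.
Proof.
have pt := shape_part tp.2 m.
have mono i j : i <= j -> shape p m j <= shape p m i by exact: part_le.
have K d : d <= m -> nth [::] (nonnil [seq rowL p m r | r <- iota d (m - d)]) r = rowL p m (d + r).
  move e: (m - d) => k; elim: k d e r => [|k IH] d e r hd.
    rewrite /nonnil /= nth_nil; apply/esym/eqP; rewrite -size_eq0 -shapeE (shape_out tp.2) //; lia.
  rewrite /nonnil /=; case: eqP => [z|nz] /=.
    have zz i : d <= i -> rowL p m i = [::].
      by move=> hi; apply/eqP; rewrite -size_eq0 -shapeE -leqn0 (leq_trans (mono d i hi)) // shapeE z.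
    rewrite zz ?leq_addr // (_ : [seq _ <- _ | _] = [::]) ?nth_nil //.
    apply/eqP; rewrite -size_eq0 size_filter -leqn0 leqNgt -has_count; apply/hasPn => R /mapP [i].
    by rewrite mem_iota => hi ->; rewrite zz //; lia.
  case: r => [|r] /=; first by rewrite addn0.
  by rewrite -/(nonnil _) IH ?addSnnS //; lia.
by have := K 0 (leq0n m); rewrite subn0 add0n.
Qed.

Lemma tablK : fil (tabl m p) = p.
Proof.
apply: functional_extensionality => a; apply: functional_extensionality => r.
rewrite /fil tabl_nth mem_filter mem_iota; case e: (p a r) => //=.
by have := tp.1 _ _ e; lia.
Qed.

Lemma tabl_incr : increasing_tableau (tabl m p) /\ all (all (fun x => x <= m)) (tabl m p).
Proof.
have rows R : R \in tabl m p -> sorted ltn R /\ all (fun x => 0 < x <= m) R.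
  rewrite mem_filter => /andP [_ /mapP [r _ ->]]; split.
    by apply: (sorted_filter ltn_trans); exact: iota_ltn_sorted.
  by apply/allP => x; rewrite mem_filter mem_iota; lia.
have sh : sorted geq (map size (tabl m p)).
  by apply/shapeP => r; rewrite !tabl_nth -!shapeE; exact: (shape_part tp.2).
split; last by apply/allP => R /rows [_]; apply: sub_all => x /andP [].
apply/and4P; split.
- by rewrite /is_shape sh; apply/allP => R; rewrite mem_filter; case: R.
- by apply/allP => R /rows [_]; apply: sub_all => x /andP [].
- by apply/allP => R /rows [].
apply/(columns_sorted sh) => j; apply/(columnP _ sh) => r; rewrite !tabl_nth => hj.
set x := nth 0 (rowL p m r.+1) j.
have srt q a : sorted ltn (rowL p a q) by apply: (sorted_filter ltn_trans); exact: iota_ltn_sorted.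
have xr : x \in rowL p m r.+1 by rewrite mem_nth.
move: (xr); rewrite mem_filter mem_iota => /andP [px hx].
have cnt q a : a <= m -> shape p a q = count (fun y => y <= a) (rowL p m q).
  move=> am; rewrite shapeE /rowL -(subnKC am) iotaD filter_cat count_cat -size_filter.
  rewrite (_ : [seq _ <- [seq _ <- iota 1 _ | _] | _] = [seq b <- iota 1 a | p b q]); last first.
    by apply/all_filterP; apply/allP => y; rewrite mem_filter mem_iota; lia.
  rewrite [X in _ = _ + X](_ : _ = 0) ?addn0 //; apply/eqP; rewrite -leqn0 leqNgt -has_count.
  by apply/hasPn => y; rewrite mem_filter mem_iota; lia.
have e1 : j <= shape p x.-1 r.+1.
  rewrite cnt; last lia.
  case: (j) hj @x xr px hx => [|i] hi x xr px hx //; rewrite count_nth_geq // ltnW //=.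
  by have := sortedP 0 (srt r.+1 m) i hi; rewrite -/x; lia.
have px' : p x.-1.+1 r.+1 by rewrite prednK //; lia.
have := tp.2 x.-1 r px' => lt; have := leq_ltn_trans e1 lt.
by rewrite cnt ?count_nth_geq //; lia.
Qed.
End OneF.

(** * The reading word and the left key of an increasing tableau *)

Lemma he_swap u v : all (fun x => all (far x) v) u -> hecke_equiv (u ++ v) (v ++ u).
Proof.
elim: u => [|x u IH] /=; first by move=> _; rewrite cats0; exact: he_refl.
case/andP => h /IH e; apply: (he_trans (b := (x :: v) ++ u)); first exact: (he_catl [:: x] e).
by have := he_catr u (he_far h); rewrite -catA.
Qed.

Definition wcol P J := flatten [seq rev (col 0 P j) | j <- iota 0 J].

Lemma wcolS P J : wcol P J.+1 = wcol P J ++ rev (col 0 P J).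
Proof. by rewrite /wcol -{1}[J.+1]addn1 iotaD map_cat flatten_cat /= cats0. Qed.

Lemma wcol_cons R P J : J <= size R ->
  (forall i j x, i < j < size R -> x \in col 0 P j -> far (nth 0 R i) x) ->
  hecke_equiv (wcol (R :: P) J) (wcol P J ++ take J R).
Proof.
move=> + h; elim: J => [|J IH] hJ; first by rewrite take0; exact: he_refl.
rewrite !wcolS (take_nth 0) // [col 0 (R :: P) J](_ : _ = nth 0 R J :: col 0 P J); last by rewrite /col /= hJ.
rewrite rev_cons -!cats1 !catA; apply: he_catr.
apply: (he_trans (b := (wcol P J ++ take J R) ++ rev (col 0 P J))); first by apply: he_catr; apply: IH; exact: ltnW.
rewrite -!catA; apply: he_catl; apply: he_swap; apply/(all_nthP 0) => i; rewrite size_takel ?(ltnW hJ) // => hi.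
by rewrite nth_take //; apply/allP => x; rewrite mem_rev; apply: h; lia.
Qed.

Lemma wcol_more P J : sorted geq (map size P) -> ncols P <= J -> wcol P J = word P.
Proof.
move=> sh hJ; rewrite /wcol -(subnKC hJ) iotaD map_cat flatten_cat /word /columns -map_comp.
rewrite [X in _ ++ X](_ : _ = [::]) ?cats0 //; apply: size0nil; rewrite size_flatten sumnE big_map big_map big_seq.
rewrite big1 // => j; rewrite mem_iota => hj; rewrite size_rev.
have := @sel_size _ 0 j P 0 sh; rewrite nth0 -/(ncols P) /sel -/(col 0 P j); case: (size _) => // k; lia.
Qed.

Lemma incr_tail R P : increasing_tableau (R :: P) -> increasing_tableau P.
Proof.
move=> h; have sh := shape_incr h; case/and4P: (h) => /andP [s1 /= /andP [_ s2]] /= /andP [_ s3] /andP [_ s4] s5.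
have sh' : sorted geq (map size P) by move: sh => /=; apply: path_sorted.
apply/and4P; split=> //; first by rewrite /is_shape sh'.
apply/(columns_sorted sh') => j; have /(columns_sorted sh) /(_ j) := s5.
by rewrite /col /=; case: ifP => // _ /=; apply: path_sorted.
Qed.

(** Moving the top row to the end makes its entries cross only entries strictly below and strictly
    to the right; these are larger by at least two and hence commute. *)
Lemma word_rows P : increasing_tableau P -> hecke_equiv (word P) (flatten (rev P)).
Proof.
elim: P => [|R P IH] h; first exact: he_refl.
have sh := shape_incr h; have h' := incr_tail h; have sh' := shape_incr h'.
have nc : ncols P <= size R by have := proj1 (shapeP _) sh 0; rewrite /= nth0.
rewrite -(@wcol_more _ (size R)) // rev_cons -cats1 flatten_cat /= cats0.
apply: he_trans (he_catr _ (IH h')); rewrite -(@wcol_more _ (size R)) //.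
have := @wcol_cons R P (size R) (leqnn _); rewrite take_size; apply=> i j x /andP [ij jR].
case/(nthP 0) => r; rewrite -/(sel 0 j P) sel_size // => hr; rewrite sel_nth // => <-.
have srt : sorted ltn R := row_sorted h 0.
have l1 : nth 0 R i < nth 0 R j by apply: (sorted_ltn_nth ltn_trans 0 srt) => //; rewrite inE; lia.
suff l2 : nth 0 R j < nth 0 (nth [::] P r) j by apply/orP; left; rewrite addn2; exact: leq_ltn_trans l1 l2.
elim: r hr => [|r IHr] hr; first exact: (@col_incr (R :: P) h j 0 hr).
have hr' : j < size (nth [::] P r) by apply: leq_trans hr _; exact: (proj1 (shapeP _) sh').
exact: ltn_trans (IHr hr') (@col_incr (R :: P) h j r.+1 hr).
Qed.

Lemma wd_flat f R : wd f R = flatten (rev (mkseq f R)).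
Proof.
by elim: R => [|R IH] //; rewrite wdS IH /mkseq -[R.+1]addn1 iotaD map_cat /= cats1 rev_rcons.
Qed.

Lemma rword_fil m P : increasing_tableau P -> all (all (fun x => x <= m)) P -> rword (fil P) m = flatten (rev P).
Proof.
move=> h hm; rewrite /rword wd_flat /mkseq (eq_map (rowL_full h hm)) -(subnKC (size_le h hm)) iotaD map_cat.
rewrite -/(mkseq _ _) mkseq_nth rev_cat flatten_cat [X in X ++ _](_ : _ = [::]) //.
apply: size0nil; rewrite size_flatten sumnE big_map big_seq big1 // => R; rewrite mem_rev => /mapP [r].
by rewrite mem_iota add0n => /andP [hr _] ->; rewrite nth_default.
Qed.

Lemma word_rword m P : increasing_tableau P -> all (all (fun x => x <= m)) P ->
  hecke_equiv (word P) (rword (fil P) m).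
Proof. by move=> h hm; rewrite rword_fil //; exact: word_rows. Qed.

Definition ucol m (f : nat -> nat) j := [seq v <- iota 1 m | j < f v].

Lemma ob_rcons w T S s k : size T = size S -> ob w (rcons T false) (rcons S s) k = rcons (ob w T S k) false.
Proof. by elim: T S k => [|t T IH] [|s' S] k //= [e]; rewrite IH. Qed.

Lemma KF_rcons (F : nat -> bitseq) s i n : (forall j, size (F j) = s) ->
  KF false (fun j => rcons (F j) false) i n = rcons (KF false F i n) false.
Proof.
move=> h; elim: n i => [|n IH] i //.
by rewrite /= IH ob_rcons // (size_KF false (s := s)) // h.
Qed.

Lemma tot_rows m P : increasing_tableau P -> all (all (fun x => x <= m)) P ->
  forall j, cge 0 m (comp (fil P) m) j.+1 0 = count (leq j.+1) (map size P).
Proof.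
move=> h hm j; have [bal _] := comp_balanced m (fil_tab h hm).2.
have : perm_eq (map (comp (fil P) m) (iota 1 m)) (map (shape (fil P) m) (iota 0 m)).
  by apply/allP => k _; rewrite /= !count_map; apply/eqP; exact: bal.
move/permP/(_ (leq j.+1)) => e.
transitivity (count (leq j.+1) (map (comp (fil P) m) (iota 1 m))); first by rewrite count_map /cge /lk subn0.
rewrite e.
rewrite (eq_map (shape_full h hm)) (map_comp size (nth [::] P)) -(subnKC (size_le h hm)) iotaD !map_cat count_cat.
rewrite -/(mkseq _ _) mkseq_nth [X in _ + X](_ : _ = 0) ?addn0 //.
apply/eqP; rewrite -leqn0 leqNgt -has_count; apply/hasPn => x /mapP [R /mapP [r]].
by rewrite mem_iota add0n => /andP [hr _] -> ->; rewrite nth_default.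
Qed.

Section LeftKey.
Variables (m : nat) (P : seq (seq nat)).
Hypotheses (incP : increasing_tableau P) (leP : all (all (fun x => x <= m)) P).
Local Notation p := (fil P).
Local Notation f := (comp p m).

Lemma mem_colP v j : (v \in col 0 P j) <-> exists r, j < size (nth [::] P r) /\ nth 0 (nth [::] P r) j = v.
Proof.
have sh := shape_incr incP; rewrite -/(sel 0 j P); split.
  by case/(nthP 0) => r; rewrite sel_size // => hr; rewrite sel_nth //; exists r.
by case=> r [h1 <-]; rewrite -(sel_nth 0 sh h1) mem_nth // sel_size.
Qed.

Lemma mem_colb v j : v \in dn m -> (v \in col 0 P j) = colb p j v.
Proof.
rewrite mem_dn; case: v => // b hb; apply/idP/extbP => [/mem_colP [r [h1 h2]]|[r [_ h2 h3]]].
  have pr : p b.+1 r by rewrite /fil -h2 mem_nth.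
  have [k1 k2] := shape_index incP leP pr; exists r; split=> //.
    exact: tab_row (fil_tab incP leP) pr.
  have ur : uniq (nth [::] P r) by apply: (@sorted_uniq _ ltn ltn_trans ltnn); exact: row_sorted.
  by apply/eqP; rewrite -(nth_uniq 0 k1 h1 ur) k2 h2.
by have [k1 k2] := shape_index incP leP h2; apply/mem_colP; exists r; rewrite -h3.
Qed.

Lemma left_key_ucol : left_key P = of_cols 0 [seq ucol m f j | j <- iota 0 (ncols P)].
Proof.
rewrite /left_key; congr of_cols; apply/eq_in_map => j; rewrite mem_iota => hj.
have sh := shape_incr incP.
have srt i : sorted ltn (col 0 P i) by have /and4P [_ _ _ /(columns_sorted sh)] := incP; exact.
have bnd i v : v \in col 0 P i -> 0 < v <= m.
  by case/mem_colP => r [h1 <-]; apply: (allP (row_bound incP leP r)); rewrite mem_nth.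
have -> : take j.+1 (columns 0 P) = [seq col 0 P i | i <- iota 0 j.+1].
  by rewrite /columns -map_take take_iota (minn_idPl _) //; lia.
have [||| b1 b2 b3] := @iter_bits false (rev (iota 0 m.+1)) tri (fun x => x < m.+1) [seq col 0 P i | i <- iota 0 j.+1] (@tri_bits m.+1).
- by rewrite size_map size_iota.
- by apply/allP => c /mapP [i _ ->]; apply/allP => v /bnd; lia.
- by apply/allP => c /mapP [i _ ->]; apply: (@sorted_uniq _ ltn ltn_trans ltnn).
set K := iter_op _ _ in b1 b2 b3 *.
have srtK : sorted leq K.
  by rewrite /K; case: (j) => [|i] /=; [apply: sub_sorted (srt 0) => x y /ltnW | apply: sort_sorted leq_total _].
have memK v : (v \in K) = (0 < v <= m) && (j < f v).
  have el : rev (iota 0 m.+1) = rcons (dn m) 0 by rewrite /= rev_cons.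
  move: b1; rewrite el -map_comp Kb_KF (@eq_KF _ _ (fun i => rcons [seq colb p i u | u <- dn m] false)); last first.
    move=> i _; rewrite /bits /= map_rcons; congr rcons; last by apply/negP => /bnd.
    by apply/eq_in_map => u hu; exact: mem_colb.
  rewrite (@KF_rcons _ m) ?key_comp => [|i]; last by rewrite size_map size_rev size_iota.
  rewrite /bits map_rcons => /rcons_inj [/eq_in_map kk _]; case: (boolP (0 < v <= m)) => hv /=.
    by rewrite kk // mem_dn.
  by apply/negP => /b3 /=; move/bnd; rewrite (negbTE hv).
apply: (irr_sorted_eq ltn_trans ltnn).
- by rewrite ltn_sorted_uniq_leq b2.
- by apply: (sorted_filter ltn_trans); exact: iota_ltn_sorted.
by move=> v; rewrite memK mem_filter mem_iota andbC; congr (_ && _); lia.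
Qed.
End LeftKey.

Lemma count_of_cols (A : eqType) (x0 : A) (a : pred A) cs : sorted geq (map size cs) ->
  count a (flatten (of_cols x0 cs)) = \sum_(c <- cs) count a c.
Proof.
move=> srt; have hd c : c \in cs -> size c <= size (head [::] cs).
  move: srt; case: cs => //= c0 cs'; rewrite (path_sortedE (rev_trans leq_trans)) => /andP [/allP h _].
  by rewrite inE => /orP [/eqP -> //|hc]; exact: h (map_f size hc).
rewrite count_flatten sumnE !big_map.
transitivity (\sum_(0 <= r < size (head [::] cs)) \sum_(c <- cs | r < size c) (a (nth x0 c r) : nat)).
  rewrite /index_iota subn0; apply: eq_bigr => r _.
  by rewrite -sum1_count big_mkcond big_map big_filter; apply: eq_bigr => c _ /=; case: (a _).
rewrite (exchange_big_dep predT) //= big_seq [RHS]big_seq; apply: eq_bigr => c hc.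
rewrite -(big_nat_widen 0 (size c) _ predT) ?hd // -sum1_count -[in RHS](mkseq_nth x0 c) big_map [RHS]big_mkcond.
by rewrite /index_iota subn0; apply: eq_bigr => r _ /=; case: (a _).
Qed.

Lemma columns_of_cols cs : sorted geq (map size cs) -> all (fun c => 0 < size c) cs -> columns 0 (of_cols 0 cs) = cs.
Proof.
move=> srt /allP ne; have nc : ncols (of_cols 0 cs) = size cs.
  rewrite /ncols -nth0 of_cols_row // /sel size_map; congr size; exact/all_filterP/allP.
have sh : sorted geq (map size (of_cols 0 cs)).
  apply/shapeP => r; rewrite !of_cols_row // leqNgt; apply/negP; rewrite sel_size // => h.
  by have := @sel_size _ 0 r cs (size (sel 0 r cs)) srt; rewrite ltnn (ltnW h).
apply: (@eq_from_nth _ [::]) => [|j]; rewrite /columns size_map size_iota nc // => hj.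
rewrite (nth_map 0) ?size_iota // nth_iota // add0n -/(sel 0 j _).
have E r : (r < size (sel 0 j (of_cols 0 cs))) = (r < size (nth [::] cs j)).
  by rewrite sel_size // of_cols_row // sel_size.
have sz : size (sel 0 j (of_cols 0 cs)) = size (nth [::] cs j).
  have := E (size (sel 0 j (of_cols 0 cs))); have := E (size (nth [::] cs j)); rewrite !ltnn; lia.
apply: (@eq_from_nth _ 0) => // r hr; rewrite sel_nth //; last by rewrite -(sel_size 0) // -sz.
by rewrite of_cols_row // sel_nth // -sz.
Qed.

(** * Capping the left key at [n] *)

Lemma take_gtn (B : seq nat) q v : sorted gtn B -> v \in B -> (v \in take q B) = (count (ltn v) B < q).
Proof.
have gt : transitive gtn by move=> a b c /= h1 h2; exact: ltn_trans h2 h1.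
elim: B q => //= b B IH q; rewrite (path_sortedE gt) => /andP [/allP h srt]; rewrite inE.
case: q => [|q]; first by rewrite in_nil; lia.
rewrite inE; case: (v =P b) => [-> _|_ /= hv].
  rewrite ltnn (_ : count _ _ = 0) //; apply/eqP; rewrite -leqn0 leqNgt -has_count; apply/hasPn => x /h /=; lia.
by rewrite IH //; have /= := h v hv; lia.
Qed.

Lemma count_from (a : pred nat) l t : uniq l -> t \in l ->
  count (fun v => (t <= v) && a v) l = count (fun v => (t < v) && a v) l + a t.
Proof.
move=> ul tl; have := @count_off (fun v => (t <= v) && a v) (fun v => (t < v) && a v) l t ul tl.
by rewrite leqnn ltnn addn0 => -> // v; rewrite eq_sym => h; rewrite leq_eqVlt (negbTE h).
Qed.

Lemma count_leq_iota v n : v <= n -> count (ltn v) (iota 1 n) = n - v.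
Proof.
move=> h; rewrite -{1}(subnKC h) iotaD count_cat (_ : count _ (iota 1 v) = 0); last first.
  by apply/eqP; rewrite -leqn0 leqNgt -has_count; apply/hasPn => x; rewrite mem_iota /=; lia.
rewrite -[RHS](size_iota (1 + v)) -[RHS]count_predT; apply: eq_in_count => x; rewrite mem_iota /=; lia.
Qed.

Section Cap.
Variables (n m : nat) (f : nat -> nat).
Hypothesis nm : n <= m.

(** [v] lies in the capped column if it was there already, or if the column has more than [n - v]
    entries above [v], so that the replacements fill the gaps down to [v]. *)
Definition capc c v := (0 < v <= n) && ((c < f v) || (n - v < cge 0 m f c.+1 v.+1)).

Lemma capc_anti c d v : c <= d -> capc d v -> capc c v.
Proof.
move=> cd /andP [h1 h2]; rewrite /capc h1; case/orP: h2 => h2; first by rewrite (leq_ltn_trans cd h2).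
by rewrite (leq_trans h2) ?orbT //; apply: cge_anti.
Qed.

Lemma cap_colP c : uniq (cap_col n (ucol m f c)) /\ forall v, (v \in cap_col n (ucol m f c)) = capc c v.
Proof.
set U := ucol m f c; rewrite /cap_col; set q := count _ U.
have gt : transitive geq by move=> a b e; rewrite /geq /= => h1 h2; exact: leq_trans h2 h1.
have eB : sort geq [seq i <- iota 1 n | i \notin U] = rev [seq i <- iota 1 n | i \notin U].
  apply: (sorted_eq gt); first by move=> a b; rewrite /geq /= andbC; exact: anti_leq.
  - by apply: sort_sorted => a b; rewrite /geq /=; exact: leq_total.
  - by rewrite rev_sorted; apply: sorted_filter; [exact: leq_trans | exact: iota_sorted].
  - by rewrite perm_sort perm_sym perm_rev.
rewrite eB; set B := rev _.
have sB : sorted gtn B by rewrite rev_sorted; apply: (sorted_filter ltn_trans); exact: iota_ltn_sorted.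
have mB v : (v \in B) = (0 < v <= n) && (v \notin U) by rewrite mem_rev mem_filter mem_iota; case: (_ \notin _) => /=; lia.
have mU v : (v \in U) = (0 < v <= m) && (c < f v) by rewrite mem_filter mem_iota; lia.
have uB : uniq B by rewrite rev_uniq filter_uniq ?iota_uniq.
split.
  rewrite sort_uniq cat_uniq filter_uniq ?filter_uniq ?iota_uniq // take_uniq // andbT.
  by apply/hasPn => v /mem_take; rewrite mB => /andP [_ vU]; rewrite /= mem_filter (negbTE vU) andbF.
move=> v; rewrite mem_sort mem_cat mem_filter mU /capc.
case: (boolP (0 < v <= n)) => hv /=; last first.
  apply/negP => /orP [/andP [h1 /andP [h2 _]]|/mem_take]; last by rewrite mB (negbTE hv).
  by move: hv; rewrite h1; lia.
have -> : (v <= n) && ((0 < v <= m) && (c < f v)) = (c < f v) by lia.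
case: (ltnP c (f v)) => cv //=.
have vB : v \in B by rewrite mB hv mU; lia.
rewrite take_gtn //.
have e1 : count (ltn v) B + cge 0 n f c.+1 v.+1 = n - v.
  rewrite -count_leq_iota; last lia.
  rewrite count_rev count_filter /cge /lk subn0 -count_predUI [X in _ + X](_ : _ = 0) ?addn0.
    by apply: eq_in_count => x; rewrite mem_iota /= mU => hx; case: (ltnP v x) => //=; lia.
  by apply/eqP; rewrite -leqn0 leqNgt -has_count; apply/hasPn => x; rewrite mem_iota /= mU; lia.
have e2 : cge 0 m f c.+1 v.+1 = cge 0 n f c.+1 v.+1 + q.
  rewrite /q /U /ucol count_filter /cge /lk !subn0 -(subnKC nm) !iotaD !count_cat.
  rewrite [X in _ = _ + (X + _)](_ : _ = 0); last first.
    by apply/eqP; rewrite -leqn0 leqNgt -has_count; apply/hasPn => x; rewrite mem_iota /=; lia.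
  by rewrite add0n; congr (_ + _); apply: eq_in_count => x; rewrite mem_iota /=; lia.
by rewrite e2; lia.
Qed.

Lemma cap_count c t : 0 < t -> 
  count (fun v => (t <= v) && capc c v) (iota 1 n) = minn (cge 0 m f c.+1 t) (n.+1 - t).
Proof.
move=> t0; case: (leqP t n.+1) => tn; last first.
  rewrite (_ : n.+1 - t = 0) ?minn0; last by lia.
  by apply/eqP; rewrite -leqn0 leqNgt -has_count; apply/hasPn => x; rewrite mem_iota /=; lia.
move e: (n.+1 - t) => d; elim: d t t0 tn e => [|d IH] t t0 tn e.
  rewrite minn0; apply/eqP; rewrite -leqn0 leqNgt -has_count; apply/hasPn => x; rewrite mem_iota /=; lia.
rewrite count_from ?iota_uniq ?mem_iota //; last by lia.
have -> : cge 0 m f c.+1 t = cge 0 m f c.+1 t.+1 + (c < f t).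
  by apply: (@count_from (fun v => c < f v)); [exact: iota_uniq | rewrite mem_iota; lia].
rewrite IH //; [|lia|lia]; rewrite /capc (_ : n - t = d); last by lia.
have -> : 0 < t <= n by lia.
by case: (c < f t) => /=; lia.
Qed.

End Cap.

(** Recovers the columns of a key from its weight: an entry of the weight counts the nested columns
    that contain the letter. *)
Lemma sum_thr (b : nat -> bool) J c : (forall i j, i <= j -> b j -> b i) -> (forall j, J <= j -> ~~ b j) ->
  (c < \sum_(j < J) b j) = b c.
Proof.
move=> anti out; suff H d : (c < \sum_(j < d) b j) = b c && (c < d).
  by rewrite H; case: (ltnP c J) => [|/out /negbTE ->]; rewrite ?andbT.
elim: d => [|d IH]; first by rewrite big_ord0 andbF.
have le : \sum_(j < d) b j <= d by rewrite -[X in _ <= X]card_ord -sum1_card; apply: leq_sum => i _; case: (b i).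
have full : b d -> \sum_(j < d) b j = d.
  move=> bd; rewrite -[RHS]card_ord -sum1_card; apply: eq_bigr => i _; rewrite (anti i d _ bd) //.
  exact: ltnW.
rewrite big_ord_recr /=; case bd: (b d); last first.
  rewrite addn0 IH; case: (ltngtP c d) => h; [|by rewrite !andbF; case: (ltnP c d.+1); lia|].
    by rewrite ltnS ltnW.
  by rewrite h bd.
rewrite full // addn1 ltnS; case: (leqP c d) => h; last by rewrite andbF.
by rewrite (anti c d h bd).
Qed.

Section Weight.
Variables (n m : nat) (P : seq (seq nat)).
Hypotheses (nm : n <= m) (incP : increasing_tableau P) (leP : all (all (fun x => x <= m)) P).
Local Notation f := (comp (fil P) m).
Local Notation J := (ncols P).

Lemma tot_out j : J <= j -> cge 0 m f j.+1 0 = 0.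
Proof.
move=> h; rewrite (tot_rows incP leP) count_map; apply/eqP; rewrite -leqn0 leqNgt -has_count.
apply/(has_nthP [::]) => -[r _ /=]; have sh := proj1 (shapeP _) (shape_incr incP).
have : size (nth [::] P r) <= size (nth [::] P 0) by elim: (r) => // i; apply: leq_trans.
by rewrite nth0 -/J; lia.
Qed.

Lemma f_le v : f v <= J.
Proof.
rewrite leqNgt; apply/negP => h; have hv : 0 < v <= m.
  by case: (boolP (0 < v <= m)) => // /comp_out e; move: h; rewrite e.
have := tot_out (leqnn J); apply/eqP; rewrite -lt0n -has_count; apply/hasP; exists v => //.
by rewrite mem_lk.
Qed.

Lemma ucol_shape : sorted geq (map size [seq ucol m f j | j <- iota 0 J]).
Proof.
apply/(sortedP 0) => i; rewrite !size_map size_iota => hi.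
rewrite !(nth_map [::]) ?(nth_map 0) ?size_map ?size_iota ?nth_iota; try lia.
by rewrite !size_filter /geq /=; apply: sub_count => v /ltnW.
Qed.

Lemma ucol_pos : all (fun c => 0 < size c) [seq ucol m f j | j <- iota 0 J].
Proof.
apply/allP => c /mapP [j]; rewrite mem_iota => hj ->.
have -> : size (ucol m f j) = cge 0 m f j.+1 0 by rewrite size_filter /cge /lk subn0.
rewrite (tot_rows incP leP) count_map -has_count; apply/(has_nthP [::]); exists 0.
  by move: hj; rewrite /ncols; case: (P).
by rewrite /= nth0 -/J; lia.
Qed.

Lemma wt_of_cols cs v : sorted geq (map size cs) -> all uniq cs -> 0 < v <= n ->
  wv (wt n (of_cols 0 cs)) v = \sum_(c <- cs) (v \in c).
Proof.
move=> srt uc hv; rewrite /wt /wt_seq; case: v hv => // v hv /=.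
rewrite (nth_map 0) ?size_iota // nth_iota // add1n count_of_cols // big_seq [RHS]big_seq.
by apply: eq_bigr => c /(allP uc) h; rewrite count_uniq_mem.
Qed.

Lemma sum_iota (F : nat -> nat) : \sum_(j <- iota 0 J) F j = \sum_(j < J) F j.
Proof. by rewrite -(big_mkord predT) /index_iota subn0. Qed.

Lemma wt_cap v : 0 < v <= n -> wv (wt n (cap n (left_key P))) v = \sum_(j < J) capc n m f j v.
Proof.
move=> hv; rewrite (left_key_ucol incP leP) /cap columns_of_cols ?ucol_shape ?ucol_pos // -map_comp.
have cP j := cap_colP f nm j.
rewrite wt_of_cols //.
- by rewrite big_map sum_iota; apply: eq_bigr => j _; rewrite /= (cP j).2.
- apply/(sortedP 0) => i; rewrite !size_map size_iota => hi.
  rewrite !(nth_map [::]) ?(nth_map 0) ?size_map ?size_iota ?nth_iota; try lia.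
  rewrite /geq /=; apply: uniq_leq_size; first by case: (cP (0 + i.+1)).
  by move=> x; rewrite !(cP _).2; apply: capc_anti; lia.
- by apply/allP => c /mapP [j _ ->]; case: (cP j).
Qed.

Lemma wv_out k (al : seq nat) v : size al = k -> ~~ (0 < v <= k) -> wv al v = 0.
Proof. by move=> <-; case: v => // v hv; rewrite /= nth_default //; lia. Qed.

Lemma capped_cap : size P <= n -> capped n m f (wv (wt n (cap n (left_key P)))).
Proof.
move=> sP; split.
- by move=> v; exact: comp_out.
- by move=> v; apply: wv_out; rewrite size_map size_iota.
- by move=> c; rewrite (tot_rows incP leP); apply: leq_trans (count_size _ _) _; rewrite size_map.
move=> c t t0; rewrite -cap_count //; rewrite /cge /lk subn0; apply: eq_in_count => v; rewrite mem_iota => hv.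
rewrite wt_cap; last by lia.
congr (_ && _); rewrite (@sum_thr (fun j => capc n m f j v)) // => [i j ij|j hj].
  exact: capc_anti.
rewrite /capc; apply/negP => /andP [_ /orP [|]]; first by have := f_le v; lia.
have := tot_out hj; have : cge 0 m f j.+1 v.+1 <= cge 0 m f j.+1 0 by apply: sub_count => x /andP [].
by lia.
Qed.

Lemma capped_id : all (all (fun x => x <= n)) (left_key P) ->
  capped n m f (wv (wt n (left_key P))).
Proof.
rewrite (left_key_ucol incP leP) => h.
have E v : 0 < v <= n -> wv (wt n (of_cols 0 [seq ucol m f j | j <- iota 0 J])) v = f v.
  move=> hv; rewrite wt_of_cols ?ucol_shape //; last first.
    by apply/allP => c /mapP [j _ ->]; rewrite filter_uniq ?iota_uniq.
  rewrite big_map sum_iota -[RHS](card_ord (f v)) -sum1_card.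
  rewrite (big_ord_widen J (fun=> 1) (f_le v)) [RHS]big_mkcond /=; apply: eq_bigr => j _.
  rewrite mem_filter mem_iota (_ : 1 <= v < 1 + m) ?andbT; last by lia.
  by case: ifP.
have out v : ~~ (0 < v <= n) -> f v = 0.
  move=> nv; case: (posnP (f v)) => // fv; have hv : 0 < v <= m.
    by case: (boolP (0 < v <= m)) => // /comp_out e; move: fv; rewrite e.
  have J0 : 0 < J := leq_trans fv (f_le v).
  have : has (pred1 v) (flatten (of_cols 0 [seq ucol m f j | j <- iota 0 J])).
    rewrite has_count count_of_cols ?ucol_shape // big_map -(prednK J0) /= big_cons ltn_addr //.
    by rewrite -has_count; apply/hasP; exists v; rewrite /= ?mem_filter ?mem_iota ?fv //; lia.
  case/hasP => x /flattenP [R hR xR] /= /eqP ex; have := allP (allP h _ hR) _ xR; lia.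
have tot c t : cge 0 n (wv (wt n (of_cols 0 [seq ucol m f j | j <- iota 0 J]))) c.+1 t = cge 0 m f c.+1 t.
  rewrite (@cge_supp n m f c t nm out); apply: eq_in_count => v; rewrite mem_lk => hv; rewrite E //.
split.
- by move=> v; exact: comp_out.
- by move=> v; apply: wv_out; rewrite size_map size_iota.
- by move=> c; rewrite -tot cge01; apply: leq_trans (@cge_bound _ _ _ 1 isT) _; lia.
- by move=> c t t0; rewrite tot; have := @cge_bound n (wv (wt n (of_cols 0 [seq ucol m f j | j <- iota 0 J]))) c.+1 t t0; rewrite tot; lia.
Qed.

Lemma sumn_capped al : size al = n -> capped n m f (wv al) -> sumn al = size (flatten P).
Proof.
move=> sal cap; rewrite size_flatten.
pose M := (\max_(a <- al) a + \max_(a <- map size P) a)%N.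
have bd (l : seq nat) a : a \in l -> (a <= \max_(a <- l) a)%N by move=> h; apply: (@leq_bigmax_seq _ l predT id).
rewrite !(@sumn_count _ M).
- by apply: eq_bigr => j _; rewrite (count_wv _ sal) (capped_tot _ cap) (tot_rows incP leP).
- by apply/allP => a /bd h; apply: leq_trans h _; first [exact: leq_addr | exact: leq_addl].
- by apply/allP => a /bd h; apply: leq_trans h _; first [exact: leq_addr | exact: leq_addl].
Qed.
End Weight.

Local Open Scope ring_scope.

(** * The product formula *)

Lemma fsum_seq (T : eqType) (V : nmodType) (A : T -> Prop) (F : T -> V) s :
  uniq s -> (forall x, x \in s <-> A x) -> fsum A F = \sum_(x <- s) F x.
Proof.
move=> us hs; rewrite /fsum; case: excluded_middle_informative => [H|[]]; last by exists s.
case: constructive_indefinite_description => s' /= [us' hs']; apply: perm_big; apply: uniq_perm => // x.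
by apply/idP/idP => /[dup] h; [move/hs'/hs | move/hs/hs'].
Qed.

Section Phi.
Variables (R : comNzRingType) (n : nat) (beta : R).
Local Notation S := {mpoly R[n]}.

(* Homogenization: the exponent of [beta] is the degree minus [c]. *)
Definition Phi c (p : {poly S}) : S := \sum_(d < size p) beta ^+ (d - c) *: p`_d.

Lemma PhiE c (p : {poly S}) B : (size p <= B)%N -> Phi c p = \sum_(d < B) beta ^+ (d - c) *: p`_d.
Proof.
move=> h; rewrite /Phi (big_ord_widen B (fun d => beta ^+ (d - c) *: p`_d) h) big_mkcond /=.
apply: eq_bigr => d _; case: ltnP => // hd; by rewrite nth_default // scaler0.
Qed.

Lemma Phi0 c : Phi c 0 = 0. Proof. by rewrite /Phi size_poly0 big_ord0. Qed.

Lemma PhiD c p q : Phi c (p + q) = Phi c p + Phi c q.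
Proof.
rewrite !(@PhiE _ _ (maxn (size p) (size q))) ?leq_maxl ?leq_maxr ?size_polyD //.
by rewrite -big_split /=; apply: eq_bigr => d _; rewrite coefD scalerDr.
Qed.

Lemma Phi_mon c a d : Phi c (a%:P * 'X^d) = beta ^+ (d - c) *: a.
Proof.
have sz : (size (a%:P * 'X^d : {poly S})%R <= d.+1)%N.
  apply: leq_trans (size_polyMleq _ _) _; rewrite size_polyXn size_polyC; case: (a != 0); lia.
rewrite (PhiE _ sz) (bigD1 ord_max) //= coefCM coefXn eqxx mulr1 big1 ?addr0 // => i ni.
by rewrite coefCM coefXn (_ : (val i == d) = false) ?mulr0 ?scaler0 //; apply: contraNF ni => /eqP e; apply/eqP/val_inj.
Qed.

Lemma Phi_sum (I : Type) (s : seq I) (P : pred I) c (F : I -> {poly S}) :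
  Phi c (\sum_(i <- s | P i) F i) = \sum_(i <- s | P i) Phi c (F i).
Proof. by apply: (big_morph (Phi c) (PhiD c) (Phi0 c)). Qed.

(** The lower bounds on the degrees make the truncated subtractions additive. *)
Lemma Phi_mul (I J : eqType) (s : seq I) (t : seq J) a b (A : I -> S) (B : J -> S) (d : I -> nat) (e : J -> nat) :
  (forall i, i \in s -> a <= d i)%N -> (forall j, j \in t -> b <= e j)%N ->
  Phi (a + b) ((\sum_(i <- s) (A i)%:P * 'X^(d i)) * (\sum_(j <- t) (B j)%:P * 'X^(e j))) =
  (\sum_(i <- s) beta ^+ (d i - a) *: A i) * (\sum_(j <- t) beta ^+ (e j - b) *: B j).
Proof.
move=> hs ht; rewrite !big_distrlr /= Phi_sum [LHS]big_seq [RHS]big_seq; apply: eq_bigr => i /hs hi.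
rewrite Phi_sum [LHS]big_seq [RHS]big_seq; apply: eq_bigr => j /ht hj.
rewrite mulrACA -polyCM -exprD Phi_mon -scalerAl -scalerAr scalerA -exprD; congr (_ ^+ _ *: _); lia.
Qed.
End Phi.

Lemma TS_eq1 (V : nmodType) m p0 (g : filling -> V) : tab m p0 -> TS m (fun q => q = p0) g = g p0.
Proof.
move=> t0; rewrite -(TS_eq (C := fun q => True /\ q = p0) (f := g)) => [|q _|//]; last by split=> [[]|].
rewrite -TS_if (TS_single _ t0) => [|p _ ne]; last by case: decP.
by case: decP => [_|[]] //; case: decP.
Qed.

Lemma capped_widen n N m f a : (N <= m)%N -> (forall v, ~~ (0 < v <= N)%N -> f v = 0%N) -> 
  capped n N f a -> capped n m f a.
Proof.
move=> Nm s [h1 h2 h3 h4]; split=> [v hv|//|c|c t t0]; first by apply: s; lia.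
- by rewrite (@cge_supp N m f c 0 Nm s).
- by rewrite (@cge_supp N m f c t Nm s) h4.
Qed.

(** The first column of the key has one element per row of [P], and a reverse tableau with letters
    in [[n]] cannot match a column of height greater than [n]. *)
Lemma Fr_zero (V : comNzRingType) (x : nat -> V) n m P : (n <= m)%N -> increasing_tableau P ->
  all (all (fun y => y <= m)%N) P -> (n < size P)%N -> Fr n m x n (comp (fil P) m) = 0.
Proof.
move=> nm incP leP sP; have fm v : (comp (fil P) m v <= m)%N by exact: comp_leq_letter.
have [s [_ ms <-]] := enum_Fr x nm (leqnn n) fm (fun v => @comp_out (fil P) m v).
rewrite big_seq big1 // => T /ms [_ [g [gg [_ _ /(_ 1%N)]]]]; rewrite subnn in gg.
rewrite subnn (tot_rows incP leP) => e; exfalso; move: e; case: gg => gs _ _.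
rewrite (@cge_supp n m g 0 0 nm gs) cge01 => e; have := @cge_bound n g 1 1 isT; rewrite e.
have -> : count (leq 1) (map size P) = size P.
  by rewrite -[RHS](size_map size); apply/eqP; rewrite -all_count all_map; case/and4P: incP => /andP [].
lia.
Qed.

Lemma hecke_letters w N m a : (N <= m)%N -> (forall x, ~~ (N < x <= m)%N -> w x = x) -> hecke_word w a ->
  all (fun c => N < c <= m)%N a.
Proof.
move=> Nm fx [b [rb ab]]; apply/allP => c; rewrite (hecke_mem ab) => cb.
by have /allP /(_ c cb) := reduced_inside Nm fx rb; lia.
Qed.

Lemma closed_hecke w : closed (hecke_word w).
Proof. by move=> a b ab [c [rc ac]]; exists c; split=> //; apply: he_trans ac; exact: he_sym. Qed.

Lemma word_big w N m P : increasing_tableau P -> all (all (fun y => y <= m)%N) P ->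
  hecke_word w [seq x <- word P | (N < x)%N] <-> hecke_word w (bigw m N (fil P)).
Proof.
move=> incP leP; apply: (closed_iff (closed_hecke (w := w))); apply: he_filter; exact: word_rword.
Qed.

(** Ensures that the truncated exponent of [beta] in the theorem is an honest difference. *)
Lemma size_big w N P : increasing_tableau P -> hecke_word w [seq x <- word P | (N < x)%N] ->
  (size (flatten (restrict N P)) + ell w <= size (flatten P))%N.
Proof.
move=> incP /(closed_hecke (he_filter N (word_rows incP))) /hecke_size; rewrite size_filter count_flatten map_rev sumn_rev -count_flatten.
have -> : size (flatten (restrict N P)) = count (fun x => x <= N)%N (flatten P).
  rewrite /restrict; elim: (P) => //= r Q IH; rewrite count_cat -IH; case: eqP => [e|_] /=.
    by rewrite -size_filter e.
  by rewrite size_cat size_filter.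
rewrite -(count_predC (fun x => x <= N)%N (flatten P)) leq_add2l.
by rewrite (eq_count (a2 := predC (fun x => x <= N)%N)) // => x /=; rewrite -ltnNge.
Qed.

Section Main.
Variables (R : comNzRingType) (beta : R) (n N m : nat) (alpha : seq nat) (P1 : seq (seq nat)) (w : nat -> nat).
Hypotheses (incP1 : increasing_tableau P1) (leP1 : all (all (fun x => x <= N)%N) P1) (nN : (n < N)%N) (Nm : (N <= m)%N).
Hypotheses (fx : forall x, ~~ (N < x <= m)%N -> w x = x).

Definition adm P := [/\ increasing_tableau P, (size P <= n)%N, restrict N P = P1 & hecke_word w [seq x <- word P | (N < x)%N]].

Lemma adm_letters P : adm P -> all (all (fun x => x <= m)%N) P.
Proof.
case=> incP _ _ hw; have := hecke_letters Nm fx hw => /allP h.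
apply/allP => r hr; apply/allP => y yr; case: (leqP y N) => hy; first lia.
suff /h : y \in [seq x <- word P | (N < x)%N] by lia.
rewrite mem_filter hy (hecke_mem (word_rows incP)); apply/flattenP; exists r => //.
by rewrite mem_rev.
Qed.

Lemma restrict_iff P : increasing_tableau P -> all (all (fun x => x <= m)%N) P ->
  restrict N P = P1 <-> trunc N (fil P) = fil P1.
Proof.
move=> incP leP; rewrite (restrictE incP leP Nm); split=> [<-|->]; last exact: filK.
by rewrite tablK //; apply: tab_trunc; exact: fil_tab leP.
Qed.

Lemma adm_iff P : increasing_tableau P -> all (all (fun x => x <= m)%N) P ->
  adm P <-> (size P <= n)%N /\ CL m N (fun q => q = fil P1) (hecke_word w) (fil P).
Proof.
move=> incP leP; have := restrict_iff incP leP; have := word_big w N incP leP; rewrite /CL /adm => h1 h2.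
by split=> [[_ ? /h2 ? /h1 ?]|[? [/h2 ? /h1 ?]]].
Qed.

Definition adms := [seq tabl m (toF t) | t : ffill m <- index_enum (ffill m : finType) &
  dec (tab m (toF t) /\ CL m N (fun q => q = fil P1) (hecke_word w) (toF t)) && (size (tabl m (toF t)) <= n)%N].

Lemma adms_uniq : uniq adms.
Proof.
rewrite map_inj_in_uniq ?filter_uniq ?index_enum_uniq // => t t'; rewrite !mem_filter.
move=> /andP [/andP [/decP [h _] _] _] /andP [/andP [/decP [h' _] _] _] e.
by rewrite -(toFK t) -(toFK t') -(tablK h) -(tablK h') e.
Qed.

Lemma adms_mem P : P \in adms <-> adm P.
Proof.
split=> [/mapP [t]|h].
  rewrite mem_filter => /andP [/andP [/decP [ht hc] hs] _] ->; have [i1 i2] := tabl_incr ht.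
  by apply/(adm_iff i1 i2); rewrite tablK.
have leP := adm_letters h; have incP : increasing_tableau P by case: h.
have tp := fil_tab incP leP; apply/mapP; exists (ofF m (fil P)); last by rewrite ofFK // filK.
rewrite mem_filter ofFK // filK // mem_index_enum andbT; have /(adm_iff incP leP) [-> hc] := h.
by rewrite andbT; apply/decP.
Qed.

Lemma main_sum (V : nmodType) (F : filling -> V) (G : seq (seq nat) -> V) :
  (forall P, increasing_tableau P -> all (all (fun x => x <= m)%N) P -> (n < size P)%N -> F (fil P) = 0) ->
  (forall P, adm P -> F (fil P) = G P) ->
  TS m (CL m N (fun q => q = fil P1) (hecke_word w)) F = fsum adm G.
Proof.
move=> h0 h1;
rewrite (fsum_seq _ adms_uniq adms_mem) big_map big_filter big_mkcondr /=.
rewrite /TS; apply: eq_bigr => t /decP [tp hc].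
have [i1 i2] := tabl_incr tp; case: leqP => hs; last by rewrite -(tablK tp) h0.
by rewrite -(tablK tp) h1 ?tablK //; apply/(adm_iff i1 i2); rewrite tablK.
Qed.
End Main.

Local Close Scope ring_scope.

Theorem theorem1p3 (R : comNzRingType) (beta : R) (n : nat) (alpha : seq nat)
  (P1 : seq (seq nat)) (N : nat) (w : nat -> nat) :
  0 < n ->
  size alpha = n ->
  increasing_tableau P1 ->
  all (all (fun x => x <= n)) (left_key P1) ->
  wt n (left_key P1) = alpha ->
  n < N ->
  all (all (fun x => x < N)) P1 ->
  in_Splus w ->
  (forall x, 1 <= x <= N -> w x = x) ->
  (lascoux n beta alpha * groth n beta w)%R =
  fsum (fun P : seq (seq nat) =>
          [/\ increasing_tableau P, size P <= n, restrict N P = P1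
            & hecke_word w [seq x <- word P | N < x]])
       (fun P => beta ^+ (size (flatten P) - ell w - sumn alpha)
                   *: lascoux n beta (wt n (cap n (left_key P))))%R.
Proof.
move=> n0 sa incP1 lk1 wt1 nN leP1 wS fixN; have [_ [w0 [M fM]]] := wS.
(* Beyond [m] the permutation [w] is the identity, so no admissible [P] has a letter larger than
   [m]. *)
pose m := maxn N M; have Nm : N <= m by exact: leq_maxl.
have nm : n <= m by exact: leq_trans (ltnW nN) Nm.
have fx x : ~~ (N < x <= m) -> w x = x.
  move=> hx; case: (posnP x) => [->|x0] //; case: (leqP x N) => h; first by apply: fixN; rewrite x0.
  by apply: fM; apply: leq_ltn_trans (leq_maxr N M) _; rewrite ltnNge; apply: contraNN hx => ->; rewrite h.
have leP1' : all (all (fun x => x <= N)) P1.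
  by apply: sub_all leP1 => r; apply: sub_all => x; exact: ltnW.
have t1 := fil_tab incP1 leP1'.
have cap0 : capped n N (comp (fil P1) N) (wv alpha) by rewrite -wt1; apply: capped_id => //; exact: ltnW.
have cap1 := capped_widen Nm (fun v => @comp_out (fil P1) N v) cap0.
have f1 v : comp (fil P1) N v <= m by apply: leq_trans Nm; exact: comp_leq_letter.
have [s1 [u1 m1 d1 e1]] := lascoux_Fr R nm f1 sa cap1.
have [s2 [u2 m2 d2 e2]] := groth_GG R n Nm wS fx.
have key := iterate (xv R n) nN Nm (fun q => q = fil P1) (leqnn n) (closed_hecke (w := w)).
rewrite (TS_eq1 _ t1) e1 e2 in key.
have -> : lascoux n beta alpha = _ := fsum_seq _ u1 m1.
have -> : groth n beta w = _ := fsum_seq _ u2 m2.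
(* [key] is the product formula without [beta], in the homogenizing variable; [Phi] restores [beta]
   on both sides. *)
rewrite -Phi_mul // -key {key e1 e2 m1 m2 u1 u2 d1 d2} Phi_sum.
pose F p := Phi beta (sumn alpha + ell w) (Fr n m (@xv R n) n (comp p m)).
pose G P : {mpoly R[n]} :=
  (beta ^+ (size (flatten P) - ell w - sumn alpha) *: lascoux n beta (wt n (cap n (left_key P))))%R.
suff: TS m (CL m N (fun q => q = fil P1) (hecke_word w)) F = fsum (adm n N P1 w) G by [].
apply: main_sum => // [P incP leP sP|P aP]; first by rewrite /F Fr_zero // Phi0.
have leP : all (all (fun x => x <= m)) P by apply: adm_letters aP.
have [incP sP rP hw] := aP.
have cap := capped_cap nm incP leP sP.
set al := wt n (cap n (left_key P)) in cap *; have sal : size al = n by rewrite size_map size_iota.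
have [s [us ms ds es]] := lascoux_Fr R nm (comp_leq_letter (fil P) m) sal cap.
rewrite /F /G -/al; have -> : lascoux n beta al = _ := fsum_seq _ us ms.
rewrite es Phi_sum scaler_sumr big_seq [RHS]big_seq; apply: eq_bigr => T /ds hT.
rewrite Phi_mon scalerA -exprD; congr (_ ^+ _ *: _)%R.
(* [alpha] has the size of [P1] and [al] that of [P], so the exponents of [beta] telescope. *)
have e1 := sumn_capped incP1 leP1' sa cap0; have e2 := sumn_capped incP leP sal cap.
by have := size_big incP hw; rewrite rP; lia.
Qed.
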